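(* (1) Let $D\subset V=\mathbb{A}^n_{\mathbb{C}}$ be a linear free divisor whose associated group $G$ is reductive. Then the number of irreducible components of $D$ equals the number of irreducible summands of the $G$-module $V$ (i.e. the number $\ell$ of summands in a decomposition $V=V_1\oplus\cdots\oplus V_\ell$ into irreducible $G$-modules). (2) Let $Q$ be a (connected) quiver and $d$ a sincere dimension vector such that $(Q,d)$ defines a linear free divisor. Then $Q$ has no oriented or unoriented cycles, i.e. the underlying graph of $Q$ is a tree.
   Context: Linear free divisors: let $V=\mathbb{A}^n_{\mathbb{C}}$ with linear coordinates $x_1,\dots,x_n$ and let $D\subset V$ be a reduced hypersurface. $\mathrm{Der}(-\log D)$ is the sheaf of vector fields $\delta$ with $\delta(f)\in(f)$ for a local reduced equation $f$ of $D$. $D$ is a linear free divisor if $\mathrm{Der}(-\log D)$ is freely generated over $\mathcal{O}_V$ by (germs of) globally defined linear vector fields, i.e. fields of the form $\sum_{i,j}a_{ij}x_j\partial/\partial x_i$ with $a_{ij}\in\mathbb{C}$. The associated group $G$ is the largest connected subgroup of $\mathrm{GL}(V)$ preserving $D$. Quivers: a quiver $Q=(Q_0,Q_1,s,t)$ has finite vertex set $Q_0$, finite arrow set $Q_1$ and source/target maps $s,t$; all quivers are assumed connected as graphs. For $d\in\mathbb{N}^{Q_0}$ put $\mathrm{Rep}(Q,d)=\bigoplus_{\alpha\in Q_1}\mathrm{Hom}(\mathbb{C}^{d_{s\alpha}},\mathbb{C}^{d_{t\alpha}})$, with the action of $\mathrm{GL}(Q,d)=\prod_{i\in Q_0}\mathrm{GL}_{d_i}(\mathbb{C})$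 by $(g_i)\cdot(x_\alpha)=(g_{t\alpha}x_\alpha g_{s\alpha}^{-1})$; it acts through $\mathrm{PGL}(Q,d)=\mathrm{GL}(Q,d)/\mathbb{C}^*\mathrm{id}$. A dimension vector $d$ is sincere if $d_i\ge1$ for all $i\in Q_0$. For $d$ sincere, $(Q,d)$ defines a linear free divisor $D$ if the discriminant (complement of the open orbit) $D$ of the action of $\mathrm{GL}(Q,d)$ on $\mathrm{Rep}(Q,d)$ is a linear free divisor with associated group $G=\mathrm{PGL}(Q,d)$; then $D$ is called a quiver linear free divisor. *)

(* Defs.v *)
From HB Require Import structures.
From mathcomp Require Import all_boot all_order all_algebra fraction.
From mathcomp Require Import complex.
From mathcomp Require Import classical_sets functions cardinality reals.
From mathcomp Require Import mpoly.
Set Implicit Arguments.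
Unset Strict Implicit.
Unset Printing Implicit Defensive.
Import Order.TTheory GRing.Theory Num.Theory.
Local Open Scope ring_scope.
Local Open Scope classical_set_scope.

(* The complex numbers are R[i] for R : realType.  The affine space A^n is
   'cV[R[i]]_n, and GL(V) acts on it by left multiplication. *)

(* Zariski topology, for a type T whose points have coordinates
   coord x : 'I_m -> K. *)
Section Zariski.
Variables (K : fieldType) (T : Type) (m : nat) (coord : T -> 'I_m -> K).

Definition zariski_closed (Z : set T) : Prop :=
  exists S : set {mpoly K[m]},
    Z = [set x | forall p, S p -> p.@[coord x] = 0].

Definition zariski_open (U : set T) : Prop := zariski_closed (~` U).

Definition zariski_connected (X : set T) : Prop :=
  X !=set0 /\
  forall Z1 Z2, zariski_closed Z1 -> zariski_closed Z2 ->
    X `<=` Z1 `|` Z2 -> X `&` (Z1 `&` Z2) = set0 -> X `<=` Z1 \/ X `<=` Z2.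

Definition zariski_irreducible (X : set T) : Prop :=
  X !=set0 /\
  forall Z1 Z2, zariski_closed Z1 -> zariski_closed Z2 ->
    X `<=` Z1 `|` Z2 -> X `<=` Z1 \/ X `<=` Z2.

Definition irreducible_components (X : set T) : set (set T) :=
  [set Y | [/\ Y `<=` X, zariski_irreducible Y &
    forall Y', Y' `<=` X -> zariski_irreducible Y' -> Y `<=` Y' -> Y' = Y]].

End Zariski.

Definition vec_coord (K : fieldType) n (x : 'cV[K]_n) : 'I_n -> K :=
  fun i => x i 0.

Definition mat_coord (K : fieldType) n (g : 'M[K]_n) : 'I_(n * n) -> K :=
  fun k => mxvec g 0 k.

Section LinearFreeDivisor.
Variables (K : fieldType) (n : nat).
Implicit Types (D : set 'cV[K]_n) (f : {mpoly K[n]}) (p : 'cV[K]_n).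

(* f generates the ideal of functions vanishing on the hypersurface D = V(f);
   the condition on msize says that f is not constant, so that D is a
   nonempty hypersurface (and D <> V). *)
Definition reduced_equation D f : Prop :=
  [/\ (1 < msize f)%N,
      D = [set x | f.@[vec_coord x] = 0] &
      forall g : {mpoly K[n]},
        (forall x, D x -> g.@[vec_coord x] = 0) -> exists h, g = h * f].

(* membership in the local ring O_{V,p}, inside the field of rational
   functions *)
Definition regular_at p : set {fraction {mpoly K[n]}} :=
  [set g | exists a b : {mpoly K[n]},
     b.@[vec_coord p] != 0 /\ g = tofrac a / tofrac b].

(* The row vector delta stands for \sum_i delta_i d/dx_i. *)
Definition apply_vf (delta : 'rV[{fraction {mpoly K[n]}}]_n) f :
    {fraction {mpoly K[n]}} :=
  \sum_(i < n) delta 0 i * tofrac (f^`M(i)).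

(* the stalk at p of Der(-log D), where D has reduced equation f *)
Definition der_log f p : set 'rV[{fraction {mpoly K[n]}}]_n :=
  [set delta : 'rV_n | (forall i, regular_at p (delta 0 i)) /\
     exists2 h, regular_at p h & apply_vf delta f = h * tofrac f].

(* the linear vector field \sum_(i, j) A i j x_j d/dx_i *)
Definition linear_vf (A : 'M[K]_n) : 'rV[{fraction {mpoly K[n]}}]_n :=
  \row_i tofrac (\sum_(j < n) A i j *: 'X_j).

(* The sheaf Der(-log D) is free on k global linear vector fields: their germs
   form a basis of the stalk over O_{V,p} at every point p. *)
Definition linear_free_divisor D : Prop :=
  exists f, reduced_equation D f /\
  exists k (A : 'I_k -> 'M[K]_n), forall p,
    [/\ forall j, der_log f p (linear_vf (A j)),
        forall delta, der_log f p delta ->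
          exists2 h : 'I_k -> {fraction {mpoly K[n]}},
            forall j, regular_at p (h j) &
            delta = \sum_(j < k) h j *: linear_vf (A j) &
        forall h : 'I_k -> {fraction {mpoly K[n]}},
          (forall j, regular_at p (h j)) ->
          \sum_(j < k) h j *: linear_vf (A j) = 0 -> forall j, h j = 0].

Definition is_subgroup (H : set 'M[K]_n) : Prop :=
  [/\ H `<=` [set g | g \in unitmx], H 1%:M,
      forall g h, H g -> H h -> H (g *m h) &
      forall g, H g -> H (invmx g)].

Definition preserves (H : set 'M[K]_n) D : Prop :=
  forall g x, H g -> D x -> D (g *m x).

(* G is the largest connected subgroup of GL(V) preserving D.  (GL(V) is open
   in 'M_n, so its Zariski topology is induced by that of 'M_n.) *)
Definition associated_group D (G : set 'M[K]_n) : Prop :=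
  [/\ is_subgroup G, zariski_connected (@mat_coord K n) G, preserves G D &
      forall H : set 'M[K]_n, is_subgroup H ->
        zariski_connected (@mat_coord K n) H -> preserves H D -> H `<=` G].

Definition unipotent (U : set 'M[K]_n) : Prop :=
  forall u, U u -> exists k, (u - 1%:M) ^+ k = 0.

(* The unipotent radical of G is trivial. *)
Definition reductive (G : set 'M[K]_n) : Prop :=
  forall U : set 'M[K]_n,
    is_subgroup U -> U `<=` G ->
    (exists2 Z, zariski_closed (@mat_coord K n) Z & U = G `&` Z) ->
    zariski_connected (@mat_coord K n) U ->
    (forall g u, G g -> U u -> U (g *m u *m invmx g)) ->
    unipotent U ->
    U = [set 1%:M].

Definition stable (G : set 'M[K]_n) (W : {vspace 'cV[K]_n}) : Prop :=
  forall g v, G g -> v \in W -> g *m v \in W.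

Definition irreducible_submodule (G : set 'M[K]_n) (W : {vspace 'cV[K]_n}) :
    Prop :=
  [/\ stable G W, W != 0%VS &
      forall U : {vspace 'cV[K]_n},
        (U <= W)%VS -> stable G U -> U = 0%VS \/ U = W].

(* V = W_1 (+) ... (+) W_l with each W_i an irreducible G-module *)
Definition irreducible_decomposition (G : set 'M[K]_n) (l : nat)
    (W : 'I_l -> {vspace 'cV[K]_n}) : Prop :=
  [/\ forall i, irreducible_submodule G (W i),
      directv (\sum_(i < l) W i)%VS &
      (\sum_(i < l) W i)%VS = fullv].

End LinearFreeDivisor.

Record quiver := Quiver {
  vertex : finType;
  arrow : finType;
  src : arrow -> vertex;
  tgt : arrow -> vertex
}.
Arguments src {q}.
Arguments tgt {q}.

Definition adjacent (Q : quiver) : rel (vertex Q) := fun i j =>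
  [exists a : arrow Q, ((src a == i) && (tgt a == j))
                    || ((src a == j) && (tgt a == i))].

Definition connected_quiver (Q : quiver) : bool :=
  (0 < #|vertex Q|)%N && [forall i, forall j, connect (@adjacent Q) i j].

(* A step (a, true) follows the arrow a, and (a, false) goes against it. *)
Definition step_src (Q : quiver) (u : arrow Q * bool) : vertex Q :=
  if u.2 then src u.1 else tgt u.1.

Definition step_tgt (Q : quiver) (u : arrow Q * bool) : vertex Q :=
  if u.2 then tgt u.1 else src u.1.

(* Cycles of the underlying multigraph: no arrow and no vertex is repeated.  A
   loop is a cycle of length 1 and two parallel or antiparallel arrows form a
   cycle of length 2.  The oriented cycles are those with all steps
   (a, true). *)
Definition quiver_cycle (Q : quiver) (c : seq (arrow Q * bool)) : bool :=
  [&& c != [::], path.cycle (fun u v => step_tgt u == step_src v) c,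
      uniq [seq u.1 | u <- c] & uniq [seq step_src u | u <- c]].

Definition is_tree (Q : quiver) : Prop :=
  connected_quiver Q /\ forall c, ~~ @quiver_cycle Q c.

Definition sincere (Q : quiver) (d : vertex Q -> nat) : Prop :=
  forall i, (0 < d i)%N.

Section QuiverRep.
Variables (K : fieldType) (Q : quiver) (d : vertex Q -> nat).

(* Rep(Q, d) is identified with 'cV_(rep_dim) by listing the matrix entries
   of a representation. *)
Definition rep_index : finType :=
  {a : arrow Q & ('I_(d (tgt a)) * 'I_(d (src a)))%type}.

Definition rep_dim : nat := #|rep_index|.

Definition rep_of (x : 'cV[K]_rep_dim) (a : arrow Q) :
    'M[K]_(d (tgt a), d (src a)) :=
  \matrix_(i, j) x (enum_rank (existT _ a (i, j) : rep_index)) 0.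

Definition vec_of (X : forall a : arrow Q, 'M[K]_(d (tgt a), d (src a))) :
    'cV[K]_rep_dim :=
  \col_k let e : rep_index := enum_val k in
         X (tag e) (tagged e).1 (tagged e).2.

Definition in_GL (g : forall i : vertex Q, 'M[K]_(d i)) : Prop :=
  forall i, g i \in unitmx.

Definition rep_act (g : forall i : vertex Q, 'M[K]_(d i))
    (x : 'cV[K]_rep_dim) : 'cV[K]_rep_dim :=
  vec_of (fun a => g (tgt a) *m rep_of x a *m invmx (g (src a))).

(* the image of GL(Q, d) in GL(Rep(Q, d)) *)
Definition GL_image : set 'M[K]_rep_dim :=
  [set P | exists2 g, in_GL g & forall x, P *m x = rep_act g x].

Definition rep_orbit (x : 'cV[K]_rep_dim) : set 'cV[K]_rep_dim :=
  [set y | exists2 g, in_GL g & y = rep_act g x].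

Definition is_discriminant (D : set 'cV[K]_rep_dim) : Prop :=
  exists2 x, zariski_open (@vec_coord K rep_dim) (rep_orbit x) &
             D = ~` rep_orbit x.

(* "G = PGL(Q, d)": the image of GL(Q, d) is the associated group of D, and the
   kernel of the action is the group of scalars, so that PGL(Q, d) is identified
   with this image. *)
Definition defines_linear_free_divisor : Prop :=
  exists D, [/\ is_discriminant D, linear_free_divisor D,
    associated_group D GL_image &
    forall g, in_GL g -> (forall x, rep_act g x = x) ->
      exists c, forall i, g i = c%:M].

End QuiverRep.

(* Main.v *)
(* Let f be a reduced equation of D and g the Lie algebra of the matrices X whose linear
   vector field multiplies f by a constant.  For a linear free divisor dim g = n, the
   discriminant of g is D, and so g contains its centralizer C in the algebra of matrices.
   The linear equations of G hold on g, because exp(tX) lies in G for X nilpotent in g, and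
   so does diag(t^nu) for integral nu such that diag(nu) is in g.

   If G is reductive, the trace form of g is nondegenerate: its radical consists of nilpotent
   matrices and by Engel's theorem lies in the Lie algebra of a connected normal unipotent
   subgroup of G.  Hence g-modules are completely reducible (Whitehead, Weyl), and C has as
   a basis the projections onto the l irreducible summands of V.  Each prime factor p_j of f
   is an eigenvector of g, for a character chi_j.  The chi_j are independent on C, because
   the forms dp_j/p_j are independent and a functional on g which kills [g, g] and C is zero.
   They separate C: a functional on g which kills [g, g] is a closed 1-form with logarithmic
   poles along D, its residues are constants c_j, and it is therefore the sum of the
   c_j chi_j; in particular this holds for X |-> tr(XY) with Y in C.  So l = dim C is the
   number of prime factors of f.

   In the quiver case the projection e of Rep(Q, d) onto the component of an arrow al
   commutes with G, so 1 + (t - 1) e is in G, i.e. it is the action of some (h_i).  Taking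
   t = 2 and comparing matrix entries gives nonzero scalars mu_i with mu_t = 2 mu_s along al
   and mu_t = mu_s along the other arrows, which excludes a cycle through al. *)

(* The group [G] is known only as the largest connected group preserving [D], and general matrices
   have no exponential over [K]. The passage from the Lie algebra to [G] therefore uses polynomial
   curves: one that forms a group and preserves [D] lies in [G] by maximality. The Jordan
   decomposition and the rationality of the weights of [f] reduce a general element to such curves.
   In the other direction, idempotents of the centralizer commute with [G] because a trace with
   integer values cannot vary on a connected group.

   Conjugation of eigenvalues takes the place of Cartan's criterion. The diagonalizable part [S] of
   [X] has a companion [T] with the conjugate eigenvalues on the same eigenspaces, and tr(XT) is a
   sum of squared moduli; if it vanishes, [X] is nilpotent. The exponents of monomials are integers,
   so [T] stays in the Lie algebra. The centre and the semisimple part are treated alike.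

   For the factors of [f] the role of the Nullstellensatz is played by [reduced_equation], by which
   [f] divides every polynomial vanishing on [D]. *)
From HB Require Import structures.
Require Import Defs.
From mathcomp Require Import all_boot all_order all_algebra fraction separable.
From mathcomp Require Import complex.
From mathcomp Require Import classical_sets functions cardinality reals.
From mathcomp Require Import boolp ring zify mpoly.
Set Implicit Arguments.
Unset Strict Implicit.
Unset Printing Implicit Defensive.
Import Order.TTheory GRing.Theory Num.Theory.
Local Open Scope ring_scope.

(** * Polynomials and linear vector fields *)

Section Functionals.
Variables (K : fieldType) (V : lmodType K) (phi : V -> K).
Hypothesis phiL : forall c x y, phi (c *: x + y) = c * phi x + phi y.

Lemma functional0 : phi 0 = 0.
Proof. by have := phiL (-1) 0 0; rewrite scaler0 addr0 mulN1r addNr. Qed.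

Lemma functionalZ c x : phi (c *: x) = c * phi x.
Proof. by rewrite -[c *: x]addr0 phiL functional0 addr0. Qed.

Lemma functionalD x y : phi (x + y) = phi x + phi y.
Proof. by rewrite -[x]scale1r phiL mul1r scale1r. Qed.

Lemma functional_sum k (c : 'I_k -> K) (x : 'I_k -> V) :
  phi (\sum_i c i *: x i) = \sum_i c i * phi (x i).
Proof. by elim/big_rec2: _ => [|i a b _ <-]; rewrite ?functional0 ?phiL. Qed.
End Functionals.

Lemma mpoly_rmorph_ext n (R : nzRingType) (S : nzRingType)
    (f g : {rmorphism {mpoly R[n]} -> S}) :
  (forall c, f c%:MP = g c%:MP) -> (forall i, f 'X_i = g 'X_i) -> f =1 g.
Proof.
move=> fgC fgX p; rewrite (mpolyE p) !rmorph_sum; apply: eq_bigr => m _.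
rewrite -mul_mpolyC !rmorphM fgC mpolyXE_id !rmorph_prod; congr (_ * _).
by apply: eq_bigr => i _; rewrite !rmorphXn fgX.
Qed.

Lemma mpoly_ind_ring n (R : nzRingType) (P : {mpoly R[n]} -> Prop) :
  (forall c, P c%:MP) -> (forall i, P 'X_i) ->
  (forall p q, P p -> P q -> P (p + q)) ->
  (forall p q, P p -> P q -> P (p * q)) -> forall p, P p.
Proof.
move=> PC PX PD PM p; rewrite (mpolyE p).
apply: (big_ind P) => [|x y|m _]; [by rewrite -mpolyC0 | exact: PD |].
rewrite -mul_mpolyC; apply: (PM) => //; rewrite mpolyXE_id.
apply: (big_ind P) => [|x y|i _]; [by rewrite -mpolyC1 | exact: PM |].
 elim: (m i) => [|k IH]; first by rewrite expr0 -mpolyC1.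
by rewrite exprS; apply: PM.
Qed.

(** * Isolating one variable of a polynomial ring *)

Section Split.
Variables (R : comNzRingType) (n : nat) (a : 'I_n.+1).

(** The distinguished variable ['X_a] becomes the univariate indeterminate. Any [a] is allowed,
    since [residue_const] eliminates a variable in which its prime has positive degree. *)
Definition split_var (i : 'I_n.+1) : {poly {mpoly R[n]}} :=
  if unlift a i is Some j then ('X_j)%:P else 'X.
Definition to_uni : {mpoly R[n.+1]} -> {poly {mpoly R[n]}} :=
  mmap (polyC \o @mpolyC n R) split_var.
HB.instance Definition _ := GRing.RMorphism.on to_uni.

Definition insert_var : {mpoly R[n]} -> {mpoly R[n.+1]} :=
  mmap (@mpolyC n.+1 R) (fun j => 'X_(lift a j)).
HB.instance Definition _ := GRing.RMorphism.on insert_var.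

Lemma to_uniC c : to_uni c%:MP = (c%:MP)%:P.
Proof. by rewrite /to_uni mmapC. Qed.

Lemma to_uniXi i : to_uni 'X_i = split_var i.
Proof. by rewrite /to_uni mmapX mmap1U. Qed.

Lemma insert_varC c : insert_var c%:MP = c%:MP.
Proof. by rewrite /insert_var mmapC. Qed.

Lemma insert_varXi j : insert_var 'X_j = 'X_(lift a j).
Proof. by rewrite /insert_var mmapX mmap1U. Qed.

Definition of_uni : {poly {mpoly R[n]}} -> {mpoly R[n.+1]} :=
  horner_eval 'X_a \o map_poly insert_var.
HB.instance Definition _ := GRing.RMorphism.on of_uni.

Lemma to_uniK : cancel to_uni of_uni.
Proof.
apply: (@mpoly_rmorph_ext _ _ _ (of_uni \o to_uni) idfun) => [c|i] /=.
  by rewrite to_uniC /of_uni /= map_polyC horner_evalE hornerC /= insert_varC.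
rewrite to_uniXi /split_var; case: unliftP => [j|] -> /=.
  by rewrite /of_uni /= map_polyC horner_evalE hornerC /= insert_varXi.
by rewrite /of_uni /= map_polyX horner_evalE hornerX.
Qed.

Lemma to_uni_insert q : to_uni (insert_var q) = q%:P.
Proof.
move: q; apply: (@mpoly_rmorph_ext _ _ _ (to_uni \o insert_var) polyC) => [c|i] /=.
  by rewrite insert_varC to_uniC.
by rewrite insert_varXi to_uniXi /split_var liftK.
Qed.

Lemma to_uniX : to_uni 'X_a = 'X.
Proof. by rewrite to_uniXi /split_var unlift_none. Qed.

Lemma of_uniK : cancel of_uni to_uni.
Proof.
move=> p; rewrite /of_uni /= horner_evalE.
rewrite -[p in RHS]coefK poly_def (horner_coef_wide _ (size_poly _ _)).
rewrite rmorph_sum; apply: eq_bigr => i _.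
rewrite rmorphM rmorphXn /= to_uniX coef_map_id0 ?rmorph0 //=.
by rewrite to_uni_insert mul_polyC.
Qed.

Lemma of_uniC q : of_uni q%:P = insert_var q.
Proof. by rewrite /of_uni /= map_polyC horner_evalE hornerC. Qed.

Lemma insert_var_deriv q : (insert_var q)^`M(a) = 0.
Proof.
elim/mpoly_ind_ring: q => [c|i|p q Hp Hq|p q Hp Hq].
- by rewrite insert_varC mderivC.
- rewrite insert_varXi mderivX mnm1E.
  by rewrite eq_sym (negbTE (neq_lift _ _)) scale0r.
- by rewrite rmorphD mderivD Hp Hq addr0.
by rewrite rmorphM mderivM Hp Hq mul0r mulr0 addr0.
Qed.

Lemma insert_var_inj : injective insert_var.
Proof.
by move=> p q e; apply: polyC_inj; rewrite -!to_uni_insert e.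
Qed.

Definition insert_val (v : 'I_n -> R) (t : R) (i : 'I_n.+1) : R :=
  if unlift a i is Some j then v j else t.

Lemma to_uni_eval (v : 'I_n -> R) t f :
  (map_poly (meval v) (to_uni f)).[t] = f.@[insert_val v t].
Proof.
move: f; apply: (@mpoly_rmorph_ext _ _ _ (horner_eval t \o map_poly (meval v) \o to_uni) (meval _)) => [c|i] /=.
  by rewrite to_uniC map_polyC horner_evalE hornerC [LHS]mevalC mevalC.
rewrite to_uniXi mevalXU /split_var /insert_val horner_evalE.
case: unlift => [j|]; first by rewrite map_polyC hornerC [LHS]mevalXU.
by rewrite map_polyX hornerX.
Qed.
End Split.

Section Infinite.
Variable K : numFieldType.

Lemma poly_eval0 (p : {poly K}) : (forall k : nat, p.[k%:R] = 0) -> p = 0.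
Proof.
move=> p0; apply/eqP/negPn/negP => nz.
have := @max_poly_roots K p [seq k%:R | k <- iota 0 (size p)] nz.
rewrite size_map size_iota ltnn => H; suff: false by []; apply: H.
  by apply/allP => x /mapP[k _ ->]; apply/rootP.
by rewrite map_inj_uniq ?iota_uniq // => i j /eqP; rewrite eqr_nat => /eqP.
Qed.

Lemma mpoly_eval0 n (f : {mpoly K[n]}) : (forall v, f.@[v] = 0) -> f = 0.
Proof.
elim: n f => [|n IH] f f0.
  apply/mpolyP => m; have -> : m = 0%MM by apply/mnmP => [[]].
  have := f0 (fun _ => 0); rewrite [f in f.@[_]](_ : f = (f@_0)%:MP) ?mevalC ?mcoeff0 //.
  apply/mpolyP => m'; have -> : m' = 0%MM by apply/mnmP => [[]].
  by rewrite mcoeffC eqxx mulr1.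
apply: (can_inj (to_uniK ord0)); rewrite rmorph0.
apply/polyP => i; rewrite coef0; apply: IH => v.
have: map_poly (meval v) (to_uni ord0 f) = 0.
  by apply: poly_eval0 => k; rewrite to_uni_eval f0.
by move/polyP/(_ i); rewrite coef_map coef0.
Qed.
End Infinite.

Section Curves.
Variables (K : comNzRingType) (n : nat).

Definition along (c : 'I_n -> {poly K}) (f : {mpoly K[n]}) : {poly K} :=
  mmap polyC c f.
HB.instance Definition _ c := GRing.RMorphism.copy (along c) (mmap polyC c).

Lemma alongC c a : along c a%:MP = a%:P.
Proof. by rewrite /along mmapC. Qed.

Lemma alongX c i : along c 'X_i = c i.
Proof. by rewrite /along mmapX mmap1U. Qed.

Lemma horner_along c f t : (along c f).[t] = f.@[fun i => (c i).[t]].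
Proof.
move: f; apply: (@mpoly_rmorph_ext _ _ _ (horner_eval t \o along c) (meval _)) => [a|i] /=.
  by rewrite alongC horner_evalE hornerC mevalC.
by rewrite alongX horner_evalE mevalXU.
Qed.

Lemma deriv_along c f :
  (along c f)^`() = \sum_(i < n) along c f^`M(i) * (c i)^`().
Proof.
elim/mpoly_ind_ring: f => [a|i|p q Hp Hq|p q Hp Hq].
- by rewrite alongC derivC big1 // => i _; rewrite mderivC rmorph0 mul0r.
- rewrite alongX (bigD1 i) //= big1 => [|j ji].
    rewrite addr0 mderivX mnm1E eqxx scale1r.
    have -> : (U_(i) - U_(i))%MM = 0%MM.
      by move=> *; apply/mnmP => j; rewrite mnmBE mnm0E subnn.
    by rewrite mpolyX0 rmorph1 mul1r.
  by rewrite mderivX mnm1E eq_sym (negbTE ji) scale0r rmorph0 mul0r.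
- rewrite rmorphD derivD Hp Hq -big_split; apply: eq_bigr => i _ /=.
  by rewrite mderivD rmorphD mulrDl.
rewrite rmorphM derivM Hp Hq mulr_suml mulr_sumr -big_split.
apply: eq_bigr => i _ /=; rewrite mderivM rmorphD !rmorphM /=.
by rewrite mulrDl mulrAC mulrA.
Qed.
End Curves.

Section LinearFields.
Variables (K : fieldType) (n : nat).
Implicit Types (A B : 'M[K]_n) (f h : {mpoly K[n]}) (u : 'rV[K]_n).

Definition lform u : {mpoly K[n]} := \sum_(j < n) u 0 j *: 'X_j.

Definition lvf A f := \sum_(i < n) lform (row i A) * f^`M(i).

Lemma lform_is_linear : linear lform.
Proof.
move=> c u v; rewrite /lform scaler_sumr -big_split; apply: eq_bigr => i _ /=.
by rewrite !mxE scalerDl scalerA.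
Qed.
HB.instance Definition _ := GRing.isLinear.Build K _ _ _ lform lform_is_linear.

Lemma lform_delta i : lform (delta_mx 0 i) = 'X_i.
Proof.
rewrite /lform (bigD1 i) //= big1 => [|j ji]; rewrite !mxE ?eqxx.
  by rewrite scale1r addr0.
by rewrite (negbTE ji) scale0r.
Qed.

Lemma lvfD A f h : lvf A (f + h) = lvf A f + lvf A h.
Proof.
by rewrite /lvf -big_split; apply: eq_bigr => i _; rewrite /= mderivD mulrDr.
Qed.

Lemma lvfZ A c f : lvf A (c *: f) = c *: lvf A f.
Proof.
by rewrite /lvf scaler_sumr; apply: eq_bigr => i _; rewrite mderivZ scalerAr.
Qed.

Lemma lvf_is_linear A : linear (lvf A).
Proof. by move=> c f h; rewrite lvfD lvfZ. Qed.
HB.instance Definition _ A := GRing.isLinear.Build K _ _ _ (lvf A) (lvf_is_linear A).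

Lemma lvfDl A B f : lvf (A + B) f = lvf A f + lvf B f.
Proof.
by rewrite /lvf -big_split; apply: eq_bigr => i _; rewrite !raddfD mulrDl.
Qed.

Lemma lvf0l f : lvf 0 f = 0.
Proof. by rewrite /lvf big1 // => i _; rewrite row0 raddf0 mul0r. Qed.

Lemma lvfZl c A f : lvf (c *: A) f = c *: lvf A f.
Proof.
by rewrite /lvf scaler_sumr; apply: eq_bigr => i _; rewrite !linearZ scalerAl.
Qed.

Lemma lvfC A c : lvf A c%:MP = 0.
Proof. by rewrite /lvf big1 // => i _; rewrite mderivC mulr0. Qed.

Lemma lvfM A f h : lvf A (f * h) = lvf A f * h + f * lvf A h.
Proof.
rewrite /lvf mulr_suml mulr_sumr -big_split; apply: eq_bigr => i _ /=.
by rewrite mderivM; ring.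
Qed.

Lemma mderivXU (i j : 'I_n) : ('X_i)^`M(j) = (i == j)%:R :> {mpoly K[n]}.
Proof.
rewrite mderivX mnm1E; case: eqP => [->|_]; last by rewrite scale0r.
have -> : (U_(j) - U_(j))%MM = 0%MM by apply/mnmP => k; rewrite mnmBE mnm0E subnn.
by rewrite mpolyX0 scale1r.
Qed.

Lemma lvfX A i : lvf A 'X_i = lform (row i A).
Proof.
rewrite /lvf (bigD1 i) //= big1 => [|j ji]; rewrite mderivXU ?eqxx ?mulr1 ?addr0 //.
by rewrite eq_sym (negbTE ji) mulr0.
Qed.

Lemma lvf_lform A u : lvf A (lform u) = lform (u *m A).
Proof.
rewrite {1}/lform linear_sum mulmx_sum_row linear_sum; apply: eq_bigr => i _.
by rewrite [LHS]lvfZ lvfX [RHS]linearZ.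
Qed.

Lemma lform_eval u x : (lform u).@[vec_coord x] = (u *m x) 0 0.
Proof.
rewrite /lform raddf_sum mxE; apply: eq_bigr => i _.
by rewrite [LHS]mevalZ mevalXU.
Qed.
End LinearFields.

Section LinearSubst.
Variables (K : fieldType) (n : nat).
Implicit Types (A B g : 'M[K]_n) (f h : {mpoly K[n]}).

Definition lsubst g f : {mpoly K[n]} := f \mPo [tuple lform (row i g) | i < n].
HB.instance Definition _ g :=
  GRing.RMorphism.copy (lsubst g) (comp_mpoly [tuple lform (row i g) | i < n]).

Lemma lsubstC g c : lsubst g c%:MP = c%:MP.
Proof. by rewrite /lsubst comp_mpolyC. Qed.

Lemma lsubstX g i : lsubst g 'X_i = lform (row i g).
Proof. by rewrite /lsubst comp_mpolyXU -tnth_nth tnth_mktuple. Qed.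

Lemma lsubstZ g c f : lsubst g (c *: f) = c *: lsubst g f.
Proof. by rewrite /lsubst comp_mpolyZ. Qed.

Lemma lsubst_eval g f x :
  (lsubst g f).@[vec_coord x] = f.@[vec_coord (g *m x)].
Proof.
rewrite /lsubst comp_mpoly_meval; apply: meval_eq => i.
by rewrite tnth_mktuple lform_eval /vec_coord -row_mul mxE.
Qed.

Lemma lsubst_lform g u : lsubst g (lform u) = lform (u *m g).
Proof.
rewrite {1}/lform rmorph_sum mulmx_sum_row linear_sum; apply: eq_bigr => i _.
by rewrite [LHS]lsubstZ lsubstX [RHS]linearZ.
Qed.

Lemma lsubst_comp A B f : lsubst A (lsubst B f) = lsubst (B *m A) f.
Proof.
move: f; apply: (@mpoly_rmorph_ext _ _ _ (lsubst A \o lsubst B) (lsubst _)) => [c|i] /=.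
  by rewrite !lsubstC.
by rewrite !lsubstX lsubst_lform row_mul.
Qed.

Lemma lsubst1 f : lsubst 1%:M f = f.
Proof.
move: f; apply: (@mpoly_rmorph_ext _ _ _ (lsubst 1%:M) idfun) => [c|i] /=.
  by rewrite lsubstC.
by rewrite lsubstX row1 lform_delta.
Qed.

(** Chain rule: [g] carries the field of [A] to the field of [B] when it intertwines the two
    matrices. *)
Lemma lvf_lsubst A B g f :
  g *m A = B *m g -> lvf A (lsubst g f) = lsubst g (lvf B f).
Proof.
move=> e; elim/mpoly_ind_ring: f => [c|i|p q Hp Hq|p q Hp Hq].
- by rewrite lsubstC !lvfC rmorph0.
- by rewrite lsubstX lvf_lform lvfX lsubst_lform -!row_mul e.
- by rewrite rmorphD !lvfD Hp Hq rmorphD.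
by rewrite rmorphM !lvfM Hp Hq rmorphD !rmorphM.
Qed.

(* Second-order terms cancel in a commutator of derivations, so it suffices to
   compare both sides on the generators. *)
Lemma lvf_comm A B f :
  lvf A (lvf B f) - lvf B (lvf A f) = lvf (B *m A - A *m B) f.
Proof.
elim/mpoly_ind_ring: f => [c|i|p q Hp Hq|p q Hp Hq].
- by rewrite !lvfC !raddf0 addr0.
- by rewrite !lvfX !lvf_lform -raddfB /= -!row_mul -raddfB.
- by rewrite !lvfD -Hp -Hq opprD addrACA.
by rewrite !lvfM -Hp -Hq !lvfD !lvfM; ring.
Qed.
End LinearSubst.

(** * Unique factorization of polynomials *)

Section Factorial.
Variable R : idomainType.
Implicit Types a b c p u : R.

Definition divides p a := exists b, a = b * p.

Definition prime_elt p :=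
  [/\ p != 0, p \isn't a GRing.unit &
      forall a b, divides p (a * b) -> divides p a \/ divides p b].

Definition factorial_ring := forall a, a != 0 ->
  exists u s, [/\ u \is a GRing.unit, forall p, p \in s -> prime_elt p &
                  a = u * \prod_(p <- s) p].

Lemma divides_refl p : divides p p. Proof. by exists 1; rewrite mul1r. Qed.
Lemma divides_mull p a b : divides p a -> divides p (b * a).
Proof. by move=> [c ->]; exists (b * c); rewrite mulrA. Qed.
Lemma divides_mulr p a b : divides p a -> divides p (a * b).
Proof. by rewrite mulrC; apply: divides_mull. Qed.
Lemma dividesD p a b : divides p a -> divides p b -> divides p (a + b).
Proof. by move=> [c ->] [d ->]; exists (c + d); rewrite mulrDl. Qed.
Lemma dividesN p a : divides p a -> divides p (- a).
Proof. by move=> [c ->]; exists (- c); rewrite mulNr. Qed.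
Lemma dividesB p a b : divides p a -> divides p b -> divides p (a - b).
Proof. by move=> pa pb; apply: dividesD => //; apply: dividesN. Qed.
Lemma divides0 p : divides p 0. Proof. by exists 0; rewrite mul0r. Qed.
Lemma divides_sum p (I : Type) (r : seq I) (P : pred I) F :
  (forall i, P i -> divides p (F i)) -> divides p (\sum_(i <- r | P i) F i).
Proof. by move=> h; apply: big_ind => //; [exact: divides0 | exact: dividesD]. Qed.

Lemma dvd_unit p u : u \is a GRing.unit -> divides p u -> p \is a GRing.unit.
Proof. by move=> uu [b e]; move: uu; rewrite e unitrM => /andP[]. Qed.

Lemma prime_ndvd1 p : prime_elt p -> ~ divides p 1.
Proof. by move=> [_ /negP np _] /(dvd_unit (unitr1 _)). Qed.

Lemma prime_dvd_unit p u : prime_elt p -> u \is a GRing.unit -> ~ divides p u.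
Proof. by move=> [_ /negP np _] uu /(dvd_unit uu). Qed.

Lemma prime_dvd_prod p (s : seq R) : prime_elt p ->
  divides p (\prod_(x <- s) x) -> exists2 x, x \in s & divides p x.
Proof.
move=> pp; elim: s => [|x s IH]; first by rewrite big_nil => /(prime_ndvd1 pp).
rewrite big_cons => /(let: And3 _ _ h := pp in h) [px|/IH[y ys py]].
  by exists x; rewrite ?mem_head.
by exists y; rewrite // inE ys orbT.
Qed.

Lemma prime_assoc p x : prime_elt p -> prime_elt x -> divides p x ->
  exists2 v, v \is a GRing.unit & x = v * p.
Proof.
move=> [p0 np _] [x0 nx hx] [v e]; exists v => //.
have: divides x (v * p) by rewrite -e; apply: divides_refl.
case/hx => [[w ew]|[w ew]].
  case/negP: np; apply/unitrP; exists w; suff h: w * p = 1 by split=> //; rewrite mulrC.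
  by apply: (mulIf x0); rewrite mul1r {2}e ew; ring.
apply/unitrP; exists w; suff h: w * v = 1 by split=> //; rewrite mulrC.
by apply: (mulIf p0); rewrite mul1r {2}ew e; ring.
Qed.
End Factorial.

(** * Gauss's lemma and factorization in a univariate polynomial ring *)

Section GaussLemma.
Variable R : idomainType.
Hypothesis factR : factorial_ring R.
Implicit Types (a b p q : {poly R}) (c : R).

Lemma polyC_prime c : prime_elt c -> prime_elt c%:P.
Proof.
move=> [c0 nc hc]; split; rewrite ?polyC_eq0 //.
  by rewrite poly_unitE coefC eqxx (negbTE nc) andbF.
move=> a b; move: {2}(_ + _)%N (leqnn (size a + size b)%N) => m.
elim: m a b => [|m IH] a b.
  rewrite leqn0 addn_eq0 size_poly_eq0 => /andP[/eqP-> _] _; left; exact: divides0.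
have red q : q != 0 -> divides c (lead_coef q) ->
   exists2 q' : {poly R}, (size q' < size q)%N &
     forall r, divides c%:P (q * r) -> divides c%:P (q' * r) /\
     (divides c%:P q' -> divides c%:P q).
  move=> q0 [d e]; pose t := c%:P * (d *: 'X^((size q).-1)).
  have ct: divides c%:P t by exists (d *: 'X^((size q).-1)); rewrite mulrC.
  exists (q - t).
    have szq : (0 < size q)%N by rewrite size_poly_gt0.
    rewrite -(prednK szq) ltnS; apply/leq_sizeP => j hj.
    rewrite coefB coefCM coefZ coefXn mulrA [c * d]mulrC -e.
    case: eqP => [->|/eqP ne]; first by rewrite mulr1 subrr.
    rewrite mulr0 subr0 nth_default // -(prednK szq) ltn_neqAle hj andbT.
    by rewrite eq_sym.
  move=> r h; split; first by rewrite mulrBl; apply: dividesB => //; apply: divides_mulr.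
  by move=> h'; rewrite -(subrK t q); apply: dividesD.
move=> sz h; have [->|a0] := eqVneq a 0; first by left; exact: divides0.
have [->|b0] := eqVneq b 0; first by right; exact: divides0.
case: (pselect (divides c (lead_coef a))) => [ca|nca].
  have [q sq hq] := red a a0 ca; have [h1 h2] := hq b h.
  case: (IH q b) => //; last by right.
    by rewrite -ltnS; apply: leq_trans sz; rewrite ltn_add2r.
  by move/h2; left.
case: (pselect (divides c (lead_coef b))) => [cb|ncb].
  rewrite mulrC in h; have [q sq hq] := red b b0 cb; have [h1 h2] := hq a h.
  rewrite mulrC in h1; case: (IH a q) => //; last by move/h2; right.
    by rewrite -ltnS; apply: leq_trans sz; rewrite ltn_add2l.
  by left.
case: h => d e; have /hc[] : divides c (lead_coef a * lead_coef b) => //.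
rewrite -lead_coefM e /lead_coef; set k := (size _).-1.
by exists d`_k; rewrite coefMC.
Qed.

Definition primitive p := forall c, prime_elt c -> ~ divides c%:P p.

(** Each prime constant taken out of [a] uses up one prime in the factorization of the leading
    coefficient, which bounds the number of extractions. *)
Lemma primitive_part a : a != 0 ->
  exists c p, [/\ c != 0, a = c%:P * p & primitive p].
Proof.
move=> a0; have [|u [s [uu ps e]]] := factR (a := lead_coef a).
  by rewrite lead_coef_eq0.
have [m hm] := ubnP (size s); elim: m s a u a0 uu ps e hm => // m IH s a u a0 uu ps e hm.
case: (pselect (exists2 c, prime_elt c & divides c%:P a)); last first.
  move=> h; exists 1, a; split; rewrite ?oner_eq0 ?mul1r // => c pc ca.
  by apply: h; exists c.
move=> [c pc [b eb]].
have c0 : c != 0 by case: pc.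
have b0 : b != 0 by apply: contra_neq a0 => b0; rewrite eb b0 mul0r.
have eb' : lead_coef a = lead_coef b * c by rewrite eb lead_coefM lead_coefC.
have [|x xs cx] := prime_dvd_prod (s := s) pc.
  have : divides c (u * \prod_(p <- s) p) by rewrite -e eb'; exists (lead_coef b).
  by case: (pc) => _ _ h /h[|//] /(prime_dvd_unit pc uu).
have [v uv ex] := prime_assoc pc (ps x xs) cx.
have [||||c' [p [c'0 ep pp]]] := IH (rem x s) b (u * v) b0.
- by rewrite unitrM uu.
- by move=> p /mem_rem /ps.
- apply: (mulIf c0); rewrite -eb' e (perm_big _ (perm_to_rem xs)) big_cons.
  by rewrite [X in u * (X * _)]ex; ring.
- by rewrite size_rem // -ltnS prednK //; case: (s) xs.
exists (c' * c), p; split => //; first by rewrite mulf_neq0.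
by rewrite eb ep polyCM; ring.
Qed.

(** The primes of [c] are cancelled one at a time: each stays prime in the polynomial ring and does
    not divide the primitive [p], so it divides the cofactor. *)
Lemma primitive_dvd p c a : primitive p -> c != 0 ->
  divides p (c%:P * a) -> divides p a.
Proof.
move=> pp c0; have [u [s [uu ps ->]]] := factR c0.
rewrite polyCM -mulrA => -[b e].
have {e}: exists b, (\prod_(x <- s) x)%:P * a = b * p.
  exists ((u^-1)%:P * b); rewrite -mulrA -e mulrA -polyCM mulVr //.
  by rewrite mul1r.
elim: s ps => [_|x s IH ps]; first by rewrite big_nil mul1r => -[d ->]; exists d.
rewrite big_cons polyCM -mulrA => -[d e]; apply: IH.
  by move=> y ys; apply: ps; rewrite inE ys orbT.
have px : prime_elt x by apply: ps; rewrite mem_head.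
have [x0 _ hx] := polyC_prime px.
case: (hx d p) => [||/(pp _ px)//].
  by rewrite -e; exists ((\prod_(j <- s) j)%:P * a); rewrite mulrC.
move=> [g eg]; exists g; apply: (mulfI x0).
by rewrite e eg; ring.
Qed.

Import Pdiv.Idomain.

(** Over a domain [%|] is divisibility up to a nonzero constant, that is, over the fraction field.
    For primitive [p] it is true divisibility. *)
Lemma primitive_dvdp p a : primitive p -> p %| a -> divides p a.
Proof.
move=> pp /dvdpP[[c q] /= c0 e]; apply: (primitive_dvd pp c0).
by exists q; rewrite mul_polyC.
Qed.

Lemma primitive_irreducible_prime p :
  primitive p -> irreducible_poly p -> prime_elt p.
Proof.
move=> pp [sp hp]; have p0 : p != 0 by rewrite -size_poly_gt0 ltnW.
split=> //.
  by rewrite poly_unitE negb_and neq_ltn sp orbT.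
move=> a b [c e].
have : p %| a * b by rewrite e dvdp_mull.
case: (eqVneq (size (gcdp p a)) 1%N) => [h1|h1].
  have h2 : coprimep p a by rewrite /coprimep h1.
  by rewrite Gauss_dvdpr // => /(primitive_dvdp pp); right.
move=> _; left; apply: primitive_dvdp => //.
by rewrite -(eqp_dvdl _ (hp _ h1 (dvdp_gcdl _ _))) dvdp_gcdr.
Qed.

Lemma poly_factorial : factorial_ring {poly R}.
Proof.
move=> a; have [m] := ubnP (size a); elim: m a => // m IH a.
case: (leqP (size a) 1) => [sa _ a0|sa hm a0].
  have e := size1_polyC sa; have c0 : a`_0 != 0 by move: a0; rewrite {1}e polyC_eq0.
  have [u [s [uu ps ec]]] := factR c0; exists u%:P, [seq x%:P | x <- s]; split.
  - by rewrite rmorph_unit.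
  - by move=> p /mapP[x /ps px ->]; apply: polyC_prime.
  by rewrite [LHS]e ec polyCM big_map rmorph_prod.
(* A nonconstant divisor of least size: its primitive part is irreducible, hence prime. *)
have ex : exists k, `[< exists q, [/\ (1 < size q)%N, q %| a & size q = k] >].
  by exists (size a); apply/asboolP; exists a; split.
case: (ex_minnP ex) => k /asboolP[q [sq qa ek]] kmin.
have q0 : q != 0 by rewrite -size_poly_gt0 ltnW.
have [c [p [c0 eq pp]]] := primitive_part q0.
have epq : p %= q by rewrite eq mul_polyC eqp_sym eqp_scale.
have sp : size p = size q by apply: eqp_size.
have pirr : irreducible_poly p.
  split=> [|r hr rp]; first by rewrite sp.
  have ra : r %| a by apply: dvdp_trans rp _; rewrite (eqp_dvdl _ epq).
  have r0 : r != 0.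
    apply: contraTneq rp => ->; rewrite dvd0p -size_poly_eq0 sp size_poly_eq0.
    exact: q0.
  have sr : (1 < size r)%N by rewrite ltn_neqAle eq_sym hr size_poly_gt0.
  rewrite -dvdp_size_eqp // eqn_leq sp ek kmin ?andbT.
    by rewrite -ek -sp dvdp_leq // -size_poly_gt0 sp ltnW.
  by apply/asboolP; exists r.
have ppr := primitive_irreducible_prime pp pirr.
have [|b eb] := primitive_dvdp (a := a) pp; first by rewrite (eqp_dvdl _ epq).
have b0 : b != 0 by apply: contra_neq a0 => b0; rewrite eb b0 mul0r.
have p0 : p != 0 by case: ppr.
have [|//|u [s [uu ps e]]] := IH b.
  rewrite -ltnS; apply: leq_trans hm; rewrite ltnS eb size_mul //.
  have [sz ] : (1 < size p)%N /\ (0 < size b)%N by rewrite sp size_poly_gt0.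
  by case: (size p) sz => [|[|k']] // _ ; rewrite !addnS /= ltnS leq_addr.
exists u, (p :: s); split=> // [r|]; last by rewrite big_cons eb e; ring.
by rewrite inE => /predU1P[-> //|/ps].
Qed.
End GaussLemma.

Section Transport.
Variables (R S : idomainType) (f : {rmorphism R -> S}) (g : {rmorphism S -> R}).
Hypotheses (fK : cancel f g) (gK : cancel g f).

Lemma iso_prime p : prime_elt p -> prime_elt (f p).
Proof.
move=> [p0 np hp]; split.
- by apply: contra_neq p0 => e; rewrite -(fK p) e rmorph0.
- by apply: contra np => /(rmorph_unit g); rewrite /= fK.
move=> a b [c e]; case: (hp (g a) (g b)).
- by exists (g c); rewrite -rmorphM e rmorphM fK.
- by move=> [d ed]; left; exists (f d); rewrite -rmorphM -ed gK.
by move=> [d ed]; right; exists (f d); rewrite -rmorphM -ed gK.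
Qed.

Lemma iso_factorial : factorial_ring R -> factorial_ring S.
Proof.
move=> h a a0; have ga0 : g a != 0.
  by apply: contra_neq a0 => e; rewrite -(gK a) e rmorph0.
have [u [s [uu ps e]]] := h _ ga0; exists (f u), (map f s); split.
- exact: rmorph_unit.
- by move=> p /mapP[x /ps px ->]; apply: iso_prime.
by rewrite -(gK a) e rmorphM big_map rmorph_prod.
Qed.
End Transport.

Theorem mpoly_factorial (K : fieldType) n : factorial_ring {mpoly K[n]}.
Proof.
elim: n => [|n IH].
  move=> a a0; exists a, [::]; split=> //; last by rewrite big_nil mulr1.
  have e : a = (a@_0)%:MP.
    apply/mpolyP => m; rewrite mcoeffC.
    by have -> : m = 0%MM by [apply/mnmP => [[]]]; rewrite eqxx mulr1.
  rewrite e rmorph_unit // unitfE; apply: contra_neq a0 => c0.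
  by rewrite e c0 mpolyC0.
apply: (@iso_factorial {poly {mpoly K[n]}} _ (of_uni ord0) (to_uni ord0)).
- exact: of_uniK.
- exact: to_uniK.
exact: poly_factorial.
Qed.

(** * Nilpotent and diagonalizable matrices *)

Section Fitting.
Variables (K : numFieldType) (n : nat).
Implicit Types (A B e T : 'M[K]_n.+1) (h p q : {poly K}).

Lemma horner_mx_dvd A p q : p %| q -> horner_mx A p = 0 -> horner_mx A q = 0.
Proof. by move=> /dvdpP[r ->] e; rewrite rmorphM /= e mulr0. Qed.

(** In a full-rank factorization [e] = CB idempotence forces BC = 1, of size the rank. In
    characteristic zero the trace thus counts dimensions. *)
Lemma mxtrace_idem e : e * e = e -> \tr e = (\rank e)%:R.
Proof.
move=> ee; have [L hL] := row_fullP (col_base_full e).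
have [M hM] := row_freeP (row_base_free e).
have eCR : col_base e *m row_base e = e by rewrite mulmx_base.
have ee' : e *m e = e by [].
move: ee'; rewrite -{1 2 3 4}eCR.
move: (col_base e) (row_base e) hL hM => C B hL hM.
move=> /(congr1 (fun x => L *m x *m M)).
rewrite !mulmxA hL !mul1mx -!mulmxA hM mulmx1 => h.
by rewrite mxtrace_mulC h mxtrace1.
Qed.

Lemma idem_trace0 e : e * e = e -> \tr e = 0 -> e = 0.
Proof.
move=> ee; rewrite mxtrace_idem // => /eqP; rewrite pnatr_eq0 mxrank_eq0.
by move/eqP.
Qed.

(** [e] projects onto the part where [T] is invertible, along the generalized kernel. On its image
    h(T) inverts [T], which is why the idempotent is given as T h(T). *)
Lemma fitting T : exists h N,
  let e := horner_mx T ('X * h) in e * e = e /\ T ^+ N * (1 - e) = 0.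
Proof.
have p0 := monic_neq0 (char_poly_monic T); have CH := Cayley_Hamilton T.
have [a [q]] := multiplicity_XsubC (char_poly T) 0.
rewrite p0 subr0 /= => rq ep.
have cop : coprimep ('X ^+ a.+1) q.
  by apply: coprimep_expl; rewrite coprimep_sym -['X]subr0 coprimep_XsubC.
have [[al be] /= bez] := Bezout_eq1_coprimepP _ _ cop.
pose e := horner_mx T ('X * (al * 'X^a)).
have ee : 'X * (al * 'X^a) = al * 'X^(a.+1) :> {poly K} by rewrite exprS; ring.
have e1 : 1 - e = horner_mx T (be * q).
  rewrite /e ee -(rmorph1 (horner_mx T)) -rmorphB; congr (horner_mx T _).
  by apply: (addIr (al * 'X^(a.+1))); rewrite subrK addrC bez.
have z r : horner_mx T (r * ('X^(a.+1) * q)) = 0.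
  by rewrite exprS -mulrA [_ ^+ a * q]mulrC -ep mulrA rmorphM /= CH mulr0.
exists (al * 'X^a), a.+1; split; last first.
  rewrite -/e e1 -{1}(horner_mx_X T) -rmorphXn -rmorphM /=.
  by rewrite -[RHS](z be); congr horner_mx; ring.
apply/eqP; rewrite -subr_eq0 -opprB oppr_eq0 -{1}[horner_mx _ _]mulr1 -mulrBr.
by rewrite -/e e1 /e ee -rmorphM -(z (al * be)); apply/eqP; congr horner_mx; ring.
Qed.

End Fitting.

(* A = C R with C, R of size rank A, and R C is again nilpotent. *)
Lemma nilpotent_trace (K : fieldType) n (A : 'M[K]_n) k : A ^+ k = 0 -> \tr A = 0.
Proof.
have [m] := ubnP n; elim: m n A k => // m IH n A k hn Ak.
have [fl|nf] := boolP (row_full A).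
  have [B hB] := row_fullP fl; elim: k Ak => [|k IHk]; last first.
    by rewrite exprS => /(congr1 (mulmx B)); rewrite mulmx0 -mulmxE mulmxA hB mul1mx.
  by rewrite expr0 => h; rewrite -[A]mulmx1 -[1%:M]/(1 : 'M_n) h mulmx0 mxtrace0.
have eA := mulmx_base A.
have hr : (\rank A < n)%N by rewrite ltn_neqAle nf rank_leq_col.
move: (col_base A) (row_base A) eA => C B eA.
rewrite -eA mxtrace_mulC; apply: (IH _ _ k.+1); first exact: leq_trans hr hn.
have e j : (B *m C) ^+ j.+1 = B *m (A ^+ j) *m C.
  elim: j => [|j IHj]; first by rewrite expr1 expr0 mulmx1.
  rewrite exprSr IHj exprSr -!mulmxE -!mulmxA; congr (_ *m (_ *m _)).
  by rewrite mulmxA eA.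
by rewrite e Ak mulmx0 mul0mx.
Qed.

Section CRT.
Variable K : fieldType.
Implicit Types (p q s : {poly K}) (r : seq K).

(** Used with [phi] the identity for the Jordan decomposition, and with complex conjugation and
    exponent 1 for the conjugate of a diagonalizable matrix. *)
Lemma crt_poly (phi : K -> K) (N : nat) r : uniq r ->
  exists s, forall x, x \in r -> ('X - x%:P) ^+ N %| s - (phi x)%:P.
Proof.
elim: r => [_|x r IH /= /andP[xr ur]]; first by exists 0.
have [s hs] := IH ur; pose q := \prod_(y <- r) ('X - y%:P) ^+ N.
have cop : coprimep (('X - x%:P) ^+ N) q.
  rewrite /q; elim: (r) xr => [|y r' IHr]; first by rewrite big_nil coprimep1.
  rewrite inE negb_or big_cons coprimepMr => /andP[xy /IHr ->]; rewrite andbT.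
  by apply/coprimep_expl/coprimep_expr/coprimep_XsubC2; rewrite subr_eq0 eq_sym.
have [[u v] /= bez] := Bezout_eq1_coprimepP _ _ cop.
exists (s + ((phi x)%:P - s) * (v * q)) => y; rewrite inE => /predU1P[->|yr].
  have -> : v * q = 1 - u * ('X - x%:P) ^+ N.
    by apply: (addIr (u * ('X - x%:P) ^+ N)); rewrite subrK addrC bez.
  by rewrite mulrBr mulr1 addrA [s + _]addrC subrK addrAC subrr add0r mulrA -mulNr dvdp_mull.
rewrite addrAC dvdp_add ?hs // mulrA dvdp_mull // /q (big_rem y) //=.
exact: dvdp_mulIl.
Qed.

Lemma dvdp_prod_XsubC_exp (N : nat) r q : uniq r ->
  (forall x, x \in r -> ('X - x%:P) ^+ N %| q) ->
  (\prod_(x <- r) ('X - x%:P)) ^+ N %| q.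
Proof.
rewrite -prodrXl; elim: r => [_ _|x r IH /= /andP[xr ur] h].
  by rewrite big_nil dvd1p.
rewrite big_cons Gauss_dvdp ?h ?mem_head ?IH // => [y yr|].
  by apply: h; rewrite inE yr orbT.
elim: (r) xr => [|y r' IHr]; first by rewrite big_nil coprimep1.
rewrite inE negb_or big_cons coprimepMr => /andP[xy /IHr ->]; rewrite andbT.
by apply/coprimep_expl/coprimep_expr/coprimep_XsubC2; rewrite subr_eq0 eq_sym.
Qed.
End CRT.

Section Jordan.
Variables (K : numClosedFieldType) (n : nat).

(** [s] is congruent to x modulo (X - x)^N at every eigenvalue x, so s(X) acts as x on the
    generalized eigenspace. *)
Lemma jordan (X : 'M[K]_n.+1) : exists (s : {poly K}) (r : seq K) (N : nat),
  [/\ uniq r, horner_mx (horner_mx X s) (\prod_(x <- r) ('X - x%:P)) = 0 &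
      (X - horner_mx X s) ^+ N = 0].
Proof.
have [r0 e0] := closed_field_poly_normal (char_poly X).
rewrite (monicP (char_poly_monic X)) scale1r in e0.
pose r := undup r0; pose N := (size r0).+1; pose w := \prod_(x <- r) ('X - x%:P).
have wN : horner_mx X (w ^+ N) = 0.
  apply: (horner_mx_dvd _ (Cayley_Hamilton X)); rewrite e0 /N exprS dvdp_mull //.
  have : {subset r0 <= r} by move=> x; rewrite mem_undup.
  elim: (r0) => [|x l IH] h; first by rewrite big_nil expr0.
  rewrite big_cons exprS dvdp_mul ?IH // => [|y yl].
    by rewrite /w (big_rem x) ?dvdp_mulIl //; apply: h; rewrite mem_head.
  by apply: h; rewrite inE yl orbT.
have [s hs] := crt_poly id N (undup_uniq r0).
exists s, r, N; split; first exact: undup_uniq.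
  have -> : horner_mx (horner_mx X s) w = horner_mx X (w \Po s).
    rewrite /w !rmorph_prod; apply: eq_bigr => x _.
    by rewrite !rmorphB /= !horner_mx_X !horner_mx_C comp_polyX comp_polyC horner_mx_C.
  apply: (horner_mx_dvd _ wN); apply: dvdp_prod_XsubC_exp (undup_uniq _) _ => x xr.
  rewrite /w (big_rem x) // comp_polyM comp_polyB comp_polyX comp_polyC.
  by rewrite dvdp_mulr // hs.
have dX : w %| 'X - s.
  rewrite -[w]expr1; apply: dvdp_prod_XsubC_exp (undup_uniq _) _ => x xr.
  have -> : 'X - s = ('X - x%:P) - (s - x%:P) by rewrite opprB addrA subrK.
  rewrite expr1 dvdp_sub //; apply: dvdp_trans (hs x xr).
  by rewrite /N exprS dvdp_mulIl.
rewrite -{1}(horner_mx_X X) -rmorphB -rmorphXn /=.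
by apply: (horner_mx_dvd _ wN); rewrite dvdp_exp2r.
Qed.
End Jordan.

Section Traces.
Variables (K : numClosedFieldType) (n : nat).
Implicit Types (A S T e : 'M[K]_n.+1) (h : {poly K}).

Lemma diag_ofP S r : uniq r -> horner_mx S (\prod_(x <- r) ('X - x%:P)) = 0 ->
  exists2 P, P \in unitmx & similar_diag P S.
Proof.
by move=> ur h0; apply/diagonalizableP; exists r => //; apply: mxminpoly_min.
Qed.

Lemma comm_nilpotent_mul A S N : GRing.comm A S -> A ^+ N = 0 -> (S * A) ^+ N = 0.
Proof. by move=> c AN; rewrite exprMn_comm ?AN ?mulr0 //; apply: commr_sym. Qed.

(* In a common eigenbasis of S and e the trace is the sum of e_i |s_i|^2. *)
Lemma trace_conj_eq0 S e h r :
  uniq r -> horner_mx S (\prod_(x <- r) ('X - x%:P)) = 0 ->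
  (forall x, x \in r -> h.[x] = x^* ) -> e * e = e -> GRing.comm e S ->
  \tr (e * S * horner_mx S h) = 0 -> e * S = 0.
Proof.
move=> ur hS hh ee ceS; set T := horner_mx S h => tr0.
have dS := diag_ofP ur hS.
have de : exists2 P, P \in unitmx & similar_diag P e.
  apply: (@diag_ofP _ [:: 0; 1]); first by rewrite /= inE eq_sym oner_neq0.
  rewrite big_cons big_seq1 subr0 rmorphM rmorphB /= horner_mx_X horner_mx_C.
  by rewrite mulrBr ee -[1%:M]/(1 : 'M_n.+1) mulr1 subrr.
have [|P Pu /andP[]] := (codiagonalizableP [:: S; e]).1.
  split=> [f g|f]; rewrite !inE => /orP[]/eqP->; rewrite ?inE //.
    by move=> /orP[]/eqP-> //; exact: esym.
  by move=> /orP[]/eqP->.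
rewrite /= andbT => /similar_diagPex[d /(similarLR Pu)].
rewrite conjVmx // => eS /similar_diagPex[c /(similarLR Pu)].
rewrite conjVmx // => eE.
have PP (B C : 'M[K]_n.+1) :
    (invmx P *m B *m P) * (invmx P *m C *m P) = invmx P *m (B *m C) *m P.
  by rewrite -mulmxE !mulmxA mulmxK // !mulmxA.
have eT : T = invmx P *m diag_mx (map_mx (horner h) d) *m P.
  by rewrite /T eS horner_mx_uconjC // horner_mx_diag.
have trP B : \tr (invmx P *m B *m P) = \tr B.
  by rewrite mxtrace_mulC mulmxA mulmxV // mul1mx.
have injP B : invmx P *m B *m P = 0 -> B = 0.
  move=> /(congr1 (fun x => P *m x *m invmx P)).
  by rewrite mulmx0 mul0mx !mulmxA mulmxV // mul1mx mulmxK.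
have dr i : d 0 i \in r.
  move: hS; rewrite eS horner_mx_uconjC // => /injP.
  rewrite horner_mx_diag => /matrixP/(_ i i); rewrite !mxE eqxx mulr1n => /eqP.
  by rewrite -/(root _ _) root_prod_XsubC.
have cc i : c 0 i * c 0 i = c 0 i.
  move: ee; rewrite eE PP => h1; apply/eqP; rewrite -subr_eq0; apply/eqP.
  have /matrixP/(_ i i) : diag_mx c *m diag_mx c - diag_mx c = 0.
    by apply: injP; rewrite mulmxBr mulmxBl h1 subrr.
  by rewrite mulmx_diag !mxE eqxx !mulr1n.
move: tr0; rewrite eE eS eT !PP trP !mulmx_diag mxtrace_diag => /eqP.
rewrite psumr_eq0 => [/allP h0|i _]; last first.
  rewrite !mxE hh // -mulrA -normCK -cc mulr_ge0 ?exprn_ge0 //.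
  have /eqP : c 0 i * (c 0 i - 1) = 0 by rewrite mulrBr mulr1 cc subrr.
  by rewrite mulf_eq0 subr_eq0 => /orP[]/eqP->; rewrite ?mul0r ?mul1r ?lexx ?ler01.
set Z := diag_mx _; suff -> : Z = 0 by rewrite mulmx0 mul0mx.
apply/matrixP => i j; rewrite !mxE.
have := h0 i (mem_index_enum i); rewrite /= !mxE hh // -mulrA mulf_eq0.
by rewrite mul_conjC_eq0 => /orP[]/eqP->; rewrite ?mul0r ?mulr0 mul0rn.
Qed.

(** [e * T * (A - S)] is nilpotent, so the trace hypothesis holds with [S] in place of [A] too. Then
    [e * S] is 0 and [e * A = e * (A - S)]. *)
Lemma trace_conj_nilpotent A S e h r N :
  uniq r -> horner_mx S (\prod_(x <- r) ('X - x%:P)) = 0 ->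
  (forall x, x \in r -> h.[x] = x^* ) ->
  GRing.comm A S -> (A - S) ^+ N = 0 -> e * e = e ->
  GRing.comm e A -> GRing.comm e S ->
  \tr (e * A * horner_mx S h) = 0 -> (e * A) ^+ N = 0.
Proof.
move=> ur hS hh cAS hN ee ceA ceS tr0.
pose T := horner_mx S h.
have cST : GRing.comm S T by rewrite /GRing.comm -[S in LHS]horner_mx_X -[S in RHS]horner_mx_X; exact: comm_horner_mx2.
have comT B : GRing.comm B S -> GRing.comm B T.
  move=> c; apply: commr_sym; rewrite /GRing.comm; exact: (comm_horner_mx h (commr_sym c)).
suff eS0 : e * S = 0.
  have -> : e * A = e * (A - S) by rewrite mulrBr eS0 subr0.
  apply: comm_nilpotent_mul hN; apply: commr_sym; exact: commrB.
apply: (trace_conj_eq0 ur hS hh) => //; rewrite -/T.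
have -> : e * S * T = e * A * T - e * T * (A - S).
  rewrite -!mulrA -mulrBr; congr (e * _).
  by rewrite mulrBr (comT _ cAS : _ * _ = _) cST opprB addrCA subrr addr0.
rewrite raddfB /= tr0 sub0r (@nilpotent_trace _ _ _ N) ?oppr0 //.
apply: comm_nilpotent_mul hN; apply: commrM.
  exact: commr_sym (commrB ceA ceS).
by apply: comT; apply: commr_sym; apply: commrB => //; exact: commr_sym.
Qed.
End Traces.

(** * Engel's theorem *)

Section Words.
Variables (K : fieldType) (N : nat) (n : 'M[K]_N -> Prop).
Implicit Types (x y u v w : 'M[K]_N).

Fixpoint words k w : Prop :=
  if k is k'.+1 then exists x w', [/\ n x, words k' w' & w = x *m w']
  else w = 1%:M.

Lemma words_cat a b u v : words a u -> words b v -> words (a + b) (u *m v).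
Proof.
elim: a u => [u -> | a IH u [x [u' [nx hu ->]]]] hv; first by rewrite mul1mx.
by exists x, (u' *m v); split; rewrite ?mulmxA //; apply: IH.
Qed.

Lemma words_split a b w : words (a + b) w ->
  exists u v, [/\ words a u, words b v & w = u *m v].
Proof.
elim: a w => [w hw|a IH w [x [w' [nx /IH[u [v [hu hv ->]]] ->]]]].
  by exists 1%:M, w; rewrite mul1mx.
by exists (x *m u), v; rewrite mulmxA; split=> //; exists x, u.
Qed.

Lemma words1 x : n x -> words 1 x.
Proof. by move=> nx; exists x, 1%:M; rewrite mulmx1. Qed.

Lemma words_rcons a u y : words a u -> n y -> words a.+1 (u *m y).
Proof. by move=> hu ny; rewrite -addn1; apply: words_cat hu (words1 ny). Qed.

Lemma words_rconsE a w : words a.+1 w -> exists u y, [/\ words a u, n y & w = u *m y].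
Proof.
elim: a w => [w [x [w' [nx -> ->]]]|a IH w [x [w' [nx /IH[u [y [hu ny ->]]] ->]]]].
  by exists 1%:M, x; rewrite mulmx1 mul1mx.
by exists (x *m u), y; rewrite mulmxA; split=> //; exists x, u.
Qed.

(** The columns of [z] lie in the i-th step of the ascending filtration by the vectors annihilated
    by all products of i elements of [n]. *)
Definition kills p i (z : 'M[K]_(N, p)) := forall u, words i u -> u *m z = 0.

Definition bracket_stable x := forall y, n y -> n (y *m x - x *m y).

Lemma kills0 p (z : 'M_(N, p)) : kills 0 z -> z = 0.
Proof. by move=> /(_ 1%:M erefl); rewrite mul1mx. Qed.

Lemma kills0r p i : kills i (0 : 'M_(N, p)).
Proof. by move=> u _; rewrite mulmx0. Qed.

Lemma killsD p i (z t : 'M_(N, p)) : kills i z -> kills i t -> kills i (z + t).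
Proof. by move=> hz ht u hu; rewrite mulmxDr hz // ht // addr0. Qed.

Lemma killsZ p i c (z : 'M_(N, p)) : kills i z -> kills i (c *: z).
Proof. by move=> hz u hu; rewrite -scalemxAr hz // scaler0. Qed.

Lemma killsW p i (z : 'M_(N, p)) : kills i z -> kills i.+1 z.
Proof. by move=> hz u [x [u' [_ hu ->]]]; rewrite -mulmxA hz // mulmx0. Qed.

Lemma killsS p i x (z : 'M_(N, p)) : n x -> kills i.+1 z -> kills i (x *m z).
Proof. by move=> nx hz u hu; rewrite mulmxA hz //; apply: words_rcons. Qed.

Lemma kills_stable p i x (z : 'M_(N, p)) :
  bracket_stable x -> kills i z -> kills i (x *m z).
Proof.
move=> sx; elim: i z => [|i IH] z hz u.
  by move=> _; rewrite (kills0 hz) !mulmx0.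
move=> /words_rconsE[v [y [hv ny ->]]].
have -> : v *m y *m (x *m z) =
    v *m (x *m (y *m z)) + (v *m (y *m x - x *m y)) *m z.
  rewrite mulmxBr mulmxBl !mulmxA addrC subrK //.
rewrite IH //; last exact: killsS.
by rewrite add0r hz //; apply: words_rcons => //; apply: sx.
Qed.

Definition nilpotent_words := exists k, forall w, words k w -> w = 0.

Lemma kills_all p k (z : 'M_(N, p)) :
  (forall w, words k w -> w = 0) -> kills k z.
Proof. by move=> h u /h->; rewrite mul0mx. Qed.

Lemma kills_exp (f : 'M[K]_N) k :
  (forall w, words k w -> w = 0) ->
  (forall i (z : 'M[K]_N), kills i.+1 z -> kills i (f *m z)) -> f ^+ k = 0.
Proof.
move=> h hf; suff hk j : (j <= k)%N -> kills (k - j) (f ^+ j).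
  by apply: kills0; rewrite -(subnn k); apply: hk.
elim: j => [|j IH] hj; first by rewrite subn0; apply: kills_all.
by rewrite exprS; apply: hf; rewrite subnSK //; apply: IH; apply: ltnW.
Qed.

(** [y] preserves the filtration and [x] lowers it by one. This makes an ideal of nilpotents
    orthogonal, for the trace form, to the algebra that normalizes it. *)
Lemma nilpotent_mul_stable x y : nilpotent_words -> n x -> bracket_stable y ->
  exists k, (x *m y) ^+ k = 0.
Proof.
move=> [k hk] nx sy; exists k; apply: kills_exp => // i z hz.
by rewrite -mulmxA; apply: killsS nx _; apply: kills_stable.
Qed.
End Words.

Section Engel.
Variables (K : fieldType) (N : nat).
Implicit Types (n : 'M[K]_N -> Prop) (x y : 'M[K]_N) (h : {vspace 'M[K]_N}).

Definition lie_subspace n :=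
  [/\ n 0, forall x y, n x -> n y -> n (x + y), forall c x, n x -> n (c *: x) &
      forall x y, n x -> n y -> n (x *m y - y *m x)].

(** Modulo the next lower step of the filtration of [h], a word of length j in [h + <[x]>] acts as a
    multiple of [x ^+ j]. Hence every m letters lower the filtration by one. *)
Lemma words_extend h x m : nilpotent_words (fun y => y \in h) ->
  bracket_stable (fun y => y \in h) x -> x ^+ m = 0 ->
  nilpotent_words (fun y => y \in (h + <[x]>)%VS).
Proof.
pose H (y : 'M_N) : Prop := y \in h.
pose H' (y : 'M_N) : Prop := y \in (h + <[x]>)%VS; rewrite -/H -/H'.
move=> [k hk] sx xm; exists (m * k)%N => w.
have st y i (z : 'M_N) : H' y -> kills H i z -> kills H i (y *m z).
  move=> hy; have /memv_addP[a ha [_ /vlineP[c ->] ->]] : y \in (h + <[x]>)%VS := hy.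
  move=> hz; rewrite mulmxDl -scalemxAl.
  apply: killsD; last by apply: killsZ; apply: kills_stable.
  by apply: killsS => //; apply: killsW.
have pw j u i (z : 'M_N) : words H' j u -> kills H i.+1 z ->
    exists c, kills H i (u *m z - c *: (x ^+ j *m z)) /\ kills H i.+1 (u *m z).
  elim: j u => [u -> hz|j IH u [y [u' [hy hu ->]]] hz].
    by exists 1; rewrite expr0 scale1r !mul1mx subrr; split => //; apply: kills0r.
  have [c [h1 h2]] := IH u' hu hz.
  have h3 : kills H i.+1 (y *m u' *m z) by rewrite -mulmxA; apply: st.
  have /memv_addP[a ha [_ /vlineP[d ->] ey]] : y \in (h + <[x]>)%VS := hy.
  exists (d * c); split=> //.
  have -> : y *m u' *m z - d * c *: (x ^+ j.+1 *m z) =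
      a *m (u' *m z) + d *: (x *m (u' *m z - c *: (x ^+ j *m z))).
    rewrite ey mulmxDl mulmxDl -!mulmxA -addrA; congr (_ + _).
    by rewrite mulmxBr scalerBr -!scalemxAl -scalemxAr scalerA exprS -mulmxE !mulmxA.
  apply: killsD; first exact: killsS.
  by apply: killsZ; apply: kills_stable.
suff bl j u (z : 'M_N) : (j <= k)%N -> words H' (m * j) u -> kills H (k - j) (u *m z).
  by move=> hw; apply: (@kills0 _ _ H); rewrite -(subnn k) -[w]mulmx1; apply: bl.
elim: j u => [|j IH] u hj; first by move=> _; rewrite subn0; apply: kills_all.
rewrite mulnS => hu.
have [u1 [u2 [h1 h2 ->]]] := words_split hu.
have [|c [h3 _]] := pw m u1 (k - j.+1)%N (u2 *m z) h1.
  by rewrite subnSK //; apply: IH => //; apply: ltnW.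
by move: h3; rewrite xm mul0mx scaler0 subr0 mulmxA.
Qed.

(** A subalgebra [h] of [n] of largest dimension among those with nilpotent words is all of [n]:
    otherwise some [z] of [n] outside [h] normalizes it, and [words_extend] enlarges it. *)
Theorem engel n : lie_subspace n -> (forall x, n x -> exists k, x ^+ k = 0) ->
  nilpotent_words n.
Proof.
move=> [n0 nD nZ nB] nil.
pose good h := [/\ forall x, x \in h -> n x,
  forall x y, x \in h -> y \in h -> x *m y - y *m x \in h &
  nilpotent_words (fun y => y \in h)].
have ex : exists d, `[< exists2 h, good h & \dim h = d >].
  exists 0%N; apply/asboolP; exists 0%VS; rewrite ?dimv0 //; split.
  - by move=> x; rewrite memv0 => /eqP->.
  - by move=> x y; rewrite !memv0 => /eqP-> /eqP->; rewrite mulmx0 subrr.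
  by exists 1%N => w [x [w' []]]; rewrite memv0 => /eqP-> _ ->; rewrite mul0mx.
have ub d : `[< exists2 h, good h & \dim h = d >] -> (d <= \dim {:'M[K]_N})%N.
  by move=> /asboolP[h _ <-]; apply/dimvS/subvf.
case: (ex_maxnP ex ub) => d /asboolP[h gh <-] hmax.
have [hn hB hw] := gh.
suff nh x : n x -> x \in h.
  have [k hk] := hw; exists k => w hw'; apply: hk; elim: k w hw' => //= k IH w.
  by move=> [x [w' [/nh hx /IH hw' ->]]]; exists x, w'.
move=> nx; apply: contrapT => xh.
suff [z [nz zh sz]] : exists z, [/\ n z, ~ z \in h & bracket_stable (fun y => y \in h) z].
  have [m zm] := nil z nz.
  have sB a b : a \in h -> b \in (h + <[z]>)%VS -> a *m b - b *m a \in h.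
    move=> ha /memv_addP[b' hb [_ /vlineP[c ->] ->]].
    rewrite mulmxDr mulmxDl opprD addrACA -scalemxAr -scalemxAl -scalerBr.
    by rewrite rpredD ?rpredZ //; [exact: hB | exact: (sz a ha)].
  have : good (h + <[z]>)%VS.
    split; last exact: words_extend zm.
    - by move=> y /memv_addP[a /hn ha [_ /vlineP[c ->] ->]]; apply: nD => //; apply: nZ.
    - move=> a b /memv_addP[a' ha [_ /vlineP[c ->] ->]] hb.
      rewrite mulmxDl mulmxDr opprD addrACA -scalemxAr -scalemxAl -scalerBr.
      apply: (subvP (addvSl h <[z]>)); rewrite rpredD ?sB //.
      rewrite rpredZ // -opprB rpredN.
      move: hb => /memv_addP[b' hb [_ /vlineP[e ->] ->]].
      rewrite mulmxDl mulmxDr opprD addrACA -scalemxAr -scalemxAl subrr addr0.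
      exact: sz.
  move=> g; have := hmax (\dim (h + <[z]>)%VS); rewrite leqNgt => /(_ _)/negP; case.
    by apply/asboolP; exists (h + <[z]>)%VS.
  rewrite ltn_neqAle dimvS ?addvSl // andbT; apply/negP => /eqP e.
  apply: zh; have /eqP -> : h == (h + <[z]>)%VS by rewrite -(geq_leqif (dimv_leqif_eq (addvSl _ _))) e.
  by apply: (subvP (addvSr h <[z]>)); apply: memv_line.
apply: contrapT => nex.
have [k hk] := hw.
have hkl a w : (k <= a)%N -> words (fun y => y \in h) a w -> w = 0.
  elim: a w => [|a IH] w; first by rewrite leqn0 => /eqP k0 h0; apply: hk; rewrite k0.
  rewrite leq_eqVlt => /predU1P[<-|ka]; first exact: hk.
  by move=> [y [w' [_ /IH-> // ->]]]; rewrite mulmx0.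
(* If nothing outside [h] normalizes it, bracketing with elements of [h] can go on outside [h] for
   ever. Each bracket adds a letter of [h] on one side, so after 2k brackets the result is 0, which
   lies in [h]. *)
have step j : exists z, [/\ n z, ~ z \in h & forall a b u v,
    words (fun y => y \in h) a u -> words (fun y => y \in h) b v ->
    (k + k <= a + b + j)%N -> u *m z *m v = 0].
  elim: j => [|j [z [nz zh hz]]].
    exists x; split=> // a b u v hu hv; rewrite addn0 => ab.
    case: (leqP k a) => [ka|ak]; first by rewrite (hkl a u) // !mul0mx.
    rewrite (hkl b v) ?mulmx0 // leqNgt; apply/negP => bk.
    by move: ab; rewrite leqNgt -addnS leq_add // ltnW.
  have [y [hy yz]] : exists y, y \in h /\ ~ y *m z - z *m y \in h.
    apply: contrapT => hh; apply: nex; exists z; split=> // y hy.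
    by apply: contrapT => yz; apply: hh; exists y.
  exists (y *m z - z *m y); split=> //; first by apply: nB => //; apply: hn.
  move=> a b u v hu hv ab; rewrite mulmxBr mulmxBl.
  have -> : u *m (y *m z) *m v = (u *m y) *m z *m v by rewrite !mulmxA.
  have -> : u *m (z *m y) *m v = u *m z *m (y *m v) by rewrite !mulmxA.
  rewrite (hz a.+1 b) ?(hz a b.+1) ?subrr //.
  - by exists y, v.
  - by move: ab; rewrite !(addnS, addSn).
  - exact: words_rcons.
  by move: ab; rewrite !(addnS, addSn).
have [z [nz zh hz]] := step (k + k)%N.
by apply: zh; have := hz 0%N 0%N 1%:M 1%:M erefl erefl (leqnn _); rewrite mul1mx mulmx1 => ->; apply: mem0v.
Qed.
End Engel.

(** * Complete reducibility *)

Section CommDeriv.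
Variables (K : numFieldType) (n : nat).
Implicit Types (X Y Z S : 'M[K]_n.+1) (p s : {poly K}).

Lemma comm_deriv X Y p : let Z := X * Y - Y * X in X * Z = Z * X ->
  horner_mx X p * Y - Y * horner_mx X p = horner_mx X p^`() * Z.
Proof.
move=> Z cXZ; elim/poly_ind: p => [|p c IH].
  by rewrite deriv0 !rmorph0 !mul0r mulr0 subrr.
rewrite derivD derivC derivM derivX addr0 mulr1 !rmorphD !rmorphM /=.
rewrite horner_mx_X horner_mx_C [_ * X + _ in RHS]addrC.
have cY : c%:M * Y = Y * c%:M by rewrite -!mulmxE mul_scalar_mx mul_mx_scalar.
move: (horner_mx X p) (horner_mx X p^`()) IH => h h' IH.
rewrite [RHS]mulrDl -[h' * X * Z]mulrA cXZ [h' * (Z * X)]mulrA -IH mulrBr mulrBl.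
rewrite mulrDl mulrDr cY opprD addrACA subrr addr0 !mulrA.
by rewrite addrA subrK.
Qed.

(** [S, Y] commutes with [S]. Applied to the polynomial w with simple roots that kills [S],
    [comm_deriv] gives w'(S) [S, Y] = 0, and w'(S) is invertible. *)
Lemma diag_commute X Y s r : let S := horner_mx X s in
  uniq r -> horner_mx S (\prod_(x <- r) ('X - x%:P)) = 0 ->
  X * (X * Y - Y * X) = (X * Y - Y * X) * X -> S * Y = Y * S.
Proof.
move=> S ur hS cXZ; have e1 := comm_deriv s cXZ.
set Z := X * Y - Y * X in cXZ e1.
have cSZ : S * Z = Z * S by apply: (comm_horner_mx s cXZ).
have cSZ' : S * (S * Y - Y * S) = (S * Y - Y * S) * S.
  have cSD : S * horner_mx X s^`() = horner_mx X s^`() * S by exact: comm_horner_mx2.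
  by rewrite e1 mulrA cSD -mulrA cSZ mulrA.
have := comm_deriv (\prod_(x <- r) ('X - x%:P)) cSZ'.
rewrite hS mul0r mulr0 subrr => /esym e2.
have := ur; rewrite -(@separable_prod_XsubC K) unlock => /Bezout_eq1_coprimepP[[a b] /= bez].
apply/eqP; rewrite -subr_eq0; apply/eqP.
rewrite -[LHS]mul1r -(rmorph1 (horner_mx S)) -bez rmorphD !rmorphM /= hS mulr0 add0r.
by rewrite -mulrA e2 mulr0.
Qed.
End CommDeriv.

Section ConjPair.
Variables (K : numClosedFieldType) (n : nat).
Implicit Types (X Y S T e : 'M[K]_n.+1).

(** [S] is the diagonalizable part of [X], and [T] has the conjugate eigenvalues on the same
    eigenspaces. [T] stands in for an adjoint of [S], but as a polynomial in [X] it commutes with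
    whatever commutes with [X]. *)
Definition conj_pair X S T := exists (s h : {poly K}) (r : seq K) (N : nat),
  [/\ uniq r, S = horner_mx X s /\ T = horner_mx S h,
      horner_mx S (\prod_(x <- r) ('X - x%:P)) = 0,
      (X - S) ^+ N = 0 & forall x, x \in r -> h.[x] = x^*].

Lemma conj_pair_ex X : exists S T, conj_pair X S T.
Proof.
have [s [r [N [ur hS hN]]]] := jordan X.
have [h hh] := crt_poly (fun x : K => x^*) 1 ur.
exists (horner_mx X s), (horner_mx (horner_mx X s) h), s, h, r, N; split=> // x xr.
apply/eqP; rewrite -subr_eq0 -[x^*](hornerC _ x) -hornerN -hornerD -/(root _ _).
by rewrite -dvdp_XsubCl; have := hh x xr; rewrite expr1.
Qed.

Lemma conj_pair_comm X S T Y : conj_pair X S T -> X * Y = Y * X ->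
  S * Y = Y * S /\ T * Y = Y * T.
Proof.
move=> [s [h [r [N [_ [-> ->] _ _ _]]]]] c.
have c1 := comm_horner_mx s c; split=> //.
exact: (comm_horner_mx h c1).
Qed.

Lemma conj_pair_trace X S T e : conj_pair X S T -> e * e = e ->
  e * X = X * e -> \tr (e * X * T) = 0 -> exists N, (e * X) ^+ N = 0.
Proof.
move=> [s [h [r [N [ur [eS eT] hS hN hh]]]]] ee ce; rewrite eT => tr0; exists N.
apply: (trace_conj_nilpotent ur hS hh) => //.
- by rewrite eS /GRing.comm; exact/esym/comm_horner_mx.
- by rewrite eS /GRing.comm; apply/esym/comm_horner_mx; exact/esym.
Qed.
Lemma conj_pair_diag X S T : conj_pair X S T -> exists P d,
  [/\ P \in unitmx, S = invmx P *m diag_mx d *m P &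
      T = invmx P *m diag_mx (map_mx (fun x => x^*) d) *m P].
Proof.
move=> [s [h0 [r0 [N [ur0 [eS eT] hS _ hh0]]]]].
have [P Pu /similar_diagPex[d /(similarLR Pu)]] := diag_ofP ur0 hS.
rewrite conjVmx // => {}eS.
have injP (B : 'M[K]_n.+1) : invmx P *m B *m P = 0 -> B = 0.
  move=> /(congr1 (fun x => P *m x *m invmx P)).
  by rewrite mulmx0 mul0mx !mulmxA mulmxV // mul1mx mulmxK.
have dr i : d 0 i \in r0.
  move: hS; rewrite eS horner_mx_uconjC // => /injP.
  rewrite horner_mx_diag => /matrixP/(_ i i); rewrite !mxE eqxx mulr1n => /eqP.
  by rewrite -/(root _ _) root_prod_XsubC.
exists P, d; split=> //.
rewrite eT eS horner_mx_uconjC // horner_mx_diag; congr (_ *m diag_mx _ *m _).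
by apply/rowP => i; rewrite !mxE hh0.
Qed.
End ConjPair.

(** * Lie algebras with nondegenerate trace form that contain their centralizer *)

Section ReductiveLie.
Variables (K : numClosedFieldType) (n : nat).
Implicit Types (X Y S T u : 'M[K]_n.+1).
Variable g : {vspace 'M[K]_n.+1}.

Definition centralizes u := forall X, X \in g -> u * X = X * u.

Hypothesis gB : forall X Y, X \in g -> Y \in g -> X * Y - Y * X \in g.
Hypothesis gN : forall X, X \in g -> (forall Y, Y \in g -> \tr (X * Y) = 0) -> X = 0.
Hypothesis gC : forall u, centralizes u -> u \in g.

Lemma mxtrace_bracket X Y Z :
  \tr ((X * Y - Y * X) * Z) = \tr (X * (Y * Z - Z * Y)) :> K.
Proof.
rewrite mulrBl mulrBr !raddfB /= -!mulrA; congr (_ - _).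
by rewrite -mulmxE mxtrace_mulC !mulmxE -!mulrA.
Qed.

(** By Engel's theorem X Y is nilpotent for X in the ideal and Y in [g], so the ideal lies in the
    radical of the trace form. *)
Lemma nil_ideal_eq0 (I : 'M[K]_n.+1 -> Prop) : lie_subspace I ->
  (forall X, I X -> X \in g) ->
  (forall X Y, I X -> Y \in g -> I (X * Y - Y * X)) ->
  (forall X, I X -> exists k, X ^+ k = 0) -> forall X, I X -> X = 0.
Proof.
move=> Il Ig IB Inil X IX; apply: gN; first exact: Ig.
move=> Y gY; have st : bracket_stable I Y by move=> Z IZ; apply: IB.
have [k hk] := nilpotent_mul_stable (engel Il Inil) IX st.
exact: nilpotent_trace hk.
Qed.

Lemma central_nil_eq0 u k : centralizes u -> u ^+ k = 0 -> u = 0.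
Proof.
move=> cu uk; apply: gN; first exact: gC.
move=> Y gY; rewrite (cu _ gY); apply: (@nilpotent_trace _ _ _ k).
by rewrite exprMn_comm ?uk ?mulr0 //; apply/esym/cu.
Qed.

(** The nilpotent part [u - S] of a central element is central as well, hence 0: central elements
    are diagonalizable. *)
Lemma central_pair u S T : centralizes u -> conj_pair u S T ->
  u = S /\ centralizes T.
Proof.
move=> cu c; have cST := fun X gX => conj_pair_comm c (cu X gX).
split; last by move=> X /cST[].
have [s [h [r [N [_ _ _ hN _]]]]] := c.
apply/eqP; rewrite -subr_eq0; apply/eqP; apply: central_nil_eq0 hN.
by move=> X gX; rewrite mulrBl mulrBr (cu _ gX) (cST _ gX).1.
Qed.

(** The conjugate [T] of [u] is an admissible [v], and tr(uT) is the sum of the squared moduli of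
    the eigenvalues of [u]. *)
Lemma central_trace_eq0 u : centralizes u ->
  (forall v, centralizes v -> \tr (u * v) = 0) -> u = 0.
Proof.
move=> cu tr0; have [S [T c]] := conj_pair_ex u.
have [_ cT] := central_pair cu c.
have [||N] := conj_pair_trace (e := 1) c (mulr1 _).
- by rewrite mulr1 mul1r.
- by rewrite mul1r; apply: tr0.
by rewrite mul1r; apply: central_nil_eq0.
Qed.

Variables (d : nat) (b : 'I_d.+1 -> 'M[K]_n.+1).
Hypothesis bg : forall i, b i \in g.
Hypothesis bspan : forall X, X \in g -> exists v : 'rV[K]_d.+1, X = \sum_i v 0 i *: b i.
Hypothesis bfree : forall v : 'rV[K]_d.+1, \sum_i v 0 i *: b i = 0 -> v = 0.

Definition lcomb (v : 'rV[K]_d.+1) := \sum_i v 0 i *: b i.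

Lemma lcomb_in v : lcomb v \in g.
Proof. by apply: memv_suml => i _; apply/memvZ/bg. Qed.

Lemma lcombD v w : lcomb (v + w) = lcomb v + lcomb w.
Proof.
by rewrite /lcomb -big_split; apply: eq_bigr => i _; rewrite !mxE scalerDl.
Qed.

Lemma lcombZ c v : lcomb (c *: v) = c *: lcomb v.
Proof.
by rewrite /lcomb scaler_sumr; apply: eq_bigr => i _; rewrite !mxE scalerA.
Qed.

Definition gram : 'M[K]_d.+1 := \matrix_(i, j) \tr (b i * b j).

Lemma gramE v w : \tr (lcomb v * lcomb w) = (v *m gram *m w^T) 0 0.
Proof.
rewrite /lcomb mulr_suml raddf_sum -mulmxA mxE; apply: eq_bigr => i _.
rewrite mulr_sumr raddf_sum !mxE mulr_sumr; apply: eq_bigr => j _ /=.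
by rewrite -scalerAl -scalerAr !linearZ !mxE /= [w _ _ * _]mulrC.
Qed.

Lemma gram_unit : gram \in unitmx.
Proof.
rewrite -row_free_unit -kermx_eq0; apply/eqP/row_matrixP => i; rewrite row0.
have h : row i (kermx gram) *m gram = 0 by rewrite -row_mul mulmx_ker row0.
apply: bfree; apply: gN; first exact: lcomb_in.
move=> Y /bspan[w ->]; rewrite -/(lcomb _) -/(lcomb w) gramE h mul0mx mxE //.
Qed.

(** Dual form of g = [g, g] + C. A functional on [g] is tr(X w) for some w in [g]; vanishing on
    brackets makes w central, and vanishing on the centralizer then makes it 0. *)
Lemma functional_eq0 (phi : 'M[K]_n.+1 -> K) :
  (forall c X Y, phi (c *: X + Y) = c * phi X + phi Y) ->
  (forall X Y, X \in g -> Y \in g -> phi (X * Y - Y * X) = 0) ->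
  (forall u, centralizes u -> phi u = 0) -> forall X, X \in g -> phi X = 0.
Proof.
move=> phiL phiB phiC.
pose w : 'rV[K]_d.+1 := (invmx gram *m \col_i phi (b i))^T.
have phiE X : X \in g -> phi X = \tr (X * lcomb w).
  move=> /bspan[v ->]; rewrite -/(lcomb v) gramE trmxK mulmxA mulmxK ?gram_unit //.
  by rewrite mxE /lcomb (functional_sum phiL); apply: eq_bigr => i _; rewrite mxE.
have cw : centralizes (lcomb w).
  move=> X gX; apply/eqP; rewrite -subr_eq0; apply/eqP; apply: gN.
    by apply: gB => //; apply: lcomb_in.
  move=> Y gY; rewrite mxtrace_bracket -mulmxE mxtrace_mulC mulmxE.
  by rewrite -phiE ?gB // phiB.
move=> X gX; rewrite phiE //; suff -> : lcomb w = 0 by rewrite mulr0 mxtrace0.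
apply: central_trace_eq0 => // v cv.
by rewrite -mulmxE mxtrace_mulC mulmxE -phiE ?gC // phiC.
Qed.

Definition is_adjoint X (c : 'M[K]_d.+1) :=
  forall i, b i * X - X * b i = \sum_j c i j *: b j.

Lemma adjoint_ex X : X \in g -> exists c, is_adjoint X c.
Proof.
move=> gX; have /choice[f hf] i : exists v : 'rV[K]_d.+1, b i * X - X * b i = lcomb v.
  by apply: bspan; apply: gB.
by exists (\matrix_(i, j) f i 0 j) => i; rewrite hf; apply: eq_bigr => j _; rewrite mxE.
Qed.

Lemma lcomb_adjoint X c v : is_adjoint X c ->
  lcomb v * X - X * lcomb v = lcomb (v *m c).
Proof.
move=> hc; rewrite /lcomb mulr_suml mulr_sumr -sumrB.
transitivity (\sum_i v 0 i *: \sum_j c i j *: b j).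
  by apply: eq_bigr => i _; rewrite -hc scalerBr scalerAl scalerAr.
under eq_bigr do rewrite scaler_sumr; rewrite exchange_big; apply: eq_bigr => j _.
by rewrite mxE scaler_suml; apply: eq_bigr => i _; rewrite scalerA.
Qed.

(** * Whitehead's first lemma: cocycles are coboundaries *)

Section Whitehead.
(** [rho] is a representation acting from the right on row vectors, and [kap] is a 1-cocycle with
    values in it. An invariant idempotent [e] stands for a direct summand. [rhoT] is the conjugation
    argument on summands, [rhoC] says that the centre acts semisimply on them, and [kapC] solves the
    problem for a single central element. *)
Variables (m : nat) (rho : 'M[K]_n.+1 -> 'M[K]_m.+1) (kap : 'M[K]_n.+1 -> 'rV[K]_m.+1).
Implicit Types (e f Om : 'M[K]_m.+1).

Definition inv_idem e := e * e = e /\ forall X, X \in g -> e * rho X = rho X * e.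

Hypothesis rhoL : forall c X Y, rho (c *: X + Y) = c *: rho X + rho Y.
Hypothesis rhoB : forall X Y, X \in g -> Y \in g ->
  rho (X * Y - Y * X) = rho X * rho Y - rho Y * rho X.
Hypothesis rhoT : forall X, X \in g -> exists2 T, T \in g & forall e, inv_idem e ->
  \tr (e * rho X * rho T) = 0 -> exists N, (e * rho X) ^+ N = 0.
Hypothesis rhoC : forall u e N, centralizes u -> inv_idem e ->
  (e * rho u) ^+ N = 0 -> e * rho u = 0.
Hypothesis kapL : forall c X Y, kap (c *: X + Y) = c *: kap X + kap Y.
Hypothesis kapB : forall X Y, X \in g -> Y \in g ->
  kap (X * Y - Y * X) = kap X *m rho Y - kap Y *m rho X.
Hypothesis kapC : forall u, centralizes u -> exists v, kap u = v *m rho u.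

Definition cobound e := exists v, forall X, X \in g -> kap X *m e = v *m rho X *m e.

Let rho0 : rho 0 = 0.
Proof. by have := rhoL (-1) 0 0; rewrite scaler0 addr0 scaleN1r addNr. Qed.

Let rhoD X Y : rho (X + Y) = rho X + rho Y.
Proof. by have := rhoL 1 X Y; rewrite !scale1r. Qed.

Let rhoZ c X : rho (c *: X) = c *: rho X.
Proof. by have := rhoL c X 0; rewrite !addr0 rho0 addr0. Qed.

Let kap0 : kap 0 = 0.
Proof. by have := kapL (-1) 0 0; rewrite scaler0 addr0 scaleN1r addNr. Qed.

Let rho_sum (I : Type) (r : seq I) c (F : I -> 'M[K]_n.+1) :
  rho (\sum_(i <- r) c i *: F i) = \sum_(i <- r) c i *: rho (F i).
Proof. by elim/big_rec2: _ => // i y x _ <-; exact: rhoL. Qed.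

(* An operator Om commuting with rho splits off the part of e on which it is
   invertible; there the cocycle is the coboundary of v Om^-1. *)
Lemma split_off e Om v : inv_idem e ->
  (forall X, X \in g -> Om * rho X = rho X * Om) -> e * Om = Om * e ->
  (forall X, X \in g -> kap X *m Om *m e = v *m rho X *m e) ->
  (forall N, (e * Om) ^+ N <> 0) ->
  exists e', [/\ inv_idem e', (\rank e' < \rank e)%N & cobound e' -> cobound e].
Proof.
move=> [ee ce] cOm ceO hv nnil; pose W := e * Om.
have eW : e * W = W by rewrite /W mulrA ee.
have We : W * e = W by rewrite /W -mulrA -ceO mulrA ee.
have cW X : X \in g -> W * rho X = rho X * W.
  by move=> gX; rewrite /W -mulrA cOm // mulrA ce // mulrA.
have [h [N]] := fitting W; set f := horner_mx W _ => -[ff fN].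
have cH p X : X \in g -> horner_mx W p * rho X = rho X * horner_mx W p.
  by move=> gX; apply: (comm_horner_mx p (cW X gX)).
have cHe p : horner_mx W p * e = e * horner_mx W p.
  by apply: (@comm_horner_mx _ _ W e p); rewrite /comm_mx -!mulmxE in eW We *; rewrite eW We.
have fE : f = W * horner_mx W h by rewrite /f rmorphM /= horner_mx_X.
have ef : e * f = f by rewrite fE mulrA eW.
have fe : f * e = f by rewrite cHe ef.
have f0 : f != 0.
  apply/eqP => f0; move: fN; rewrite f0 subr0 mulr1; exact: nnil.
have i' : inv_idem (e - f).
  split=> [|X gX]; last by rewrite mulrBl mulrBr ce // cH.
  by rewrite mulrBl !mulrBr ee ef fe ff subrr subr0.
exists (e - f); split=> //.
  have : \tr e = \tr (e - f) + \tr f by rewrite raddfB /= subrK.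
  rewrite !mxtrace_idem ?i'.1 // -natrD => /eqP; rewrite eqr_nat => /eqP->.
  by rewrite -addn1 leq_add2l lt0n mxrank_eq0.
move=> [v' hv']; exists (v' *m (e - f) + v *m horner_mx W h) => X gX.
have -> : kap X *m e = kap X *m (e - f) + kap X *m f by rewrite -mulmxDr subrK.
rewrite hv' // !mulmxDl; congr (_ + _).
  have h1 : rho X * (e - f) = (e - f) * (rho X * e).
    by rewrite mulrA (i'.2 X gX) -mulrA mulrBl ee fe.
  by rewrite -!mulmxA; congr (_ *m _); exact: h1.
have -> : kap X *m f = kap X *m Om *m e *m horner_mx W h.
  have -> : f = Om *m e *m horner_mx W h by rewrite fE; congr (_ * _); exact: ceO.
  by rewrite !mulmxA.
rewrite hv // -!mulmxA; congr (_ *m _).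
have h2 : rho X * (e * horner_mx W h) = horner_mx W h * (rho X * e).
  by rewrite mulrA -ce // -mulrA -cH // mulrA -cHe -mulrA ce.
exact: h2.
Qed.

(** Used twice: for [k = rho] it says that the Casimir operator of the invariant tensor [L] commutes
    with [rho], and for [k = kap] it yields the vector required by [split_off]. *)
Lemma casimir p (k : 'M[K]_n.+1 -> 'M[K]_(p, m.+1)) (L c : 'M[K]_d.+1) X :
  (forall c X Y, k (c *: X + Y) = c *: k X + k Y) ->
  (forall X Y, X \in g -> Y \in g ->
    k (X * Y - Y * X) = k X *m rho Y - k Y *m rho X) ->
  X \in g -> is_adjoint X c -> c^T *m L + L *m c = 0 ->
  k X *m (\sum_i \sum_j L i j *: (rho (b i) *m rho (b j))) =
  (\sum_i \sum_j L i j *: (k (b i) *m rho (b j))) *m rho X.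
Proof.
move=> kL kB gX hc hL.
have k0 : k 0 = 0 by have := kL (-1) 0 0; rewrite scaler0 addr0 scaleN1r addNr.
have ksum (F : 'I_d.+1 -> K) (G : 'I_d.+1 -> 'M_n.+1) :
    k (\sum_i F i *: G i) = \sum_i F i *: k (G i).
  by elim/big_rec2: _ => // i y x _ <-; exact: kL.
pose S (M : 'M_d.+1) := \sum_i \sum_j M i j *: (k (b i) *m rho (b j)).
have SD M M' : S (M + M') = S M + S M'.
  rewrite /S -big_split; apply: eq_bigr => i _; rewrite -big_split.
  by apply: eq_bigr => j _; rewrite mxE scalerDl.
have S0 : S 0 = 0.
  by rewrite /S big1 // => i _; rewrite big1 // => j _; rewrite mxE scale0r.
have S1 : S (c^T *m L) = \sum_i \sum_j L i j *: (k (b i * X - X * b i) *m rho (b j)).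
  rewrite /S exchange_big [RHS]exchange_big; apply: eq_bigr => j _ /=.
  transitivity (\sum_i \sum_l (c l i * L l j) *: (k (b i) *m rho (b j))).
    by apply: eq_bigr => i _; rewrite mxE scaler_suml; apply: eq_bigr => l _; rewrite mxE.
  rewrite exchange_big; apply: eq_bigr => l _ /=; rewrite hc ksum mulmx_suml scaler_sumr.
  by apply: eq_bigr => i _; rewrite -scalemxAl scalerA mulrC.
have S2 : S (L *m c) = \sum_i \sum_j L i j *: (k (b i) *m rho (b j * X - X * b j)).
  rewrite /S; apply: eq_bigr => i _.
  transitivity (\sum_j \sum_l (L i l * c l j) *: (k (b i) *m rho (b j))).
    by apply: eq_bigr => j _; rewrite mxE scaler_suml.
  rewrite exchange_big; apply: eq_bigr => l _ /=; rewrite hc rho_sum mulmx_sumr scaler_sumr.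
  by apply: eq_bigr => j _; rewrite -scalemxAr scalerA.
apply/eqP; rewrite eq_sym -subr_eq0; apply/eqP; rewrite -[RHS]S0 -hL SD S1 S2.
rewrite mulmx_suml mulmx_sumr -sumrB -big_split; apply: eq_bigr => i _.
rewrite mulmx_suml mulmx_sumr -sumrB -big_split; apply: eq_bigr => j _ /=.
rewrite -scalemxAl -scalemxAr -scalerBr -scalerDr; congr (_ *: _).
rewrite kB // rhoB // -!mulmxE mulmxBr mulmxBl !mulmxA.
by rewrite [RHS]addrC addrA subrK.
Qed.

Section AtIdempotent.
Variable e : 'M[K]_m.+1.
Hypothesis he : inv_idem e.

Definition rgram : 'M[K]_d.+1 := \matrix_(i, j) \tr (e * rho (b i) * rho (b j)).

Lemma rgramE v w :
  \tr (e * rho (lcomb v) * rho (lcomb w)) = (v *m rgram *m w^T) 0 0.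
Proof.
rewrite /lcomb !rho_sum [e * _]mulr_sumr mulr_suml raddf_sum -mulmxA mxE.
apply: eq_bigr => i _; rewrite mulr_sumr raddf_sum !mxE mulr_sumr.
apply: eq_bigr => j _ /=.
by rewrite -!scalerAr -scalerAl !linearZ !mxE /= mulrC mulrA.
Qed.

Lemma rgram_sym : rgram^T = rgram.
Proof.
apply/matrixP => i j; rewrite !mxE he.2 // -mulrA -mulmxE mxtrace_mulC !mulmxE.
by rewrite -mulrA mulrA.
Qed.

Lemma gram_sym : gram^T = gram.
Proof. by apply/matrixP => i j; rewrite !mxE -mulmxE mxtrace_mulC. Qed.

Lemma adjoint_gram X c : X \in g -> is_adjoint X c -> c *m gram + gram *m c^T = 0.
Proof.
move=> gX hc; apply/matrixP => i j; rewrite !mxE.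
transitivity (\tr ((b i * X - X * b i) * b j) + \tr (b i * (b j * X - X * b j))).
  rewrite !hc mulr_suml mulr_sumr !raddf_sum; congr (_ + _); apply: eq_bigr => k _.
    by rewrite !mxE -scalerAl [RHS]mxtraceZ.
  by rewrite !mxE -scalerAr [RHS]mxtraceZ /= mulrC.
by rewrite mxtrace_bracket -raddfD -mulrDr /= -opprB addrC subrr mulr0 raddf0.
Qed.

Lemma adjoint_rgram X c : X \in g -> is_adjoint X c ->
  c *m rgram + rgram *m c^T = 0.
Proof.
move=> gX hc; apply/matrixP => i j; rewrite !mxE.
transitivity (\tr (e * rho (b i * X - X * b i) * rho (b j)) +
              \tr (e * rho (b i) * rho (b j * X - X * b j))).
  rewrite !hc !rho_sum mulr_sumr mulr_suml mulr_sumr !raddf_sum.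
  congr (_ + _); apply: eq_bigr => k _.
    by rewrite !mxE -scalerAr -scalerAl [RHS]mxtraceZ.
  by rewrite !mxE -scalerAr [RHS]mxtraceZ /= mulrC.
rewrite !rhoB // mulrBr mulrBl mulrBr !raddfB /=.
rewrite [e * (rho X * _)]mulrA (he.2 X gX) -!mulrA.
have -> : \tr (rho X * (e * (rho (b i) * rho (b j)))) =
          \tr (e * (rho (b i) * (rho (b j) * rho X))).
  by rewrite -mulmxE mxtrace_mulC !mulmxE !mulrA.
by rewrite addrC addrA subrK subrr.
Qed.

Hypothesis hU : forall u, centralizes u -> e * rho u = 0.

(** The endomorphism of [g], in coordinates, that carries the trace form of [g] to that of the
    summand [e]. It commutes with the adjoint action because both forms are invariant. *)
Let T : 'M[K]_d.+1 := rgram *m invmx gram.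

Let TG : T *m gram = rgram.
Proof. by rewrite /T mulmxKV // gram_unit. Qed.

Let adjoint_T X c : X \in g -> is_adjoint X c -> c *m T = T *m c.
Proof.
move=> gX hc; apply: (can_inj (mulmxK gram_unit)).
rewrite -mulmxA TG -[in RHS]mulmxA.
have /eqP := adjoint_rgram gX hc; rewrite addr_eq0 => /eqP->.
have /eqP := adjoint_gram gX hc; rewrite addr_eq0 => /eqP->.
by rewrite mulmxN mulmxA TG.
Qed.

(** The tensor is twisted by h(T), the partial inverse of [T] from [fitting], so that the Casimir
    operator has trace [\tr f] on [e]. This is the rank of a nonzero idempotent, so the operator is
    not nilpotent there. *)
Lemma casimir_split : (forall N, T ^+ N <> 0) ->
  exists e', [/\ inv_idem e', (\rank e' < \rank e)%N & cobound e' -> cobound e].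
Proof.
move=> nT; have [h [N]] := fitting T; set f := horner_mx T _ => -[ff fN].
pose L := invmx gram *m horner_mx T h.
have hL X c : X \in g -> is_adjoint X c -> c^T *m L + L *m c = 0.
  move=> gX hc; have cT := adjoint_T gX hc.
  have cH : c *m horner_mx T h = horner_mx T h *m c.
    exact/esym/(comm_horner_mx h)/esym.
  have h1 : c^T *m invmx gram = - (invmx gram *m c).
    have /eqP := adjoint_gram gX hc; rewrite addr_eq0 => /eqP e1.
    apply: (can_inj (mulKmx gram_unit)); rewrite mulmxN mulmxA.
    by rewrite -[gram *m c^T]opprK -e1 mulNmx mulmxK ?gram_unit // mulKVmx ?gram_unit.
  by rewrite /L mulmxA h1 mulNmx -!mulmxA cH addNr.
apply: (@split_off e (\sum_i \sum_j L i j *: (rho (b i) *m rho (b j)))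
                   (\sum_i \sum_j L i j *: (kap (b i) *m rho (b j)))) => //.
- move=> X gX; have [c hc] := adjoint_ex gX.
  exact/esym/(casimir rhoL rhoB gX hc (hL X c gX hc)).
- rewrite mulr_sumr mulr_suml; apply: eq_bigr => i _.
  rewrite mulr_sumr mulr_suml; apply: eq_bigr => j _.
  rewrite -scalerAr -scalerAl mulmxE; congr (_ *: _).
  by rewrite mulrA he.2 // -mulrA he.2 // mulrA.
- move=> X gX; have [c hc] := adjoint_ex gX.
  by rewrite (casimir kapL kapB gX hc (hL X c gX hc)).
move=> N'; move=> /nilpotent_trace.
have -> : \tr (e * (\sum_i \sum_j L i j *: (rho (b i) *m rho (b j)))) = \tr f.
  have -> : \tr f = \tr (L *m rgram^T).
    rewrite rgram_sym /L -mulmxA mxtrace_mulC -mulmxA -/T /f rmorphM /= horner_mx_X.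
    by rewrite -mulmxE mxtrace_mulC.
  rewrite mulr_sumr raddf_sum; apply: eq_bigr => i _ /=.
  rewrite mulr_sumr raddf_sum !mxE; apply: eq_bigr => j _ /=.
  by rewrite -scalerAr mxtraceZ !mxE mulmxE mulrA.
move=> /(idem_trace0 ff) f0; apply: (nT N).
by move: fN; rewrite f0 subr0 mulr1.
Qed.

Let gramT (w w' : 'rV[K]_d.+1) k :
  (w *m T ^+ k *m gram *m (w' *m T ^+ k)^T) =
  w *m T ^+ (k + k) *m gram *m w'^T.
Proof.
have GT : gram *m T^T = T *m gram.
  by rewrite -[gram in LHS]gram_sym -trmx_mul TG rgram_sym.
have GTk j : gram *m (T ^+ j)^T = T ^+ j *m gram.
  elim: j => [|j IH]; first by rewrite !expr0 trmx1 mulmx1 mul1mx.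
  have cT : T *m T ^+ j = T ^+ j *m T by rewrite mulmxE -exprS exprSr.
  by rewrite exprSr -mulmxE trmx_mul mulmxA GT -mulmxA IH mulmxA cT.
by rewrite trmx_mul !mulmxA -[w *m _ *m gram *m _]mulmxA GTk exprD -mulmxE !mulmxA.
Qed.

(** The image I of the last nonzero power of [T] is an ideal, isotropic for the trace form and
    orthogonal to the centralizer. Such an ideal consists of nilpotents, so it is 0. *)
Lemma rgram_nil_eq0 N : T ^+ N = 0 -> rgram = 0.
Proof.
move=> TN; apply/eqP/contraT => rg0.
have T0 : T != 0 by apply: contra_neq rg0 => T0; rewrite -TG T0 mul0mx.
have ex : exists j, T ^+ j == 0 by exists N; rewrite TN.
case: (ex_minnP ex) => [[|[|k]]]; rewrite ?expr0 ?oner_eq0 ?expr1 ?(negbTE T0) //.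
(* Exponents 0 and 1 are excluded, so the least one is k + 2. As 2(k + 1) is at least that, the
   image of [T ^+ k.+1] is isotropic. *)
move=> /eqP Tk kmin.
have Tk0 : T ^+ k.+1 != 0 by apply/negP => /kmin; rewrite ltnn.
pose I X := exists w, X = lcomb (w *m T ^+ k.+1).
have Ig X : I X -> X \in g by move=> [w ->]; apply: lcomb_in.
have IB X Y : I X -> Y \in g -> I (X * Y - Y * X).
  move=> [w ->] gY; have [c hc] := adjoint_ex gY.
  rewrite (lcomb_adjoint _ hc); exists (w *m c); rewrite -!mulmxA; congr (lcomb (_ *m _)).
  exact/esym/(commrX _ (adjoint_T gY hc)).
have II X Y : I X -> I Y -> \tr (X * Y) = 0.
  move=> [w ->] [w' ->]; rewrite gramE gramT.
  have -> : (k.+1 + k.+1 = k.+2 + k)%N by rewrite [RHS]addSnnS.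
  by rewrite exprD Tk mul0r mulmx0 !mul0mx mxE.
have IC X u : I X -> centralizes u -> \tr (X * u) = 0.
  move=> [w ->] cu; have [v ev] := bspan (gC cu).
  rewrite [u]ev -/(lcomb v) gramE exprSr -mulmxE mulmxA -[_ *m T *m gram]mulmxA TG.
  rewrite -rgramE /lcomb -ev he.2 ?lcomb_in // -mulrA hU // mulr0 raddf0 //.
have I0 : forall X, I X -> X = 0.
  apply: (nil_ideal_eq0 _ Ig IB).
    split.
    - by exists 0; rewrite mul0mx /lcomb big1 // => i _; rewrite mxE scale0r.
    - by move=> X Y [w ->] [w' ->]; exists (w + w'); rewrite mulmxDl lcombD.
    - by move=> c X [w ->]; exists (c *: w); rewrite -scalemxAl lcombZ.
    by move=> X Y IX IY; apply: IB => //; apply: Ig.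
  (* Isotropy gives [X, [X, Y]] = 0 for Y in [g], so the diagonalizable part [S] centralizes [g],
     and with it [T']. Orthogonality to the centralizer then makes [X] nilpotent. *)
  move=> X IX; have gX := Ig _ IX; have [S [T' cp]] := conj_pair_ex X.
  have cS Y : Y \in g -> S * Y = Y * S.
    move=> gY; have IXY := IB _ _ IX gY.
    have [s [h [r [N' [ur [eS eT] hS hN hh]]]]] := cp; rewrite eS.
    apply: (diag_commute ur); first by rewrite -eS.
    apply/eqP; rewrite -subr_eq0; apply/eqP; apply: gN.
      by apply: gB => //; apply: Ig.
    by move=> Z gZ; rewrite mxtrace_bracket II //; apply: IB.
  have cT' : centralizes T'.
    move=> Y gY; have [s [h [r [N' [ur [eS eT] hS hN hh]]]]] := cp; rewrite eT.
    exact: (comm_horner_mx h (cS Y gY)).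
  have [||N'] := conj_pair_trace (e := 1) cp (mulr1 _).
  - by rewrite mulr1 mul1r.
  - by rewrite mul1r; apply: IC.
  by rewrite mul1r; exists N'.
case/eqP: Tk0; apply/row_matrixP => i; rewrite row0; apply: bfree.
by rewrite rowE; apply: I0; exists (delta_mx 0 i).
Qed.

(* As rgram = 0, e rho(g) consists of nilpotents; descend along the words of Engel's
   theorem, killing the cocycle on [g, g] at each step. *)
Lemma cobound_nil : rgram = 0 -> cobound e.
Proof.
move=> rg0; exists 0 => X gX; rewrite !mul0mx.
pose I (y : 'M[K]_m.+1) := exists2 Y, Y \in g & y = e *m rho Y.
have ee : e *m e = e := he.1.
have ec Y : Y \in g -> e *m rho Y = rho Y *m e := he.2 Y.
have Il : lie_subspace I.
  split.
  - by exists 0; rewrite ?mem0v // rho0 mulmx0.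
  - move=> x y [Y gY ->] [Z gZ ->]; exists (Y + Z); first exact: memvD.
    by rewrite rhoD mulmxDr.
  - move=> c x [Y gY ->]; exists (c *: Y); first exact: memvZ.
    by rewrite rhoZ scalemxAr.
  move=> x y [Y gY ->] [Z gZ ->]; exists (Y * Z - Z * Y); first exact: gB.
  rewrite rhoB // -!mulmxE mulmxBr !mulmxA.
  by rewrite -[e *m rho Y *m e]mulmxA -ec // -[e *m rho Z *m e]mulmxA -ec // !mulmxA ee.
have Inil x : I x -> exists N, x ^+ N = 0.
  move=> [Y gY ->]; have [T' gT' hT'] := rhoT gY; apply: hT' => //.
  have [v ->] := bspan gY; have [w ->] := bspan gT'.
  by rewrite -/(lcomb v) -/(lcomb w) rgramE rg0 mulmx0 mul0mx mxE.
have [k hk] := engel Il Inil.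
suff h j Y w : (j <= k)%N -> Y \in g -> words I (k - j) w -> kap Y *m e *m w = 0.
  have := h k X 1%:M (leqnn k) gX; rewrite subnn => /(_ erefl).
  by rewrite mulmx1.
elim: j Y w => [|j IH] Y w jk gY hw.
  by rewrite subn0 in hw; rewrite (hk _ hw) mulmx0.
apply/rowP => l; rewrite [RHS]mxE.
apply: (functional_eq0 (phi := fun Y => (kap Y *m e *m w) 0 l)) gY.
- by move=> c A B; rewrite kapL !mulmxDl -!scalemxAl !mxE.
- move=> A B gA gB'; rewrite kapB // !mulmxBl.
  have z A' B' : A' \in g -> B' \in g -> kap A' *m rho B' *m e *m w = 0.
    move=> gA' gB''; have := IH A' (e *m rho B' *m w) (ltnW jk) gA'.
    rewrite !mulmxA -[kap A' *m e *m e]mulmxA ee -[kap A' *m e *m _]mulmxA ec //.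
    rewrite !mulmxA; apply.
    by rewrite -subnSK //; exists (e *m rho B'), w; split; rewrite ?ec //; exists B'; rewrite ?ec.
  by rewrite !z // subrr mxE.
move=> u cu; have [v ->] := kapC cu.
have hu : rho u *m e = 0 by rewrite -ec ?gC //; apply: hU.
by rewrite -!mulmxA [rho u *m _]mulmxA hu mul0mx mulmx0 mxE.
Qed.
End AtIdempotent.

(** Induction on the rank of [e]. A central element acting nontrivially on [e], or a Casimir
    operator if the trace form of [e] is not nilpotent relative to that of [g], splits off a part
    where the cocycle is solved. Otherwise the cocycle vanishes on [e]. *)
Theorem whitehead : exists v, forall X, X \in g -> kap X = v *m rho X.
Proof.
suff h : forall r e, (\rank e <= r)%N -> inv_idem e -> cobound e.
  have [|v hv] := h m.+1 1 (rank_leq_row _).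
    by split=> [|X _]; rewrite ?mulr1 ?mul1r.
  by exists v => X /hv; rewrite !mulmx1.
have main e : inv_idem e -> cobound e \/
    exists e', [/\ inv_idem e', (\rank e' < \rank e)%N & cobound e' -> cobound e].
  move=> he; have [[u [cu eu]]|hU] := pselect (exists u, centralizes u /\ e * rho u <> 0).
    right; have gu := gC cu.
    have cuX X : X \in g -> u * X - X * u = 0 by move=> gX; rewrite cu // subrr.
    apply: (@split_off e (rho u) (kap u)) => // [X gX||X gX|N].
    - have := rhoB gu gX; rewrite cuX // rho0 => /eqP.
      by rewrite eq_sym subr_eq0 => /eqP.
    - by rewrite he.2.
    - have := kapB gu gX; rewrite cuX // kap0 => /eqP.
      by rewrite eq_sym subr_eq0 => /eqP->.
    by move=> /(rhoC cu he).
  have {}hU u : centralizes u -> e * rho u = 0.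
    by move=> cu; apply: contrapT => h; apply: hU; exists u.
  have [[N TN]|nT] := pselect (exists N, (rgram e *m invmx gram) ^+ N = 0).
    by left; apply: cobound_nil => //; apply: rgram_nil_eq0 TN.
  by right; apply: casimir_split => // N TN; apply: nT; exists N.
elim=> [|r IH] e hr he; have [//|[e' [he' re hc]]] := main e he.
  by move: re; rewrite (eqP (_ : \rank e == 0%N)) ?ltn0 // -leqn0.
by apply: hc; apply: IH => //; rewrite -ltnS; apply: leq_trans re hr.
Qed.
End Whitehead.
End ReductiveLie.

(** * The adjoint action on all matrices *)

Section AdRep.
Variables (K : numClosedFieldType) (n : nat).
Implicit Types (X Y S T Z u : 'M[K]_n.+1) (p q : {poly K}).

(** Chosen so that [adm.+1] is convertible to [n.+1 * n.+1]: matrices become row vectors whose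
    length is visibly a successor, the form that [whitehead] uses. *)
Definition adm : nat := (n + n * n.+1)%N.
Definition vm Z : 'rV[K]_adm.+1 := mxvec Z.
Definition mv (v : 'rV[K]_adm.+1) : 'M[K]_n.+1 := vec_mx (v : 'rV_(n.+1 * n.+1)).
Definition rmul X : 'M[K]_adm.+1 := lin_mulmxr X : 'M_(n.+1 * n.+1).
Definition lmul X : 'M[K]_adm.+1 := lin_mulmx X : 'M_(n.+1 * n.+1).
(** On row vectors, from the right, [ad X] sends Z to Z X - X Z. With this sign it preserves
    brackets. *)
Definition ad X := rmul X - lmul X.

Lemma vmK : cancel vm mv. Proof. exact: mxvecK. Qed.
Lemma mvK : cancel mv vm. Proof. exact: vec_mxK. Qed.

Lemma vm_rmul Z X : vm Z *m rmul X = vm (Z * X).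
Proof.
have h : mxvec Z *m lin_mulmxr X = mxvec (Z *m X) by rewrite mul_vec_lin.
exact: h.
Qed.

Lemma vm_lmul Z X : vm Z *m lmul X = vm (X * Z).
Proof.
have h : mxvec Z *m lin_mulmx X = mxvec (X *m Z) by rewrite mul_vec_lin.
exact: h.
Qed.

Lemma vm_is_linear : linear vm.
Proof.
move=> c A B; have h : mxvec (c *: A + B) = c *: mxvec A + mxvec B by rewrite linearP.
exact: h.
Qed.
HB.instance Definition _ := GRing.isLinear.Build K _ _ _ vm vm_is_linear.

Lemma vm_ad Z X : vm Z *m ad X = vm (Z * X - X * Z).
Proof. by rewrite mulmxBr vm_rmul vm_lmul raddfB. Qed.

Lemma vm_ext (A B : 'M[K]_adm.+1) : (forall Z, vm Z *m A = vm Z *m B) -> A = B.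
Proof.
move=> h; apply/row_matrixP => i; rewrite !rowE.
by rewrite -[delta_mx _ _]mvK h.
Qed.

Lemma ad_is_linear : linear ad.
Proof.
move=> c X Y; apply: vm_ext => Z.
rewrite [RHS]mulmxDr -scalemxAr !vm_ad -linearP; congr vm.
by rewrite mulrDr mulrDl opprD addrACA -scalerAr -scalerAl -scalerBr.
Qed.
HB.instance Definition _ := GRing.isLinear.Build K _ _ _ ad ad_is_linear.

Lemma ad_bracket X Y : ad X * ad Y - ad Y * ad X = ad (X * Y - Y * X).
Proof.
apply: vm_ext => Z; rewrite -!mulmxE [LHS]mulmxBr !mulmxA !vm_ad -raddfB; congr vm => /=.
rewrite !(mulrBr, mulrBl, opprB, mulrA).
move: (Z * X * Y) (X * Z * Y) (Y * Z * X) (Y * X * Z) (Z * Y * X) (X * Y * Z).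
by move=> a1 a2 a3 a4 a5 a6; apply/matrixP => i j; rewrite !mxE; ring.
Qed.

Lemma ad_nilpotent X N : X ^+ N = 0 -> ad X ^+ (N + N) = 0.
Proof.
move=> XN.
have hr k Z : vm Z *m rmul X ^+ k = vm (Z * X ^+ k).
  elim: k Z => [|k IH] Z; first by rewrite !expr0 mulmx1 mulr1.
  by rewrite exprS -mulmxE mulmxA vm_rmul IH -mulrA -exprS.
have hl k Z : vm Z *m lmul X ^+ k = vm (X ^+ k * Z).
  elim: k Z => [|k IH] Z; first by rewrite !expr0 mulmx1 mul1r.
  by rewrite exprS -mulmxE mulmxA vm_lmul IH mulrA -exprSr.
have c : GRing.comm (rmul X) (lmul X).
  by apply: vm_ext => Z; rewrite -!mulmxE !mulmxA !(vm_rmul, vm_lmul) mulrA.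
have r0 : rmul X ^+ N = 0 by apply: vm_ext => Z; rewrite hr XN mulr0 mulmx0 raddf0.
have l0 : lmul X ^+ N = 0 by apply: vm_ext => Z; rewrite hl XN mul0r mulmx0 raddf0.
rewrite /ad exprBn_comm // big1 // => i _.
have [Ni|iN] := leqP N i.
  by rewrite -(subnK Ni) [lmul X ^+ _]exprD l0 mulr0 !mulr0 mul0rn.
have Nj : (N <= N + N - i)%N by rewrite leq_subRL ?leq_add2r; [exact: ltnW | apply: leq_trans (ltnW iN) (leq_addr _ _)].
by rewrite -(subnK Nj) exprD r0 mulr0 mulr0 mul0r mul0rn.
Qed.

Lemma ad_diag P (d : 'rV[K]_n.+1) S q Z : P \in unitmx ->
  S = invmx P *m diag_mx d *m P ->
  vm Z *m horner_mx (ad S) q =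
  vm (invmx P *m (\matrix_(i, j) ((P *m Z *m invmx P) i j * q.[d 0 j - d 0 i])) *m P).
Proof.
move=> Pu eS; elim/poly_ind: q => [|q c IH].
  rewrite rmorph0 mulmx0; set M := \matrix_(i, j) _; have -> : M = 0.
    by apply/matrixP => i j; rewrite !mxE horner0 mulr0.
  by rewrite mulmx0 mul0mx raddf0.
rewrite rmorphD rmorphM /= horner_mx_X horner_mx_C -mulmxE mulmxDr mulmxA IH vm_ad.
rewrite mul_mx_scalar -linearZ -linearD; congr vm => /=.
rewrite eS -!mulmxE !mulmxA; set M := \matrix_(i, j) _; set M' := \matrix_(i, j) _.
have -> : Z = invmx P *m (P *m Z *m invmx P) *m P.
  by rewrite !mulmxA mulVmx // mul1mx mulmxKV.
set W := P *m Z *m invmx P in M M' *; clearbody W.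
rewrite -[invmx P *m M *m P *m invmx P]mulmxA mulmxV // mulmx1.
rewrite -[invmx P *m diag_mx d *m P *m invmx P]mulmxA mulmxV // mulmx1.
rewrite -!mulmxA scalemxAr -!mulmxBr -mulmxDr scalemxAl; congr (_ *m _).
rewrite !mulmxA -mulmxBl -mulmxDl; congr (_ *m _).
apply/matrixP => i j; rewrite mul_mx_diag mul_diag_mx !mxE hornerD hornerM hornerX hornerC.
by ring.
Qed.

Lemma ad_conj_pair X S T : conj_pair X S T -> exists (h : {poly K}) (r : seq K),
  [/\ uniq r, 0 \in r, horner_mx (ad S) (\prod_(x <- r) ('X - x%:P)) = 0,
      horner_mx (ad S) h = ad T & forall x, x \in r -> h.[x] = x^*].
Proof.
move=> /conj_pair_diag[P [d [Pu eS eT]]].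
(* 0 is listed explicitly: [h] and the polynomial with roots [r] then both vanish at 0, so that
   [rho_poly] applies to them. *)
pose r := undup (0 :: [seq d 0 ij.2 - d 0 ij.1 | ij : 'I_n.+1 * 'I_n.+1]).
have hr i j : d 0 j - d 0 i \in r.
  rewrite mem_undup inE; apply/orP; right; apply/mapP.
  by exists (i, j); rewrite ?mem_enum.
have [h hh] := crt_poly (fun x : K => x^*) 1 (undup_uniq (0 :: [seq d 0 ij.2 - d 0 ij.1 | ij : 'I_n.+1 * 'I_n.+1])).
have {}hh x : x \in r -> h.[x] = x^*.
  move=> xr; apply/eqP; rewrite -subr_eq0 -[x^*](hornerC _ x) -hornerN -hornerD -/(root _ _).
  by rewrite -dvdp_XsubCl; have := hh x xr; rewrite expr1.
exists h, r; split=> //; first exact: undup_uniq.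
- by rewrite mem_undup mem_head.
- apply: vm_ext => Z; rewrite (ad_diag _ _ Pu eS) mulmx0.
  set M := \matrix_(i, j) _; suff -> : M = 0 by rewrite mulmx0 mul0mx raddf0.
  apply/matrixP => i j; rewrite !mxE.
  have /rootP-> : root (\prod_(x <- r) ('X - x%:P)) (d 0 j - d 0 i).
    by rewrite root_prod_XsubC.
  by rewrite mulr0.
apply: vm_ext => Z; rewrite (ad_diag _ _ Pu eS) vm_ad; congr vm.
rewrite eT; set M := \matrix_(i, j) _.
have -> : Z = invmx P *m (P *m Z *m invmx P) *m P.
  by rewrite !mulmxA mulVmx // mul1mx mulmxKV.
set W := P *m Z *m invmx P in M *; clearbody W.
rewrite -!mulmxE !mulmxA.
rewrite -[invmx P *m W *m P *m invmx P]mulmxA mulmxV // mulmx1.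
rewrite -[invmx P *m diag_mx _ *m P *m invmx P]mulmxA mulmxV // mulmx1.
rewrite -!mulmxA -!mulmxBr; congr (_ *m _); rewrite !mulmxA -mulmxBl; congr (_ *m _).
apply/matrixP => i j; rewrite mul_mx_diag mul_diag_mx !mxE hh // rmorphB /=.
by ring.
Qed.
End AdRep.

Lemma vspace_basis (K : fieldType) (V : vectType K) (g : {vspace V}) v0 :
  v0 \in g -> v0 != 0 -> exists d (b : 'I_d.+1 -> V),
  [/\ forall i, b i \in g,
     forall v, v \in g -> exists c : 'rV[K]_d.+1, v = \sum_i c 0 i *: b i &
     forall c : 'rV[K]_d.+1, \sum_i c 0 i *: b i = 0 -> c = 0].
Proof.
move=> gv v0n; case E: (\dim g) => [|d].
  by move: gv v0n; rewrite (eqP (_ : g == 0%VS)) -?dimv_eq0 ?E // memv0 => ->.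
pose t := tcast E (vbasis g).
have bt : basis_of g t by rewrite val_tcast; apply: vbasisP.
exists d, (fun i : 'I_d.+1 => t`_i); split.
- by move=> i; apply: (basis_mem bt); rewrite mem_nth // size_tuple.
- move=> v gv'; exists (\row_i coord t i v); rewrite {1}(coord_basis bt gv').
  by apply: eq_bigr => i _; rewrite mxE.
move=> c hc; apply/rowP => i; rewrite [RHS]mxE.
exact: (elimT (@freeP _ _ _ t) (basis_free bt) (fun i => c 0 i) hc i).
Qed.

(** * Invariant complements from the vanishing of a cocycle class *)

Section Weyl.
Variables (K : numClosedFieldType) (n : nat) (g : {vspace 'M[K]_n.+1}).
Implicit Types (X Y S T u Z : 'M[K]_n.+1).
Hypothesis gB : forall X Y, X \in g -> Y \in g -> X * Y - Y * X \in g.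
Hypothesis gR : forall X S T, X \in g -> conj_pair X S T -> S \in g /\ T \in g.
Hypothesis gN : forall X, X \in g -> (forall Y, Y \in g -> \tr (X * Y) = 0) -> X = 0.
Hypothesis gC : forall u, centralizes g u -> u \in g.
Variable pi : 'M[K]_n.+1.
Hypothesis pi_idem : pi * pi = pi.
Hypothesis pi_stable : forall X, X \in g -> pi * X * pi = X * pi.

Variable PU : 'M[K]_((adm n).+1).
Hypothesis PUE : forall Z, vm Z *m PU = vm (pi * Z * (1 - pi)).
(** [PU] projects all matrices onto Hom(V/W, W), for W the image of [pi], and [rho X] is the action
    there, extended by 0. *)
Let rho X := PU * ad X.

Let piC : (1 - pi) * (1 - pi) = 1 - pi.
Proof. by rewrite mulrBr mulr1 mulrBl mul1r pi_idem subrr subr0. Qed.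

Let PU_idem : PU * PU = PU.
Proof.
apply: vm_ext => Z; rewrite -[LHS]/(vm Z *m (PU *m PU)) mulmxA !PUE; congr vm.
by rewrite !mulrA pi_idem -mulrA piC.
Qed.

Let PU_stable X : X \in g -> PU * ad X * PU = PU * ad X.
Proof.
move=> gX; apply: vm_ext => Z; rewrite -!mulmxE !mulmxA PUE vm_ad PUE; congr vm.
set Z' := pi * Z * (1 - pi).
have h1 : pi * Z' = Z' by rewrite /Z' !mulrA pi_idem.
have h2 : Z' * pi = 0 by rewrite /Z' -mulrA mulrBl mul1r pi_idem subrr mulr0.
have h3 : pi * (X * Z') = X * Z' by rewrite -h1 !mulrA pi_stable.
have h4 : Z' * X * pi = 0 by rewrite -mulrA -pi_stable // !mulrA h2 !mul0r.
rewrite !mulrBr h3 mulrA h1 mulr1 mulrBl h4 -[X * Z' * pi]mulrA h2 mulr0.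
by rewrite subrr subr0.
Qed.

Let PU_poly X p : X \in g ->
  PU * horner_mx (ad X) p * PU = PU * horner_mx (ad X) p.
Proof.
move=> gX; elim/poly_ind: p => [|p c IH]; first by rewrite rmorph0 mulr0 mul0r.
rewrite rmorphD rmorphM /= horner_mx_X horner_mx_C mulrDr mulrDl mulrA -IH.
rewrite -!mulrA [PU * (ad X * _)]mulrA PU_stable //; congr (_ + _).
by rewrite -!mulmxE mul_scalar_mx mul_mx_scalar -scalemxAr mulmxE PU_idem.
Qed.

(** [rho X] is 0 on the kernel of [PU], where p(rho X) is the constant p(0); hence the condition at
    0. *)
Let rho_poly X p : X \in g -> p.[0] = 0 ->
  horner_mx (rho X) p = PU * horner_mx (ad X) p.
Proof.
move=> gX p0.
have h q : PU * horner_mx (rho X) q = PU * horner_mx (ad X) q.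
  elim/poly_ind: q => [|q c IH]; first by rewrite !rmorph0.
  rewrite !rmorphD !rmorphM /= !horner_mx_X !horner_mx_C [LHS]mulrDr [RHS]mulrDr mulrA IH [in RHS]mulrA.
  by rewrite /rho [in LHS]mulrA PU_poly.
have /factor_theorem[q eq] : root p 0 by apply/rootP.
rewrite -h eq subr0 mulrC rmorphM /= horner_mx_X mulrA.
by rewrite /rho mulrA PU_idem.
Qed.

Let rho_nil X N : X \in g -> X ^+ N = 0 -> exists k, rho X ^+ k = 0.
Proof.
move=> gX XN; exists (N + N).+1.
rewrite -[rho X]horner_mx_X -rmorphXn /= rho_poly //; last by rewrite hornerXn expr0n.
by rewrite rmorphXn /= horner_mx_X exprS ad_nilpotent ?mulr0.
Qed.

Let rhoL c X Y : rho (c *: X + Y) = c *: rho X + rho Y.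
Proof. by rewrite /rho linearP mulrDr scalerAr. Qed.

Let rhoB X Y : X \in g -> Y \in g ->
  rho (X * Y - Y * X) = rho X * rho Y - rho Y * rho X.
Proof.
move=> gX gY; rewrite /rho -ad_bracket mulrBr !mulrA.
by rewrite PU_stable // PU_stable.
Qed.

Let rho_comm X Y : X \in g -> Y \in g -> X * Y = Y * X ->
  rho X * rho Y = rho Y * rho X.
Proof.
move=> gX gY e; have := rhoB gX gY; rewrite e subrr /rho raddf0 mulr0 => /eqP.
by rewrite eq_sym subr_eq0 => /eqP.
Qed.

Let rho_pair X S T : X \in g -> conj_pair X S T -> exists (h : {poly K}) (r : seq K),
  [/\ uniq r, 0 \in r, horner_mx (rho S) (\prod_(x <- r) ('X - x%:P)) = 0,
      horner_mx (rho S) h = rho T & forall x, x \in r -> h.[x] = x^*].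
Proof.
move=> gX cp; have [gS gT] := gR gX cp.
have [h [r [ur r0 hS hT hh]]] := ad_conj_pair cp.
exists h, r; split=> //; last by rewrite rho_poly ?hT ?hh // conjC0.
by rewrite rho_poly ?hS ?mulr0 //; apply/rootP; rewrite root_prod_XsubC.
Qed.

Let rhoT X : X \in g -> exists2 T, T \in g & forall e, inv_idem g rho e ->
  \tr (e * rho X * rho T) = 0 -> exists N, (e * rho X) ^+ N = 0.
Proof.
move=> gX; have [S [T cp]] := conj_pair_ex X; have [gS gT] := gR gX cp.
exists T => // e [ee ce].
have [h [r [ur r0 hS hT hh]]] := rho_pair gX cp.
have [N hN] : exists N, (rho X - rho S) ^+ N = 0.
  have [s [h' [r' [N [_ _ _ hN _]]]]] := cp.
  have -> : rho X - rho S = rho (X - S).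
    have -> : X - S = (-1) *: S + X by rewrite scaleN1r addrC.
    by rewrite rhoL scaleN1r addrC.
  by apply: rho_nil hN; apply: memvB.
rewrite -hT => tr0; exists N; apply: (trace_conj_nilpotent ur hS hh) => //.
- by apply: rho_comm => //; apply/esym; have [] := conj_pair_comm cp (erefl (X * X)).
- exact: ce.
exact: ce.
Qed.

Let rhoC u e N : centralizes g u -> inv_idem g rho e ->
  (e * rho u) ^+ N = 0 -> e * rho u = 0.
Proof.
move=> cu [ee ce] hN; have gu := gC cu.
have [S [T cp]] := conj_pair_ex u; have [uS cT] := central_pair gN gC cu cp.
have [h [r [ur r0 hS hT hh]]] := rho_pair gu cp.
rewrite -uS in hS hT.
apply: (trace_conj_eq0 ur hS hh) => //; first exact: ce.
rewrite hT; have cuT : GRing.comm (e * rho u) (rho T).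
  apply: commr_sym; apply: commrM; first exact/esym/ce/gC.
  apply: esym; apply: rho_comm; [exact: gu | exact: gC | exact: cu (gC cT)].
apply: (@nilpotent_trace _ _ _ N).
by rewrite exprMn_comm // hN mul0r.
Qed.

(** In the space of all matrices this cocycle is the coboundary of [pi]; the point is to find a
    primitive inside Hom(V/W, W). *)
Let kap X := vm pi *m ad X.

Let kap_PU X : X \in g -> kap X *m PU = kap X.
Proof.
move=> gX; rewrite /kap vm_ad PUE; congr vm.
have h : pi * (pi * X - X * pi) = pi * X - X * pi.
  by rewrite mulrBr !mulrA pi_idem pi_stable.
by rewrite h mulrBr mulr1 mulrBl pi_stable // -mulrA pi_idem subrr subr0.
Qed.

Let kapB X Y : X \in g -> Y \in g ->
  kap (X * Y - Y * X) = kap X *m rho Y - kap Y *m rho X.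
Proof.
move=> gX gY; rewrite /rho -!mulmxE !mulmxA !kap_PU // /kap -ad_bracket mulmxBr.
by rewrite -!mulmxE !mulmxA.
Qed.

(** [ad u] is diagonalizable, so it is killed by some X w with w prime to X. A Bezout relation gives
    [ad u = ad u * a(ad u) * ad u], and [kap u] is recovered from its image under a(ad u). *)
Let kapC u : centralizes g u -> exists v, kap u = v *m rho u.
Proof.
move=> cu; have gu := gC cu.
have [S [T cp]] := conj_pair_ex u; have [uS cT] := central_pair gN gC cu cp.
have [h [r [ur r0 hS _ _]]] := ad_conj_pair cp; rewrite -uS in hS.
pose w := \prod_(x <- rem 0 r) ('X - x%:P).
have ew : \prod_(x <- r) ('X - x%:P) = 'X * w.
  by rewrite (perm_big _ (perm_to_rem r0)) big_cons subr0.
have cop : coprimep 'X w.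
  rewrite coprimep_sym -['X]subr0 coprimep_XsubC root_prod_XsubC.
  by rewrite mem_rem_uniq // inE eqxx.
have [[a c] /= bez] := Bezout_eq1_coprimepP _ _ cop.
have ea : ad u = ad u * horner_mx (ad u) a * ad u.
  rewrite -{1 2 4}(horner_mx_X (ad u)) -!rmorphM /=.
  have -> : 'X * a * 'X = 'X - c * ('X * w).
    apply: (addIr (c * ('X * w))); rewrite subrK.
    by transitivity ((a * 'X + c * w) * 'X); [ring | rewrite bez mul1r].
  by rewrite rmorphB rmorphM /= -ew hS mulr0 subr0.
exists (kap u *m horner_mx (ad u) a).
have e1 : kap u = kap u *m horner_mx (ad u) a *m ad u.
  transitivity (vm pi *m (ad u *m horner_mx (ad u) a *m ad u)).
    by congr (_ *m _); exact: ea.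
  by rewrite /kap !mulmxA.
have e2 : kap u *m horner_mx (ad u) a *m PU = kap u *m horner_mx (ad u) a.
  have hk := kap_PU gu; move: (kap u) hk => k hk; rewrite -hk -!mulmxA; congr (_ *m _).
  by rewrite mulmxA; exact: (PU_poly a gu).
by rewrite -[rho u]/(PU *m ad u) mulmxA e2.
Qed.

(* If W = im pi then m in Hom(V/W, W) with [pi, X] = [m, X] corrects pi into an
   equivariant projection onto W. *)
Lemma weyl_proj : exists pi', [/\ pi' * pi' = pi', pi * pi' = pi', pi' * pi = pi &
  forall X, X \in g -> pi' * X = X * pi'].
Proof.
have g1 : 1 \in g by apply: gC => X _; rewrite mul1r mulr1.
have [d [b [bg bspan bfree]]] := vspace_basis g1 (oner_neq0 _).
have kapL c X Y : kap (c *: X + Y) = c *: kap X + kap Y.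
  by rewrite /kap linearP mulmxDr scalemxAr.
have [v hv] := whitehead gB gN gC bg bspan bfree rhoL rhoB rhoT rhoC kapL kapB kapC.
pose m := pi * mv v * (1 - pi).
have pm : pi * m = m by rewrite /m !mulrA pi_idem.
have mp : m * pi = 0 by rewrite /m -mulrA mulrBl mul1r pi_idem subrr mulr0.
have mm : m * m = 0 by rewrite -{2}pm mulrA mp mul0r.
exists (pi - m); split.
- by rewrite mulrBl !mulrBr pi_idem pm mp mm !subr0.
- by rewrite mulrBr pi_idem pm.
- by rewrite mulrBl pi_idem mp subr0.
move=> X gX; have := hv X gX.
rewrite -[rho X]/(PU *m ad X) mulmxA -{1}[v]mvK PUE /kap !vm_ad.
move=> /(can_inj (@vmK _ _)) e.
rewrite mulrBl mulrBr; move: (pi * X) (X * pi) (m * X) (X * m) e => a b' c d' e.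
by apply/eqP; rewrite subr_eq -addrA [- d' + c]addrC addrC -e subrK.
Qed.
End Weyl.

Theorem weyl (K : numClosedFieldType) (n : nat) (g : {vspace 'M[K]_n.+1}) pi :
  (forall X Y, X \in g -> Y \in g -> X * Y - Y * X \in g) ->
  (forall X S T, X \in g -> conj_pair X S T -> S \in g /\ T \in g) ->
  (forall X, X \in g -> (forall Y, Y \in g -> \tr (X * Y) = 0) -> X = 0) ->
  (forall u, centralizes g u -> u \in g) ->
  pi * pi = pi -> (forall X, X \in g -> pi * X * pi = X * pi) ->
  exists pi', [/\ pi' * pi' = pi', pi * pi' = pi', pi' * pi = pi &
  forall X, X \in g -> pi' * X = X * pi'].
Proof.
move=> gB gR gN gC pp ps.
apply: (@weyl_proj _ _ g gB gR gN gC pi pp ps (lmul pi *m rmul (1 - pi))) => Z.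
by rewrite mulmxA vm_lmul vm_rmul.
Qed.

(** * Degrees, zeros and denominators of polynomials *)

Section Degrees.
Variables (K : numFieldType) (n : nat).
Implicit Types (f g h p q : {mpoly K[n]}) (A : 'M[K]_n) (x y : 'cV[K]_n).

Lemma mpoly_ext f g :
  (forall x, f.@[vec_coord x] = g.@[vec_coord x]) -> f = g.
Proof.
move=> h; apply/eqP; rewrite -subr_eq0; apply/eqP/mpoly_eval0 => v.
have := h (\col_i v i); have e : vec_coord (\col_i v i) =1 v by move=> i; rewrite /vec_coord mxE.
by rewrite mevalB !(meval_eq _ e) => ->; rewrite subrr.
Qed.

Lemma msize_mderiv i f : (msize f^`M(i) <= (msize f).-1)%N.
Proof.
rewrite {1}(mpolyE f) raddf_sum (leq_trans (mmeasure_sum _ _ _ _)) //.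
apply/bigmax_leqP_seq => m mf _ /=; rewrite mderivZ mderivX.
have [m0|m0] := posnP (m i); first by rewrite m0 scale0r scaler0 mmeasure0.
rewrite (leq_trans (mmeasureZ_le _ _ _)) // (leq_trans (mmeasureZ_le _ _ _)) //.
have hm := msize_mdeg_lt mf.
have e : (m = (m - U_(i)) + U_(i))%MM.
  by rewrite submK //; apply/mnm_lepP => j; rewrite mnm1E; case: eqP => [<-|].
rewrite [mmeasure _ _]msizeX; move: hm; rewrite {1}e mdegD mdeg1 addn1.
by case: (msize f) => //= k; rewrite ltnS.
Qed.

Lemma mderiv_small i f : f != 0 -> (msize f^`M(i) < msize f)%N.
Proof.
rewrite -msize_poly_eq0 -lt0n => f0.
by rewrite -(prednK f0) ltnS msize_mderiv.
Qed.

Lemma msize_lform (u : 'rV[K]_n) : (msize (lform u) <= 2)%N.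
Proof.
rewrite (leq_trans (mmeasure_sum _ _ _ _)) //; apply/bigmax_leqP => i _.
by rewrite (leq_trans (mmeasureZ_le _ _ _)) // [mmeasure _ _]msizeX mdeg1.
Qed.

Lemma msize_lvf A f : (msize (lvf A f) <= msize f)%N.
Proof.
have [->|f0] := eqVneq f 0; first by rewrite raddf0 msize0.
rewrite (leq_trans (mmeasure_sum _ _ _ _)) //; apply/bigmax_leqP => i _.
have [->|l0] := eqVneq (lform (row i A)) 0; first by rewrite mul0r mmeasure0.
have [->|d0] := eqVneq f^`M(i) 0; first by rewrite mulr0 mmeasure0.
rewrite [mmeasure _ _]msizeM // -ltnS.
have := leq_add (msize_lform (row i A)) (msize_mderiv i f).
move: f0; rewrite -msize_poly_eq0; case: (msize f) => //= k _.
by case: (_ + _)%N => //= j; rewrite ltnS => /ltnW; rewrite !ltnS; apply: leq_trans.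
Qed.

Lemma divides_small p q : divides p q -> (msize q < msize p)%N -> q = 0.
Proof.
move=> [h ->]; have [->|h0] := eqVneq h 0; first by rewrite mul0r.
have [->|p0] := eqVneq p 0; first by rewrite mulr0 msize0.
by rewrite msizeM // (mpolySpred _ h0) addSn /= ltnNge leq_addl.
Qed.

Lemma mpoly_unitP p : p \is a GRing.unit -> exists2 c, c != 0 & p = c%:MP.
Proof.
rewrite unfold_in => /andP[/eqP e u]; exists p@_0; rewrite // -unitfE //.
Qed.

Lemma divides_same_size p q : (msize q <= msize p)%N -> p != 0 -> divides p q ->
  exists c, q = c *: p.
Proof.
move=> sz p0 [h eq]; rewrite {}eq in sz *; have [->|h0] := eqVneq h 0.
  by exists 0; rewrite mul0r scale0r.
move: sz; rewrite msizeM // (mpolySpred _ h0) (mpolySpred _ p0) addSn addnS /= ltnS.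
rewrite -[leqRHS]add0n leq_add2r leqn0 => /eqP h1.
have sh : (msize h <= 1)%N by rewrite (mpolySpred _ h0) h1.
by exists h@_0; rewrite {1}(msize1_polyC sh) mul_mpolyC.
Qed.

Lemma mderiv_all0 f : (forall i, f^`M(i) = 0) -> f = (f@_0)%:MP.
Proof.
move=> d0; apply/mpolyP => m; rewrite mcoeffC.
case: eqP => [->|m0]; rewrite ?mulr1 // mulr0; have [i mi] : exists i, (0 < m i)%N.
  apply: contrapT => h; apply: m0; apply/mnmP => i; rewrite mnm0E.
  by case: (posnP (m i)) => [->//|mi]; case: h; exists i.
have e : (m = (m - U_(i)) + U_(i))%MM.
  by rewrite submK //; apply/mnm_lepP => j; rewrite mnm1E; case: eqP => [<-|].
have := d0 i => /(congr1 (mcoeff (m - U_(i)))); rewrite mcoeff_mderiv -e mcoeff0.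
move=> /eqP; rewrite mulrn_eq0 => /orP[/eqP mz|/eqP//].
by move: mi; rewrite e mnmDE mnm1E eqxx addn1 mz.
Qed.

Lemma prime_mderiv p : prime_elt p -> exists i, ~ divides p p^`M(i).
Proof.
move=> pp; apply: contrapT => h; have [p0 /negP np _] := pp.
have d0 i : p^`M(i) = 0.
  apply: (@divides_small p); last exact: mderiv_small.
  by apply: contrapT => hi; apply: h; exists i.
apply: np; move: p0; rewrite (mderiv_all0 d0) => p0.
by apply: rmorph_unit; rewrite unitfE; apply: contra_neq p0 => ->; rewrite mpolyC0.
Qed.

Lemma prime_factor_lvf A p q c : prime_elt p -> ~ divides p q ->
  lvf A (q * p) = c *: (q * p) -> exists a, lvf A p = a *: p.
Proof.
move=> pp npq e; have [p0 _ hp] := pp.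
apply: divides_same_size (msize_lvf A p) p0 _.
have : divides p (q * lvf A p).
  have -> : q * lvf A p = lvf A (q * p) - lvf A q * p by rewrite lvfM addrC addKr.
  by rewrite e scalerAl; apply: dividesB; apply: divides_mull; apply: divides_refl.
by case/hp.
Qed.
End Degrees.

Section Fractions.
Variable R : idomainType.
Notation tf := (@FracField.tofrac R).

Lemma tofrac_cross (a b a' b' : R) : b != 0 -> b' != 0 ->
  tf a / tf b = tf a' / tf b' -> a * b' = a' * b.
Proof.
move=> b0 b'0 /eqP; rewrite eqr_div ?tofrac_eq0 // -!tofracM tofrac_eq.
by move/eqP.
Qed.

Lemma tofrac_cancel (a p b u : R) : p != 0 ->
  tf (a * p) / tf (u * (p * b)) = tf a / tf (u * b).
Proof.
move=> p0; rewrite [u * _]mulrCA [p * _]mulrC !tofracM.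
by rewrite -mulf_div divff ?mulr1 // tofrac_eq0.
Qed.

Lemma tofrac_div_unit (a u : R) : u \is a GRing.unit -> tf a / tf u = tf (a * u^-1).
Proof.
move=> uu; have u0 : tf u != 0 by rewrite tofrac_eq0; apply: contraTneq uu => ->; rewrite unitr0.
by apply: (mulIf u0); rewrite divfK // -tofracM divrK.
Qed.
End Fractions.

Section Zeros.
Variables (K : numClosedFieldType) (n : nat).
Implicit Types (f g h p q : {mpoly K[n]}) (A : 'M[K]_n) (x y : 'cV[K]_n).

Definition line x y (i : 'I_n) : {poly K} := (x i 0)%:P + y i 0 *: 'X.

Lemma line_eval x y t f :
  (along (line x y) f).[t] = f.@[vec_coord (x + t *: y)].
Proof.
rewrite horner_along; apply: meval_eq => i.
by rewrite /vec_coord !mxE /line !hornerE mulrC.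
Qed.

Lemma line_deriv x y f :
  (along (line x y) f)^`().[0] = \sum_(i < n) f^`M(i).@[vec_coord x] * y i 0.
Proof.
rewrite deriv_along horner_sum; apply: eq_bigr => i _.
rewrite hornerM line_eval scale0r addr0; congr (_ * _).
by rewrite /line derivD derivC add0r derivZ derivX hornerZ hornerC mulr1.
Qed.

(** Without zeros, [f] would restrict to every line as a univariate polynomial without roots, hence
    as a constant. *)
Lemma mpoly_zero f : f != 0 -> f \isn't a GRing.unit ->
  exists x, f.@[vec_coord x] = 0.
Proof.
move=> f0 nu; apply: contrapT => h.
have nz x : f.@[vec_coord x] != 0 by apply/eqP => e; apply: h; exists x.
have cst x y : f.@[vec_coord x] = f.@[vec_coord y].
  have [r e] := closed_field_poly_normal (along (line x (y - x)) f).
  have : size r = 0%N.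
    case: r e => // a r e; case/negP: (nz (x + a *: (y - x))).
    by rewrite -line_eval e hornerZ big_cons hornerM hornerXsubC subrr mul0r mulr0.
  move=> /size0nil r0; move: e; rewrite r0 big_nil => e.
  have h0 := line_eval x (y - x) 0 f; have h1 := line_eval x (y - x) 1 f.
  rewrite scale0r addr0 in h0; rewrite scale1r addrCA subrr addr0 in h1.
  by rewrite -h0 -h1 e !hornerZ !hornerC.
case/negP: nu; have -> : f = (f.@[vec_coord 0])%:MP.
  by apply: mpoly_ext => x; rewrite mevalC.
by apply: rmorph_unit; rewrite unitfE.
Qed.

Lemma prime_zero p : prime_elt p -> exists x, p.@[vec_coord x] = 0.
Proof. by move=> [p0 np _]; apply: mpoly_zero. Qed.

Notation tf := (@FracField.tofrac {mpoly K[n]}).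

(** The primes of a denominator are cancelled in turn: a prime has a zero x, and a representation
    that is regular at x shows that the prime divides the numerator. *)
Lemma regular_everywhere (g : {fraction {mpoly K[n]}}) :
  (forall x, regular_at x g) -> exists a, g = tf a.
Proof.
move=> reg; have [a [b [b0 e]]] := reg 0.
have bn : b != 0 by apply: contra_neq b0 => ->; rewrite meval0.
have [u [s [uu ps eb]]] := mpoly_factorial bn.
have {b0 eb bn} : g = tf a / tf (u * \prod_(p <- s) p) by rewrite -eb.
elim: s a ps {e} => [|p s IH] a ps e.
  by exists (a * u^-1); rewrite e big_nil mulr1 tofrac_div_unit.
have pp : prime_elt p by apply: ps; rewrite mem_head.
have [x px] := prime_zero pp; have [a' [b' [b'x e']]] := reg x.
have b'n : b' != 0 by apply: contra_neq b'x => ->; rewrite meval0.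
have sn : u * \prod_(q <- p :: s) q != 0.
  rewrite mulf_neq0 //; first by apply: contraTneq uu => ->; rewrite unitr0.
  by rewrite prodf_seq_neq0; apply/allP => q /ps[].
have E : a * b' = a' * (u * \prod_(q <- p :: s) q).
  by apply: tofrac_cross; rewrite // -e.
have : divides p (a * b').
  by rewrite E big_cons; exists (a' * u * \prod_(j <- s) j); ring.
have [p0 _ hp] := pp; case/hp => [[a1 ea]|[b1 eb]]; last first.
  by case/negP: b'x; rewrite eb mevalM px mulr0.
apply: (IH a1); first by move=> q qs; apply: ps; rewrite inE qs orbT.
by rewrite e ea big_cons tofrac_cancel.
Qed.
End Zeros.

(** * Linear free divisors *)

Section FractionBasis.
Variables (R : idomainType) (n : nat).
Notation tf := (@FracField.tofrac R).

Lemma frac_repr (x : {fraction R}) : exists a b, b != 0 /\ x = tf a / tf b.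
Proof.
elim/quotW: x => x; exists (val x).1, (val x).2; split; first exact: denom_ratioP.
apply: (canRL (mulfK _)); first by rewrite tofrac_eq0 denom_ratioP.
unlock FracField.tofrac; rewrite -[LHS]FracField.pi_mul; apply/eqmodP.
rewrite /= FracField.equivfE /FracField.mulf.
by rewrite !numden_Ratio ?mulf_neq0 ?oner_eq0 ?denom_ratioP // !mulr1 mulrC.
Qed.

Lemma common_denom k (c : 'I_k -> {fraction R}) :
  exists b h, b != 0 /\ forall j, tf b * c j = tf (h j).
Proof.
have /choice[ab hab] j : exists ab : R * R, ab.2 != 0 /\ c j = tf ab.1 / tf ab.2.
  by have [a [b [b0 e]]] := frac_repr (c j); exists (a, b).
exists (\prod_j (ab j).2), (fun j => (ab j).1 * \prod_(i | i != j) (ab i).2); split.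
  by apply/prodf_neq0 => j _; have [] := hab j.
move=> j; have [b0 ->] := hab j.
rewrite (bigD1 j) //= !tofracM.
have bn : tf (ab j).2 != 0 by rewrite tofrac_eq0.
move: (tf (ab j).2) (tf (ab j).1) (tf _) bn => y x z y0; by field.
Qed.

Lemma tofrac_mx_inj p q (A B : 'M[R]_(p, q)) : map_mx tf A = map_mx tf B -> A = B.
Proof.
move=> /matrixP e; apply/matrixP => i j; have := e i j; rewrite !mxE => /eqP.
by rewrite tofrac_eq => /eqP.
Qed.

Variables (k : nat) (v : 'I_k -> 'rV[R]_n).
Hypothesis indep : forall h : 'I_k -> R, \sum_j h j *: v j = 0 -> forall j, h j = 0.

Lemma frac_indep (c : 'I_k -> {fraction R}) :
  \sum_j c j *: map_mx tf (v j) = 0 -> forall j, c j = 0.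
Proof.
move=> c0; have [b [h [b0 hb]]] := common_denom c.
have h0 : \sum_j h j *: v j = 0.
  apply: tofrac_mx_inj; rewrite map_mx_sum.
  transitivity (tf b *: \sum_j c j *: map_mx tf (v j)).
    by rewrite scaler_sumr; apply: eq_bigr => j _; rewrite scalerA hb; exact: map_mxZ.
  by rewrite c0 scaler0 map_mx0.
move=> j; apply: (@mulfI _ (tf b)); first by rewrite tofrac_eq0.
by rewrite hb (indep h0) mulr0 tofrac0.
Qed.

Variables (f : R) (H : 'M[R]_(n, k)).
Hypothesis f0 : f != 0.
Hypothesis span : H *m (\matrix_j v j) = f%:M.

Let V : 'M[{fraction R}]_(k, n) := map_mx tf (\matrix_j v j).

Let V_free : row_free V.
Proof.
rewrite -kermx_eq0; apply/eqP/row_matrixP => i; rewrite row0.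
apply/rowP => j; rewrite [RHS]mxE.
move: j; apply: (frac_indep (c := fun j => row i (kermx V) 0 j)).
have : row i (kermx V) *m V = 0 by rewrite -row_mul mulmx_ker row0.
rewrite mulmx_sum_row => h; rewrite -[RHS]h; apply: eq_bigr => j _; congr (_ *: _).
by apply/rowP => l; rewrite !mxE.
Qed.

Let V_full : row_full V.
Proof.
apply/row_fullP; exists ((tf f)^-1 *: map_mx tf H).
rewrite -scalemxAl -map_mxM span map_scalar_mx scale_scalar_mx mulVf //.
by rewrite tofrac_eq0.
Qed.

(** Over the fraction field the [v j] stay independent, and by [span] they generate, because [f] is
    invertible there. *)
Lemma basis_size : k = n.
Proof. by apply/eqP; rewrite -(eqP V_free) (eqP V_full). Qed.
End FractionBasis.

Lemma square_inverse (R : idomainType) n (H V : 'M[R]_n) f : f != 0 ->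
  H *m V = f%:M -> V *m H = f%:M.
Proof.
move=> f0 e; pose tf := @FracField.tofrac R.
apply: tofrac_mx_inj; rewrite map_mxM /= map_scalar_mx /=.
have f0' : tf f != 0 by rewrite tofrac_eq0.
have /mulmx1C : ((tf f)^-1 *: map_mx tf H) *m map_mx tf V = 1%:M.
  by rewrite -scalemxAl -map_mxM /= e map_scalar_mx scale_scalar_mx mulVf.
rewrite -scalemxAr => /(congr1 (fun M => tf f *: M)).
by rewrite scalerA divff // scale1r scale_scalar_mx mulr1.
Qed.

Section LFD.
Variables (K : numClosedFieldType) (n : nat).
Implicit Types (f g h p q : {mpoly K[n]}) (A X : 'M[K]_n) (x y : 'cV[K]_n).
Notation tf := (@FracField.tofrac {mpoly K[n]}).

Definition lvec A : 'rV[{mpoly K[n]}]_n := \row_i lform (row i A).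

Lemma linear_vfE A : linear_vf A = map_mx tf (lvec A).
Proof.
apply/rowP => i; rewrite !mxE /lform; congr (tf _).
by apply: eq_bigr => j _; rewrite mxE.
Qed.

Lemma apply_vfE (w : 'rV[{mpoly K[n]}]_n) f :
  apply_vf (map_mx tf w) f = tf (\sum_i w 0 i * f^`M(i)).
Proof.
rewrite /apply_vf (rmorph_sum tf); apply: eq_bigr => i _.
by rewrite mxE (rmorphM tf).
Qed.

Lemma apply_linear_vf A f : apply_vf (linear_vf A) f = tf (lvf A f).
Proof.
rewrite linear_vfE apply_vfE; congr (tf _); apply: eq_bigr => i _.
by rewrite mxE.
Qed.

Lemma regular_tofrac x g : regular_at x (tf g).
Proof.
by exists g, 1; rewrite meval1 oner_neq0; split => //; rewrite tofrac1 divr1.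
Qed.

Lemma lvf_eigen_const A f h : f != 0 -> lvf A f = h * f -> exists c, lvf A f = c *: f.
Proof.
move=> f0 e; apply: divides_same_size (msize_lvf A f) f0 _.
by exists h.
Qed.

Lemma lform_mderiv (u : 'rV[K]_n) i : (lform u)^`M(i) = (u 0 i)%:MP.
Proof.
rewrite /lform raddf_sum (bigD1 i) //= big1 => [|j ji]; rewrite mderivZ mderivXU.
  by rewrite eqxx addr0 -mul_mpolyC mulr1.
by rewrite (negbTE ji) scaler0.
Qed.

Lemma lform_eval0 (u : 'rV[K]_n) : (lform u).@[vec_coord 0] = 0.
Proof. by rewrite lform_eval mulmx0 mxE. Qed.

Definition field_mx k (A : 'I_k -> 'M[K]_n) : 'M[{mpoly K[n]}]_(k, n) :=
  \matrix_j lvec (A j).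

(** Only the constant terms of the [h j] contribute to the linear part at the origin. *)
Lemma field_mx_linear k (A : 'I_k -> 'M[K]_n) X (h : 'I_k -> {mpoly K[n]}) :
  lvec X = \sum_j h j *: lvec (A j) ->
  X = \sum_j (h j).@[vec_coord 0] *: A j.
Proof.
move=> e; apply/matrixP => i l.
have := congr1 (fun w : 'rV[{mpoly K[n]}]_n => ((w 0 i)^`M(l)).@[vec_coord 0]) e.
rewrite !mxE lform_mderiv mevalC mxE => ->; rewrite !summxE.
rewrite (raddf_sum (mderiv l)) (raddf_sum (meval (vec_coord 0))).
apply: eq_bigr => j _ /=; rewrite !mxE mderivM mevalD !mevalM lform_eval0 mulr0 add0r.
by rewrite lform_mderiv mevalC mxE.
Qed.

Variable D : set 'cV[K]_n.

(** [field_mx A] is the Saito matrix. Local coefficients are unique over the field of fractions, so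
    they are regular everywhere, hence polynomials. [H] expresses the logarithmic fields f d/dx_m in
    the basis, and this also forces k = n. *)
Lemma lfd_basis : linear_free_divisor D -> exists f (A : 'I_n -> 'M[K]_n) (H : 'M[{mpoly K[n]}]_n),
  [/\ reduced_equation D f,
    forall j, exists c, lvf (A j) f = c *: f,
    forall X c, lvf X f = c *: f -> exists a : 'I_n -> K, X = \sum_j a j *: A j,
    forall c : 'I_n -> K, \sum_j c j *: A j = 0 -> forall j, c j = 0 &
    H *m field_mx A = f%:M].
Proof.
move=> [f [rf [k [A hA]]]]; exists f.
have f0 : f != 0 by case: rf => sf _ _; rewrite -msize_poly_eq0 -lt0n ltnW.
have tf0 : tf f != 0 by rewrite tofrac_eq0.
have indep (h : 'I_k -> {mpoly K[n]}) :
    \sum_j h j *: lvec (A j) = 0 -> forall j, h j = 0.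
  move=> h0 j; apply/eqP; rewrite -tofrac_eq0; apply/eqP; move: j.
  have [_ _ /(_ (fun j => tf (h j)))] := hA 0; apply.
    by move=> j; apply: regular_tofrac.
  transitivity (map_mx tf (\sum_j h j *: lvec (A j))); last by rewrite h0 map_mx0.
  rewrite map_mx_sum; apply: eq_bigr => j _; rewrite linear_vfE; exact/esym/map_mxZ.
have findep := frac_indep indep.
have poly_span (w : 'rV[{mpoly K[n]}]_n) h :
    \sum_i w 0 i * f^`M(i) = h * f -> exists a : 'I_k -> {mpoly K[n]},
    w = \sum_j a j *: lvec (A j).
  move=> e.
  have hd x : exists2 a : 'I_k -> {fraction {mpoly K[n]}},
      forall j, regular_at x (a j) & map_mx tf w = \sum_j a j *: linear_vf (A j).
    have [_ sp _] := hA x; apply: sp; split=> [i|].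
      by rewrite mxE; apply: regular_tofrac.
    exists (tf h); first exact: regular_tofrac.
    by rewrite apply_vfE e (rmorphM tf).
  have [a0 _ ea0] := hd 0.
  have /choice[a ha] j : exists a, a0 j = tf a.
    apply: regular_everywhere => x; have [a ra ea] := hd x.
    suff -> : a0 j = a j by apply: ra.
    apply/eqP; rewrite -subr_eq0; apply/eqP; move: j.
    apply: (findep (fun j => a0 j - a j)).
    rewrite -[RHS](subrr (map_mx tf w)) {1}ea0 ea -sumrB.
    by apply: eq_bigr => j _; rewrite -linear_vfE scalerBl.
  exists a; apply: tofrac_mx_inj; rewrite ea0 map_mx_sum; apply: eq_bigr => j _.
  by rewrite ha linear_vfE; exact/esym/map_mxZ.
have /choice[H hH] (m : 'I_n) : exists a : 'I_k -> {mpoly K[n]},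
    f *: delta_mx 0 m = \sum_j a j *: lvec (A j).
  apply: (poly_span _ f^`M(m)); rewrite (bigD1 m) //= big1 => [|i im].
    by rewrite !mxE !eqxx mulr1 addr0 mulrC.
  by rewrite !mxE (negbTE im) andbF mulr0 mul0r.
pose H' : 'M[{mpoly K[n]}]_(n, k) := \matrix_(m, j) H m j.
have spH : H' *m field_mx A = f%:M.
  apply/row_matrixP => m; rewrite row_mul mulmx_sum_row.
  transitivity (\sum_j H m j *: lvec (A j)).
    by apply: eq_bigr => j _; rewrite !mxE rowK.
  by rewrite -hH; apply/rowP => i; rewrite !mxE /= mulr_natr eq_sym.
have ekn := basis_size indep f0 spH; subst k.
exists A, H'; split=> //.
- move=> j.
  have [h eh] : exists h, tf (lvf (A j) f) / tf f = tf h.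
    apply: regular_everywhere => x; have [/(_ j)[_ [h rh eh]] _ _] := hA x.
    by rewrite -apply_linear_vf eh mulfK.
  apply: (@lvf_eigen_const _ _ h) => //; apply/eqP; rewrite -tofrac_eq (rmorphM tf).
  by rewrite /= -eh divfK.
- move=> X c e; have [|a ea] := poly_span (lvec X) c%:MP.
    rewrite mul_mpolyC -e; apply: eq_bigr => i _; by rewrite mxE.
  by exists (fun j => (a j).@[vec_coord 0]); apply: field_mx_linear.
move=> c c0 j; have := indep (fun j => (c j)%:MP); rewrite /=.
have -> : \sum_j (c j)%:MP *: lvec (A j) = 0.
  have e : lvec (\sum_j c j *: A j) = \sum_j (c j)%:MP *: lvec (A j).
    apply/rowP => i; rewrite mxE summxE.
    have -> : row i (\sum_l c l *: A l) = \sum_l c l *: row i (A l).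
      by rewrite linear_sum; apply: eq_bigr => l _; rewrite [LHS]linearZ.
    rewrite linear_sum; apply: eq_bigr => l _.
    by rewrite [LHS]linearZ !mxE mul_mpolyC.
  by rewrite -e c0; apply/rowP => i; rewrite !mxE row0 linear0.
by move=> /(_ erefl j)/eqP; rewrite mpolyC_eq0 => /eqP.
Qed.
End LFD.

Section Facts.
Variables (K : numClosedFieldType) (n : nat).
Implicit Types (h p q : {mpoly K[n]}) (X u g : 'M[K]_n) (x y : 'cV[K]_n).
Variables (D : set 'cV[K]_n) (f : {mpoly K[n]}).
Hypothesis rf : reduced_equation D f.

Lemma reduced_neq0 : f != 0.
Proof. by case: rf => sf _ _; rewrite -msize_poly_eq0 -lt0n ltnW. Qed.

Lemma reducedE x : D x <-> f.@[vec_coord x] = 0.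
Proof. by case: rf => _ -> _. Qed.

Lemma reduced_div h : (forall x, D x -> h.@[vec_coord x] = 0) -> divides f h.
Proof. by case: rf => _ _ /(_ h). Qed.

(** If f = q' p^2, then p q' vanishes on [D], so f would divide it. *)
Lemma reduced_squarefree p q : prime_elt p -> f = q * p -> ~ divides p q.
Proof.
move=> pp e [q' eq]; have [p0 np _] := pp.
have [h eh] : divides f (p * q').
  apply: reduced_div => x /reducedE; rewrite e eq !mevalM => /eqP.
  by rewrite !mulf_eq0 => /orP[/orP[]|] /eqP->; rewrite ?mulr0 ?mul0r.
apply: (prime_ndvd1 pp); exists h.
have f0 := reduced_neq0; have q'0 : q' != 0.
  by apply: contra_neq f0 => q0; rewrite e eq q0 !mul0r.
apply: (@mulfI _ (p * q')); first by rewrite mulf_neq0.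
by rewrite mulr1 {1}eh e eq; ring.
Qed.

Definition eigen_field X := exists c, lvf X f = c *: f.

Lemma eigen_fieldB X Y : eigen_field X -> eigen_field Y -> eigen_field (X *m Y - Y *m X).
Proof.
move=> [a ha] [b hb]; exists 0; rewrite -lvf_comm ha hb !lvfZ ha hb !scalerA mulrC.
by rewrite subrr scale0r.
Qed.

Lemma subst_eigen g : g \in unitmx -> (forall x, D x -> D (g *m x)) ->
  (forall x, D x -> D (invmx g *m x)) -> exists2 c, c != 0 & lsubst g f = c *: f.
Proof.
move=> gu gD gD'.
have sub k : (forall x, D x -> D (k *m x)) -> divides f (lsubst k f).
  move=> kD; apply: reduced_div => x Dx; rewrite lsubst_eval.
  by apply/reducedE/kD.
have [h1 e1] := sub _ gD; have [h2 e2] := sub _ gD'.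
have : h1 \is a GRing.unit.
  apply/unitrP; exists (lsubst g h2).
  have e : lsubst g h2 * h1 = 1.
    apply: (mulIf reduced_neq0); rewrite mul1r -mulrA -e1 -rmorphM /= -e2.
    by rewrite lsubst_comp mulVmx // lsubst1.
  by split=> //; rewrite mulrC.
move/mpoly_unitP => [c c0 ec]; exists c => //.
by rewrite e1 ec mul_mpolyC.
Qed.

Lemma eigen_field_conj g X c : c != 0 -> lsubst g f = c *: f -> g \in unitmx ->
  eigen_field X -> eigen_field (g *m X *m invmx g).
Proof.
move=> c0 eg gu [a ha]; exists a.
have e : g *m X = g *m X *m invmx g *m g by rewrite mulmxKV.
have := lvf_lsubst f e; rewrite eg lvfZ ha.
move=> /(congr1 (lsubst (invmx g))); rewrite lsubst_comp mulmxV // lsubst1 => <-.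
rewrite scalerA mulrC -scalerA -eg lsubstZ lsubst_comp mulmxV // lsubst1 //.
Qed.

Variable A : 'I_n -> 'M[K]_n.
Hypothesis A_eigen : forall j, eigen_field (A j).
Hypothesis A_span : forall X c, lvf X f = c *: f -> exists a : 'I_n -> K, X = \sum_j a j *: A j.
Variable H : 'M[{mpoly K[n]}]_n.
Hypothesis HM : H *m field_mx A = f%:M.

Definition point_mx x : 'M[K]_n := \matrix_j (A j *m x)^T.

Lemma field_mx_eval x : map_mx (meval (vec_coord x)) (field_mx A) = point_mx x.
Proof.
apply/matrixP => j i; rewrite !mxE lform_eval mxE.
by apply: eq_bigr => l _; rewrite !mxE.
Qed.

Lemma det_field x : (\det (field_mx A)).@[vec_coord x] = \det (point_mx x).
Proof. by rewrite -field_mx_eval det_map_mx. Qed.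

(** Let M be the Saito matrix. det H det M is a power of f, so det M = 0 forces f = 0. Conversely, M
    grad f is a multiple of f; multiplying by the adjugate shows that f divides det M df/dx_i for
    every i, while a prime factor of f fails to divide some df/dx_i. *)
Lemma discriminantE x : D x <-> \det (point_mx x) = 0.
Proof.
split=> [Dx|d0]; last first.
  apply/reducedE; apply/eqP/contraT => fx.
  have := congr1 (map_mx (meval (vec_coord x))) HM.
  rewrite map_mxM /= field_mx_eval map_scalar_mx /= => /(congr1 determinant).
  rewrite det_mulmx d0 mulr0 det_scalar => /esym/eqP; rewrite expf_eq0.
  by rewrite (negbTE fx) andbF.
have f0 := reduced_neq0.
have [u [s [uu ps ef]]] := mpoly_factorial f0.
have [p ps' px] : exists2 p, p \in s & p.@[vec_coord x] = 0.
  move/reducedE: Dx; rewrite ef mevalM rmorph_prod => /eqP.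
  have [c c0 ->] := mpoly_unitP uu; rewrite mevalC mulf_eq0 (negbTE c0) /=.
  by rewrite prodf_seq_eq0 => /hasP[p ? /= /eqP]; exists p.
have pp := ps _ ps'; have [p0 _ hp] := pp.
have ef' : f = u * (\prod_(q <- rem p s) q) * p.
  by rewrite {1}ef (perm_big _ (perm_to_rem ps')) big_cons mulrCA mulrC.
have [i hi] := prime_mderiv pp.
have ndi : ~ divides p f^`M(i).
  rewrite ef' mderivM => h; have : divides p (u * (\prod_(q <- rem p s) q) * p^`M(i)).
    move: h; set a := _ * p; set b := _ * p^`M(i) => h.
    have -> : b = (a + b) - a by rewrite addrC addKr.
    by apply: dividesB h _; apply: divides_mull; apply: divides_refl.
  by case/hp => // h'; apply: (reduced_squarefree pp ef').
have : divides p (\det (field_mx A) * f^`M(i)).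
  pose dfc : 'cV[{mpoly K[n]}]_n := \col_l f^`M(l).
  have /choice[c hc] := A_eigen.
  have e : field_mx A *m dfc = f *: \col_j (c j)%:MP.
    apply/colP => j; rewrite !mxE mulrC mul_mpolyC -hc; apply: eq_bigr => l _.
    by rewrite !mxE.
  have := congr1 (mulmx (\adj (field_mx A))) e.
  rewrite mulmxA mul_adj_mx mul_scalar_mx -scalemxAr => /colP/(_ i).
  rewrite mxE [dfc _ _]mxE mxE => ->.
  apply: divides_mulr; rewrite ef'; apply: divides_mull; exact: divides_refl.
case/hp => // -[d ed]; rewrite -det_field ed mevalM px mulr0 //.
Qed.

Lemma discriminant_stable u : u \in unitmx -> (forall j, A j *m u = u *m A j) ->
  forall x, D x -> D (u *m x).
Proof.
move=> uu cu x /discriminantE d0; apply/discriminantE.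
have -> : point_mx (u *m x) = point_mx x *m u^T.
  apply/row_matrixP => j; rewrite row_mul !rowK -trmx_mul; congr (_^T).
  by rewrite !mulmxA cu.
by rewrite det_mulmx d0 mul0r.
Qed.

Lemma discriminant_stable_inv u : u \in unitmx -> (forall j, A j *m u = u *m A j) ->
  forall x, D x -> D (invmx u *m x).
Proof.
move=> uu cu; apply: discriminant_stable; first by rewrite unitmx_inv.
move=> j; apply: (can_inj (mulKmx uu)); rewrite !mulmxA mulmxV // mul1mx -cu.
by rewrite -!mulmxA mulmxV // mulmx1.
Qed.

(* 1 + k u rescales f for almost all k; compare derivatives at k = 0. *)
Lemma centralizer_eigen u : (forall j, A j *m u = u *m A j) -> eigen_field u.
Proof.
move=> cu.
have [y fy] : exists y, f.@[vec_coord y] != 0.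
  apply: contrapT => h; case/eqP: reduced_neq0; apply: mpoly_ext => x.
  by rewrite meval0; apply/eqP/contraT => fx; case: h; exists x.
pose P x : {poly K} := along (line x (u *m x)) f.
have dP x : (P x)^`().[0] = (lvf u f).@[vec_coord x].
  rewrite line_deriv /lvf raddf_sum; apply: eq_bigr => i _ /=.
  rewrite mevalM mulrC lform_eval; congr (_ * _); rewrite !mxE.
  by apply: eq_bigr => l _; rewrite !mxE.
pose d : {poly K} := \det (1%:M + 'X *: map_mx polyC u).
have dE t : d.[t] = \det (1%:M + t *: u).
  rewrite /d -horner_evalE -det_map_mx; congr (\det _).
  apply/matrixP => i j; rewrite !mxE rmorphD rmorphM /= rmorphMn rmorph1.
  by rewrite !horner_evalE hornerX hornerC.
have d0 : d != 0.
  apply: contra_eq_neq (dE 0) => ->; rewrite scale0r addr0 det1 horner0.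
  by rewrite eq_sym oner_neq0.
have PP x : f.@[vec_coord y] *: P x = f.@[vec_coord x] *: P y.
  apply: (mulfI d0); apply/eqP; rewrite -subr_eq0; apply/eqP/poly_eval0 => k.
  rewrite hornerD hornerN !hornerM !hornerZ -mulrBr dE.
  have [->|dk] := eqVneq (\det (1%:M + k%:R *: u)) 0; first by rewrite mul0r.
  set g := 1%:M + _ in dk *; have gu : g \in unitmx by rewrite unitmxE unitfE.
  have cg j : A j *m g = g *m A j.
    by rewrite mulmxDr mulmxDl mulmx1 mul1mx -scalemxAr -scalemxAl cu.
  have [c c0 e] := subst_eigen gu (discriminant_stable gu cg) (discriminant_stable_inv gu cg).
  have E z : (P z).[k%:R] = c * f.@[vec_coord z].
    rewrite /P line_eval -mevalZ -e lsubst_eval; congr (_.@[vec_coord _]).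
    by rewrite mulmxDl mul1mx -scalemxAl.
  by rewrite !E; apply/eqP; rewrite mulf_eq0; apply/orP; right; apply/eqP; ring.
exists ((lvf u f).@[vec_coord y] / f.@[vec_coord y]).
apply: mpoly_ext => x; rewrite mevalZ.
have := congr1 (fun p : {poly K} => p^`().[0]) (PP x).
rewrite !derivZ !hornerZ !dP => e; apply: (mulfI fy); rewrite e.
by rewrite [RHS]mulrA mulrCA mulfV // mulr1 mulrC.
Qed.
End Facts.

(** * One-parameter subgroups of the associated group *)

Section Weights.
Variables (K : numFieldType) (n : nat).
Implicit Types (f h p q : {mpoly K[n]}) (N X S : 'M[K]_n) (d : 'rV[K]_n).

Definition weight d (m : 'X_{1..n}) : K := \sum_i d 0 i * (m i)%:R.

Lemma lform_diag d i : lform (row i (diag_mx d)) = d 0 i *: 'X_i :> {mpoly K[n]}.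
Proof.
have -> : row i (diag_mx d) = d 0 i *: delta_mx 0 i.
  by apply/rowP => j; rewrite !mxE /= [j == i]eq_sym; case: eqP => _; rewrite ?mulr1n ?mulr1 ?mulr0n ?mulr0.
by rewrite linearZ /= lform_delta.
Qed.

Lemma lvf_diagX d m : lvf (diag_mx d) 'X_[m] = weight d m *: 'X_[m].
Proof.
rewrite /lvf /weight scaler_suml; apply: eq_bigr => i _.
rewrite lform_diag mderivX -scalerAl -scalerAr scalerA.
have [m0|m0] := posnP (m i); first by rewrite m0 mulr0 !scale0r.
rewrite -mpolyXD; congr (_ *: 'X_[_]); rewrite addmC submK //.
by apply/mnm_lepP => j; rewrite mnm1E; case: eqP => [<-|].
Qed.

Lemma mcoeff_lvf_diag d f m : (lvf (diag_mx d) f)@_m = weight d m * f@_m.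
Proof.
have eL : lvf (diag_mx d) f = \sum_(k <- msupp f) (weight d k * f@_k) *: 'X_[k].
  rewrite [in LHS](mpolyE f) linear_sum; apply: eq_bigr => k _.
  by rewrite [LHS]lvfZ lvf_diagX scalerA mulrC.
rewrite eL (raddf_sum (mcoeff m)) [in RHS](mpolyE f) (raddf_sum (mcoeff m)) mulr_sumr.
apply: eq_bigr => k _ /=; rewrite !mcoeffZ mcoeffX.
by case: eqP => [->|]; rewrite ?mulr1 ?mulr0.
Qed.

Lemma lvf_diag_eigen d f c :
  lvf (diag_mx d) f = c *: f <-> forall m, m \in msupp f -> weight d m = c.
Proof.
split=> [e m|hw].
  rewrite mcoeff_msupp => fm; apply: (mulIf fm).
  by rewrite -mcoeff_lvf_diag e mcoeffZ.
apply/mpolyP => m; rewrite mcoeff_lvf_diag mcoeffZ.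
have [/hw->//|] := boolP (m \in msupp f).
by rewrite mcoeff_msupp negbK => /eqP->; rewrite !mulr0.
Qed.

Lemma lvf_locally_nilpotent N k f : iter k (mulmx N) 1%:M = 0 ->
  exists j, iter j (lvf N) f = 0.
Proof.
move=> Nk.
have it0 j : iter j (lvf N) 0 = 0 by elim: j => //= j ->; rewrite raddf0.
have itD j p q : iter j (lvf N) (p + q) = iter j (lvf N) p + iter j (lvf N) q.
  by elim: j => //= j ->; rewrite lvfD.
have mono i j p : iter i (lvf N) p = 0 -> iter (j + i) (lvf N) p = 0.
  by rewrite iterD => ->; apply: it0.
elim/mpoly_ind_ring: f => [c|i|p q [j hj] [l hl]|p q [j hj] [l hl]].
- by exists 1%N; rewrite /= lvfC.
- exists k; suff h u : iter k (lvf N) (lform u) = lform (u *m iter k (mulmx N) 1%:M).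
    by rewrite -lform_delta h Nk mulmx0 raddf0.
  elim: k {Nk} u => [|k IH] u; first by rewrite mulmx1.
  by rewrite iterSr lvf_lform IH /= -mulmxA.
- by exists (j + l)%N; rewrite itD (mono l j q hl) addr0 addnC mono.
exists (j + l)%N; move: {2}(j + l)%N (erefl (j + l)%N) => s es.
elim: s j l p q es hj hl => [|s IH] j l p q es hj hl.
  by move/eqP: es; rewrite addn_eq0 => /andP[/eqP j0 /eqP l0]; move: hj; rewrite j0 l0 /= => ->; rewrite mul0r.
rewrite es iterSr lvfM itD.
have h1 : iter s (lvf N) (lvf N p * q) = 0.
  case: j es hj => [|j] es hj; first by rewrite (hj : p = 0) raddf0 mul0r it0.
  move: es; rewrite addSn => -[es]; rewrite -es; apply: IH => //.
  by rewrite -iterSr.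
rewrite h1 add0r; case: l es hl {h1} => [|l] es hl.
  by rewrite (hl : q = 0) raddf0 mulr0 it0.
move: es; rewrite addnS => -[es]; rewrite -es; apply: IH => //.
by rewrite -iterSr.
Qed.

(** Let T be the diagonal field minus c. On [f] it equals minus the field of [N], which commutes
    with T and is locally nilpotent, so a power of T kills [f]. Being diagonal on monomials, T
    itself kills [f]. *)
Lemma jordan_diag_eigen d N k c f : iter k (mulmx N) 1%:M = 0 ->
  diag_mx d *m N = N *m diag_mx d ->
  lvf (diag_mx d + N) f = c *: f -> lvf (diag_mx d) f = c *: f.
Proof.
move=> Nk cdN; rewrite lvfDl => e.
pose T h := lvf (diag_mx d) h - c *: h.
have TN h : T (lvf N h) = lvf N (T h).
  have e1 : lvf (diag_mx d) (lvf N h) = lvf N (lvf (diag_mx d) h).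
    apply/eqP; rewrite -subr_eq0 lvf_comm.
    by rewrite cdN subrr lvf0l.
  by rewrite /T e1 -lvfZ -(raddfB (lvf N)).
have Tit j h : T (iter j (lvf N) h) = iter j (lvf N) (T h).
  by elim: j => //= j <-.
have Tf : T f = lvf N (- f) by rewrite /T -e opprD addrA subrr add0r raddfN.
have itT j : iter j T f = iter j (lvf N) ((-1) ^+ j *: f).
  elim: j => [|j IH]; first by rewrite scale1r.
  rewrite iterS IH Tit iterSr; congr iter.
  have -> : T ((-1) ^+ j *: f) = (-1) ^+ j *: T f.
    by rewrite /T lvfZ scalerBr !scalerA [c * _]mulrC.
  by rewrite Tf raddfN /= lvfZ exprSr -scalerA scaleN1r scalerN.
have [j hj] := lvf_locally_nilpotent f Nk.
apply/lvf_diag_eigen => m; rewrite mcoeff_msupp => fm.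
have cT l : (iter l T f)@_m = (weight d m - c) ^+ l * f@_m.
  elim: l => [|l IH]; first by rewrite mul1r.
  by rewrite iterS /T mcoeffB mcoeff_lvf_diag mcoeffZ IH exprS -mulrBl mulrA.
have := cT j; rewrite itT.
have -> : iter j (lvf N) ((-1) ^+ j *: f) = (-1) ^+ j *: iter j (lvf N) f.
  by elim: (j) ((-1) ^+ j) => //= l IH a; rewrite IH lvfZ.
rewrite hj scaler0 mcoeff0 => /esym/eqP; rewrite mulf_eq0 (negbTE fm) orbF expf_eq0.
by case/andP => _; rewrite subr_eq0 => /eqP.
Qed.
End Weights.

Lemma common_int_denom n (x : 'I_n -> rat) : exists2 N : int, N != 0 &
  exists z : 'I_n -> int, forall i, x i * N%:~R = (z i)%:~R.
Proof.
exists (\prod_i denq (x i)).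
  by apply/prodf_neq0 => i _; apply: denq_neq0.
exists (fun i => numq (x i) * \prod_(j | j != i) denq (x j)) => i.
rewrite (bigD1 i) //= !rmorphM /= mulrA; congr (_ * _).
by rewrite -{1}(divq_num_den (x i)) divfK // intr_eq0 denq_neq0.
Qed.

(* The solutions of the homogeneous system [weight d m = weight d m0] are spanned by
   rational ones, hence by natural ones once the constant vector 1 is a solution. *)
Lemma nat_weights (K : numFieldType) n (s : seq 'X_{1..n}) (L : 'rV[K]_n -> K) d (c0 c1 : K) :
  (forall c x y, L (c *: x + y) = c * L x + L y) ->
  (forall m, m \in s -> weight d m = c0) ->
  (forall m, m \in s -> weight (const_mx 1) m = c1) ->
  (forall nu : 'I_n -> nat,
    (exists c, forall m, m \in s -> weight (\row_i (nu i)%:R) m = c :> K) ->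
    L (\row_i (nu i)%:R) = 0) ->
  L d = 0.
Proof.
move=> LL hd h1 hL.
have LZ := functionalZ LL.
have LD := functionalD LL.
pose M : 'M[rat]_(n, size s) :=
  \matrix_(i, k) ((nth 0%MM s k i)%:R - (nth 0%MM s 0 i)%:R).
have dM : d *m map_mx ratr M = 0.
  apply/rowP => k; rewrite !mxE.
  have hk (j : nat) : (j < size s)%N -> weight d (nth 0%MM s j) = c0.
    by move=> js; apply/hd/mem_nth.
  have k0 : (0 < size s)%N by apply: leq_ltn_trans (ltn_ord k).
  transitivity (weight d (nth 0%MM s k) - weight d (nth 0%MM s 0)).
    rewrite -sumrB; apply: eq_bigr => i _.
    by rewrite !mxE rmorphB /= !ratr_nat mulrBr.
  by rewrite !hk // subrr.
have [Z ZM /submxP[a ->]] : exists2 Z : 'M[rat]_n, Z *m M = 0 & (d <= map_mx ratr Z)%MS.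
  by exists (kermx M); [exact: mulmx_ker | rewrite map_kermx sub_kermx dM].
rewrite mulmx_sum_row (functional_sum LL) big1 // => j _.
apply/eqP; rewrite mulf_eq0; apply/orP; right.
have [N N0 [z hz]] := common_int_denom (fun i => Z j i).
(* [B] shifts the integral row to natural entries. The shift is a multiple of [const_mx 1], which is
   a solution too. *)
pose B := \sum_i `|z i|%N.
have zB i : 0 <= z i + B%:Z.
  have h : (`|z i| <= B)%N by rewrite /B (bigD1 i) //= leq_addr.
  rewrite -lerBlDl sub0r; apply: le_trans (_ : `|z i| <= _); first by rewrite -normrN ler_norm.
  by rewrite -abszE lez_nat.
have zE i : (absz (z i + B%:Z))%:R = (z i + B%:Z)%:~R :> K.
  by rewrite -[in RHS](gez0_abs (zB i)).
clearbody B; have e : row j (map_mx ratr Z) =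
    (N%:~R)^-1 *: (\row_i (absz (z i + B%:Z))%:R - B%:R *: \row_i 1%N%:R) :> 'rV[K]_n.
  apply/rowP => i; rewrite !mxE mulr1.
  have N0' : N%:~R != 0 :> K by rewrite intr_eq0.
  apply: (mulfI N0'); rewrite zE (mulVKf N0') rmorphD /= addrK.
  by rewrite -(ratr_int K N) -rmorphM mulrC /= hz ratr_int.
have bal1 : (\row_i 1%N%:R) = const_mx 1 :> 'rV[K]_n by apply/rowP => i; rewrite !mxE.
have L1 : L (\row_i 1%N%:R) = 0 by apply: (hL (fun=> 1%N)); rewrite bal1; exists c1.
rewrite e LZ LD -scaleNr LZ L1 mulr0 addr0 mulf_eq0 hL ?eqxx ?orbT //.
pose w (x : 'rV[rat]_n) (m : 'X_{1..n}) := \sum_i x 0 i * (m i)%:R.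
exists (ratr (N%:~R * w (row j Z) (nth 0%MM s 0)) + B%:R * c1) => m ms.
have -> : w (row j Z) (nth 0%MM s 0) = w (row j Z) m.
  have := ZM => /matrixP/(_ j (Ordinal (etrans (index_mem m s) ms))).
  rewrite !mxE => e0; apply/esym/eqP; rewrite -subr_eq0 -e0 /w -sumrB; apply/eqP.
  by apply: eq_bigr => i _; rewrite !mxE /= nth_index // mulrBr.
rewrite -(h1 _ ms) /weight rmorphM /w rmorph_sum /= !mulr_sumr -big_split; apply: eq_bigr => i _ /=.
rewrite !mxE rmorphM /= ratr_nat mul1r mulrA -mulrDl zE; congr (_ * _).
by rewrite -(rmorphM (ratr : rat -> K)) mulrC /= hz ratr_int rmorphD.
Qed.

Section DiagPair.
Variables (K : numClosedFieldType) (n : nat).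
Implicit Types (f : {mpoly K[n.+1]}) (X S T P : 'M[K]_n.+1) (d : 'rV[K]_n.+1).

Lemma lsubst_eigen P f X Y c : P \in unitmx -> X = invmx P *m Y *m P ->
  lvf X f = c *: f <-> lvf Y (lsubst (invmx P) f) = c *: lsubst (invmx P) f.
Proof.
move=> Pu ->; have e : invmx P *m Y = invmx P *m Y *m P *m invmx P by rewrite mulmxK.
have := lvf_lsubst f e; rewrite -lsubstZ => ->; split=> [->//|].
by move/(congr1 (lsubst P)); rewrite !lsubst_comp mulVmx // !lsubst1.
Qed.

Lemma weight_conj d (m : 'X_{1..n.+1}) :
  weight (map_mx (fun x => x^*) d) m = (weight d m)^*.
Proof.
by rewrite /weight rmorph_sum; apply: eq_bigr => i _; rewrite mxE rmorphM /= conjC_nat.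
Qed.

(** In coordinates where [S] is diagonal, all monomials of [f] have the same weight c for [S]. The
    exponents being integers, their weight for [T] is the conjugate of c. *)
Lemma eigen_conj_pair f X S T : conj_pair X S T ->
  eigen_field f X -> eigen_field f S /\ eigen_field f T.
Proof.
move=> cp [c hX]; have [P [d [Pu eS eT]]] := conj_pair_diag cp.
have [s [h [r [N [_ [eS' _] _ hN _]]]]] := cp.
pose Y := P *m (X - S) *m invmx P.
have PK (Z : 'M[K]_n.+1) : invmx P *m (P *m Z *m invmx P) *m P = Z.
  by rewrite !mulmxA mulVmx // mul1mx mulmxKV.
have dE : diag_mx d = P *m S *m invmx P.
  by rewrite eS !mulmxA mulmxV // mul1mx mulmxK.
have hX' : lvf (diag_mx d + Y) (lsubst (invmx P) f) = c *: lsubst (invmx P) f.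
  apply/(lsubst_eigen f c Pu (X := X)) => //.
  by rewrite dE /Y -mulmxDl -mulmxDr PK addrC subrK.
have hd : lvf (diag_mx d) (lsubst (invmx P) f) = c *: lsubst (invmx P) f.
  apply: (jordan_diag_eigen (k := N)) hX'.
    have -> k : iter k (mulmx Y) 1%:M = P *m (X - S) ^+ k *m invmx P.
      elim: k => [|k IH]; first by rewrite expr0 mulmx1 mulmxV.
      by rewrite iterS IH exprS /Y !mulmxA mulmxKV.
    by rewrite hN mulmx0 mul0mx.
  rewrite dE /Y !mulmxA !mulmxKV // -!mulmxA; congr (P *m _).
  rewrite !mulmxA; congr (_ *m _).
  have cXS : X *m S = S *m X by rewrite eS'; apply: (comm_mx_horner s).
  by rewrite mulmxBr mulmxBl cXS.
split.
  by exists c; apply/(lsubst_eigen f c Pu eS).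
exists (c^*); apply/(lsubst_eigen f (c^* ) Pu eT)/lvf_diag_eigen => m mf.
rewrite weight_conj; congr (_ ^* ); by move/lvf_diag_eigen: hd; apply.
Qed.
End DiagPair.

(** * Polynomial curves and Zariski connectedness *)

Section ZariskiCurves.
Variables (K : fieldType) (T : Type) (m : nat) (coord : T -> 'I_m -> K).

(** Equations pull back to [{poly K}], which is a domain. The parameter set [B] is later all of [K],
    its nonzero elements, or the natural numbers, each dense in the line. *)
Lemma curve_irreducible (c : 'I_m -> {poly K}) (pt : K -> T) (B : set K) :
  (forall t k, B t -> coord (pt t) k = (c k).[t]) ->
  (forall p : {poly K}, (forall t, B t -> p.[t] = 0) -> p = 0) ->
  zariski_irreducible coord (pt @` B)%classic.
Proof.
move=> hc hB.
have ev f t : B t -> f.@[coord (pt t)] = (along c f).[t].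
  by move=> Bt; rewrite horner_along; apply: meval_eq => i; rewrite hc.
split.
  apply: contrapT => h; case/eqP: (oner_neq0 {poly K}); apply: hB => t Bt.
  by case: h; exists (pt t), t.
move=> _ _ [S1 ->] [S2 ->] sub.
apply: contrapT => /not_orP[h1 h2].
have nz (S : set {mpoly K[m]}) :
    ~ ((pt @` B)%classic `<=` [set x | forall p, S p -> p.@[coord x] = 0])%classic ->
    exists2 p, S p & along c p != 0.
  move=> h; apply: contrapT => h'; apply: h => _ [t Bt <-] p Sp.
  rewrite ev //; have [->|nz] := eqVneq (along c p) 0; first by rewrite horner0.
  by case: h'; exists p.
have [p Sp np] := nz _ h1; have [q Sq nq] := nz _ h2.
have /eqP := mulf_neq0 np nq; apply; apply: hB => t Bt; rewrite hornerM -!ev //.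
by have [|] := sub (pt t) (imageP _ Bt) => /=; [move/(_ p Sp)|move/(_ q Sq)] => ->;
  rewrite ?mul0r ?mulr0.
Qed.

Lemma irreducible_connected (X : set T) :
  zariski_irreducible coord X -> zariski_connected coord X.
Proof. by move=> [X0 h]; split=> // Z1 Z2 c1 c2 s _; apply: h. Qed.

Lemma star_connected (X : set T) x0 : X x0 ->
  (forall x, X x -> exists C, [/\ zariski_irreducible coord C, (C `<=` X)%classic, C x & C x0]) ->
  zariski_connected coord X.
Proof.
move=> Xx0 h; split; first by exists x0.
move=> Z1 Z2 c1 c2 sub dis.
have notb x : X x -> Z1 x -> Z2 x -> False.
  by move=> Xx Z1x Z2x; have : (X `&` (Z1 `&` Z2))%classic x by []; rewrite dis.
have [z1|z2] := sub _ Xx0; [left|right] => x Xx; have [C [[_ iC] CX Cx Cx0]] := h x Xx;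
  have [s|s] := iC _ _ c1 c2 (fun y Cy => sub y (CX y Cy)); try exact: s.
  by case: (notb _ Xx0) => //; apply: s.
by case: (notb _ Xx0) => //; apply: s.
Qed.
End ZariskiCurves.

Section MatrixCurves.
Variables (K : numFieldType) (n : nat).
Implicit Types (E F : 'M[{poly K}]_n) (X : 'M[K]_n).

Definition at_point E t : 'M[K]_n := map_mx (horner_eval t) E.

Lemma at_pointM E F t : at_point (E *m F) t = at_point E t *m at_point F t.
Proof. exact: map_mxM. Qed.

Lemma at_point_const X t : at_point (map_mx polyC X) t = X.
Proof. by apply/matrixP => i j; rewrite !mxE horner_evalE hornerC. Qed.

Lemma matrix_curve_irreducible E (B : set K) :
  (forall p : {poly K}, (forall t, B t -> p.[t] = 0) -> p = 0) ->
  zariski_irreducible (@mat_coord K n) (at_point E @` B)%classic.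
Proof.
apply: (@curve_irreducible _ _ _ _ (fun k => mxvec E 0 k)) => t k _.
by rewrite /mat_coord /at_point -map_mxvec mxE.
Qed.

Lemma poly_eval_neq0 (p : {poly K}) : (forall t, t != 0 -> p.[t] = 0) -> p = 0.
Proof.
move=> h; have : p * 'X = 0.
  apply: poly_eval0 => k; rewrite hornerM hornerX.
  by have [->|k0] := eqVneq (k%:R : K) 0; rewrite ?mulr0 // h // mul0r.
by move/eqP; rewrite mulf_eq0 polyX_eq0 orbF => /eqP.
Qed.

(** [q = 1] is the equation of exp(tX), and [q = 'X] that of a torus, whose invariant derivation is
    t d/dt. *)
Lemma curve_ode f E X q c (x : 'cV[K]_n) : lvf X f = c *: f ->
  q *: map_mx (@deriv K) E = map_mx polyC X *m E ->
  let F := along (fun i => (E *m map_mx polyC x) i 0) f in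
  q * F^`() = c *: F.
Proof.
move=> ef eE F; rewrite /F; set cu := fun i : 'I_n => _.
have dcu i : q * (cu i)^`() = \sum_j (X i j)%:P * cu j.
  have -> : (cu i)^`() = (map_mx (@deriv K) E *m map_mx polyC x) i 0.
    rewrite /cu !mxE raddf_sum; apply: eq_bigr => j _ /=.
    by rewrite !mxE derivM derivC mulr0 addr0.
  transitivity ((q *: map_mx (@deriv K) E *m map_mx polyC x) i 0).
    by rewrite -scalemxAl [RHS]mxE.
  rewrite eE -mulmxA mxE; apply: eq_bigr => j _.
  by rewrite mxE.
rewrite deriv_along mulr_sumr -mul_polyC -(alongC cu) -rmorphM mul_mpolyC -ef.
rewrite /lvf rmorph_sum; apply: eq_bigr => i _.
rewrite mulrCA dcu rmorphM mulrC; congr (_ * _).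
rewrite /lform rmorph_sum; apply: eq_bigr => j _.
by rewrite -mul_mpolyC rmorphM /= alongC alongX mxE.
Qed.

Lemma curve_eval f E (x : 'cV[K]_n) t :
  (along (fun i => (E *m map_mx polyC x) i 0) f).[t] = f.@[vec_coord (at_point E t *m x)].
Proof.
rewrite horner_along; apply: meval_eq => i; rewrite /vec_coord !mxE horner_sum.
by apply: eq_bigr => j _; rewrite hornerM !mxE hornerC horner_evalE.
Qed.
End MatrixCurves.

Section PolyODE.
Variable K : numFieldType.
Implicit Types (F p : {poly K}).

Lemma poly_ode1 F c t : F^`() = c *: F -> F.[t] = F.[0].
Proof.
move=> e; have F0 : F^`() = 0.
  rewrite e; have [->|c0] := eqVneq c 0; first by rewrite scale0r.
  have [->|F0] := eqVneq F 0; first by rewrite scaler0.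
  by have := lt_size_deriv F0; rewrite e size_scale // ltnn.
suff -> : F = (F`_0)%:P by rewrite !hornerC.
apply/polyP => -[|i]; rewrite coefC //=.
have := congr1 (fun p : {poly K} => p`_i) F0; rewrite coef_deriv coef0 => /eqP.
by rewrite mulrn_eq0 => /eqP.
Qed.

(** The polynomial solutions are multiples of a single power of ['X], which are 0 once they vanish
    at 1. *)
Lemma poly_ode2 F c t : 'X * F^`() = c *: F -> F.[1] = 0 -> F.[t] = 0.
Proof.
move=> e F1; have [->|F0] := eqVneq F 0; first by rewrite horner0.
have cF i : F`_i *+ i = c * F`_i.
  have := congr1 (fun p : {poly K} => p`_i) e; rewrite coefXM coefZ => <-.
  by case: i => [|i]; rewrite ?mulr0n //= coef_deriv.
pose i := (size F).-1; have Fi : F`_i != 0 by rewrite -/(lead_coef F) lead_coef_eq0.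
have ci : c = i%:R by apply: (mulIf Fi); rewrite -cF mulr_natl.
have eF : F = F`_i *: 'X^i.
  apply/polyP => j; rewrite coefZ coefXn; have [->|ji] := eqVneq j i; first by rewrite mulr1.
  rewrite mulr0; apply/eqP; have /eqP := cF j.
  rewrite ci -[_ *+ j]mulr_natl -subr_eq0 -mulrBl mulf_eq0 => /orP[|//].
  by rewrite subr_eq0 eqr_nat (negbTE ji).
by move: F1; rewrite eF hornerZ hornerXn expr1n mulr1 => /eqP; rewrite (negbTE Fi).
Qed.
End PolyODE.

Section Exponential.
Variables (K : numFieldType) (n : nat) (N : nat) (X : 'M[K]_n.+1).
Hypothesis XN : X ^+ N = 0.

Definition expm t : 'M[K]_n.+1 := \sum_(k < N) (t ^+ k / k`!%:R) *: X ^+ k.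

Lemma expm0 : expm 0 = 1.
Proof.
rewrite /expm; case: N XN => [|k] e; first by rewrite big_ord0 -e expr0.
rewrite big_ord_recl big1 => [|i _]; first by rewrite expr0 fact0 divr1 scale1r addr0.
by rewrite exprS !mul0r scale0r.
Qed.

Lemma expmD s t : expm (s + t) = expm s * expm t.
Proof.
pose q (u : K) : {poly K} := \poly_(i < N) (u ^+ i / i`!%:R).
have eq u : expm u = horner_mx X (q u).
  rewrite /q poly_def rmorph_sum; apply: eq_bigr => i _ /=.
  by rewrite linearZ /= rmorphXn /= horner_mx_X.
have f0 k : k`!%:R != 0 :> K by rewrite pnatr_eq0 -lt0n fact_gt0.
rewrite !eq -rmorphM /=; apply/eqP; rewrite -subr_eq0 -rmorphB; apply/eqP.
apply: (@horner_mx_dvd _ _ X 'X^N); last by rewrite rmorphXn /= horner_mx_X.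
apply/eqP/modp_eq0P; rewrite -/(_ %| _) ; apply/dvdpP.
set p := _ - _; exists (drop_poly N p).
rewrite -[LHS](poly_take_drop N) (_ : take_poly N p = 0) ?add0r //.
apply/polyP => k; rewrite coef_take_poly coef0; case: ifP => // kN.
rewrite coefB coefM coef_poly kN; apply/eqP; rewrite subr_eq0; apply/eqP.
rewrite addrC exprDn mulr_suml; apply: eq_bigr => i _.
have ik : (i <= k)%N by rewrite -ltnS.
rewrite !coef_poly (leq_ltn_trans ik kN) (leq_ltn_trans (leq_subr _ _) kN).
rewrite -(bin_fact ik) !natrM -mulr_natr.
have b0 : ('C(k, i))%:R != 0 :> K by rewrite pnatr_eq0 -lt0n bin_gt0.
by field; rewrite !f0 b0.
Qed.

Definition expm_curve : 'M[{poly K}]_n.+1 :=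
  \sum_(k < N) (k`!%:R^-1 *: 'X^k) *: map_mx polyC (X ^+ k).

Lemma expm_curveE t : at_point expm_curve t = expm t.
Proof.
apply/matrixP => i j; rewrite /expm_curve /expm !mxE !summxE rmorph_sum.
apply: eq_bigr => k _; rewrite /= horner_evalE !mxE hornerM hornerZ hornerXn hornerC.
by rewrite [X in X * _]mulrC.
Qed.

Lemma expm_curve_deriv :
  1 *: map_mx (@deriv K) expm_curve = map_mx polyC X *m expm_curve.
Proof.
rewrite scale1r /expm_curve; case: N XN => [|k] e.
  rewrite !big_ord0 mulmx0; apply/matrixP => i j; by rewrite !mxE raddf0.
have eD (r : nat) (a : 'I_r -> {poly K}) (M : 'I_r -> 'M[K]_n.+1) :
    map_mx (@deriv K) (\sum_k a k *: map_mx polyC (M k)) = \sum_k (a k)^`() *: map_mx polyC (M k).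
  apply/matrixP => i j; rewrite mxE !summxE raddf_sum; apply: eq_bigr => l _ /=.
  by rewrite !mxE derivM derivC mulr0 addr0.
have eM l : map_mx polyC X *m map_mx polyC (X ^+ l) = map_mx polyC (X ^+ l.+1).
  by rewrite -map_mxM exprS.
rewrite eD big_ord_recl big_ord_recr /= derivZ expr0 -[in X in X^`()]polyC1 derivC scaler0 scale0r add0r.
rewrite mulmxDr -scalemxAr eM e map_mx0 scaler0 addr0 mulmx_sumr.
apply: eq_bigr => i _; rewrite -scalemxAr eM /bump /=; congr (_ *: _).
rewrite derivZ derivXn -scaler_nat scalerA factS natrM invfM mulrAC mulVf ?mul1r //.
by rewrite pnatr_eq0.
Qed.
End Exponential.

Section Torus.
Variables (K : numFieldType) (n : nat) (P : 'M[K]_n) (nu : 'I_n -> nat).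
Hypothesis Pu : P \in unitmx.

Definition torus t : 'M[K]_n := invmx P *m diag_mx (\row_i t ^+ nu i) *m P.

Lemma torus1 : torus 1 = 1%:M.
Proof.
rewrite /torus (_ : diag_mx _ = 1%:M) ?mulmx1 ?mulVmx //.
by rewrite -diag_const_mx; congr diag_mx; apply/rowP => i; rewrite !mxE expr1n.
Qed.

Lemma torusM s t : torus (s * t) = torus s *m torus t.
Proof.
rewrite /torus !mulmxA mulmxK // -!mulmxA; congr (_ *m _); rewrite mulmxA; congr (_ *m _).
rewrite mulmx_diag; congr diag_mx; apply/rowP => i; by rewrite !mxE exprMn.
Qed.

Definition torus_curve : 'M[{poly K}]_n :=
  map_mx polyC (invmx P) *m diag_mx (\row_i 'X^(nu i)) *m map_mx polyC P.

Lemma torus_curveE t : at_point torus_curve t = torus t.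
Proof.
rewrite /torus_curve !at_pointM !at_point_const /torus; congr (_ *m _ *m _).
rewrite /at_point map_diag_mx; congr diag_mx; apply/rowP => i.
by rewrite !mxE; exact: hornerXn.
Qed.

Lemma torus_curve_deriv : 'X *: map_mx (@deriv K) torus_curve =
  map_mx polyC (invmx P *m diag_mx (\row_i (nu i)%:R) *m P) *m torus_curve.
Proof.
have PP : map_mx polyC P *m map_mx polyC (invmx P) = 1%:M by rewrite -map_mxM mulmxV // map_mx1.
rewrite /torus_curve !map_mxM /= -[in RHS]mulmxA (mulmxA (map_mx polyC P)).
rewrite (mulmxA (map_mx polyC P)) PP mul1mx mulmxA map_diag_mx -[_ *m diag_mx _ *m diag_mx _]mulmxA.
rewrite mulmx_diag; apply/matrixP => i j; rewrite mxE [map_mx _ _ i j]mxE !mxE raddf_sum mulr_sumr.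
apply: eq_bigr => k _ /=.
rewrite !mul_mx_diag !mxE !derivM !derivC mulr0 addr0 mul0r add0r derivXn polyCMn.
by case: (nu k) => [|m]; rewrite /= ?mulr0n ?expr0 ?exprS; ring.
Qed.
End Torus.

Section InGroup.
Variables (K : numClosedFieldType) (n : nat).
Variables (D : set 'cV[K]_n.+1) (f : {mpoly K[n.+1]}) (G : set 'M[K]_n.+1).
Hypothesis rf : reduced_equation D f.
Hypothesis hG : associated_group D G.
Implicit Types (X P : 'M[K]_n.+1) (x : 'cV[K]_n.+1).

(** The points of the curve form a connected subgroup preserving [D], so the maximality of [G]
    applies. *)
Lemma curve_in_group (E : 'M[{poly K}]_n.+1) (B : set K) :
  (forall p : {poly K}, (forall t, B t -> p.[t] = 0) -> p = 0) ->
  (exists2 t, B t & at_point E t = 1%:M) ->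
  (forall s t, B s -> B t -> exists2 r, B r & at_point E r = at_point E s *m at_point E t) ->
  (forall t, B t -> exists2 s, B s & at_point E s *m at_point E t = 1%:M) ->
  (forall t x, B t -> D x -> D (at_point E t *m x)) ->
  forall t, B t -> G (at_point E t).
Proof.
move=> hB h1 hM hV hD t Bt; have [_ _ _ /(_ (at_point E @` B)%classic)] := hG.
apply; last by exists t.
- have eV s s' : at_point E s *m at_point E s' = 1%:M -> invmx (at_point E s') = at_point E s.
    move=> e; have u : at_point E s' \in unitmx by have /mulmx1_unit[] := e.
    by rewrite -[RHS](mulmxK u) e mul1mx.
  split=> [_ [s Bs <-]||_ _ [s Bs <-] [s' Bs' <-]|_ [s Bs <-]] /=.
  - by have [s' _ /mulmx1_unit[]] := hV s Bs.
  - by have [s Bs es] := h1; exists s.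
  - by have [r Br er] := hM _ _ Bs Bs'; exists r.
  - by have [s' Bs' /eV->] := hV s Bs; exists s'.
- exact/irreducible_connected/matrix_curve_irreducible.
by move=> _ x [s Bs <-]; apply: hD.
Qed.

Lemma all_points (p : {poly K}) : (forall t, setT t -> p.[t] = 0) -> p = 0.
Proof. by move=> h; apply: poly_eval0 => k; apply: h. Qed.

Lemma expm_in_group X N : X ^+ N = 0 -> eigen_field f X -> forall t, G (expm N X t).
Proof.
move=> XN [c hc] t; rewrite -expm_curveE.
apply: (curve_in_group (B := setT)) => //; first exact: all_points.
- by exists 0 => //; rewrite expm_curveE expm0.
- by move=> r s _ _; exists (r + s) => //; rewrite !expm_curveE expmD.
- by move=> s _; exists (- s) => //; rewrite !expm_curveE -[_ *m _](expmD XN) addNr expm0.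
move=> s x _ /(reducedE rf) fx; apply/(reducedE rf); rewrite -curve_eval.
have := curve_ode x hc (expm_curve_deriv XN); rewrite /= mul1r => /poly_ode1->.
by rewrite curve_eval expm_curveE expm0 // mul1mx.
Qed.

Lemma torus_in_group P (nu : 'I_n.+1 -> nat) : P \in unitmx ->
  eigen_field f (invmx P *m diag_mx (\row_i (nu i)%:R) *m P) ->
  forall t, t != 0 -> G (torus P nu t).
Proof.
move=> Pu [c hc] t; rewrite -torus_curveE.
apply: (curve_in_group (B := [set t | t != 0]%classic)) => //=; first exact: poly_eval_neq0.
- by exists 1; rewrite ?oner_neq0 ?torus_curveE ?torus1.
- by move=> r s r0 s0; exists (r * s); rewrite ?mulf_neq0 ?torus_curveE ?torusM.
- move=> s s0; exists (s^-1); first by rewrite invr_neq0.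
  by rewrite !torus_curveE -torusM // mulVf // torus1.
move=> s x _ /(reducedE rf) fx; apply/(reducedE rf); rewrite -curve_eval.
apply: poly_ode2 (curve_ode x hc (torus_curve_deriv nu Pu)) _.
by rewrite curve_eval torus_curveE torus1 // mul1mx.
Qed.

Hypothesis f1 : eigen_field f 1%:M.

Lemma eigen_field_linear c X Y : eigen_field f X -> eigen_field f Y -> eigen_field f (c *: X + Y).
Proof.
move=> [a ha] [b hb]; exists (c * a + b).
by rewrite lvfDl lvfZl ha hb scalerA scalerDl.
Qed.

(* The linear equations of G hold on its Lie algebra: differentiate along the
   one-parameter subgroups exp(tX), for X nilpotent, and diag(t^nu). *)
Lemma lie_linear (phi : 'M[K]_n.+1 -> K) :
  (forall c X Y, phi (c *: X + Y) = c * phi X + phi Y) ->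
  (forall g, G g -> phi g = 0) ->
  forall X, eigen_field f X -> phi X = 0.
Proof.
move=> phiL phiG X hX.
have nil Y N : Y ^+ N = 0 -> eigen_field f Y -> phi Y = 0.
  move=> YN hY; pose p : {poly K} := \poly_(k < N) (phi (Y ^+ k) / k`!%:R).
  have p0 : p = 0.
    apply: all_points => t _; transitivity (phi (expm N Y t)); last exact: phiG (expm_in_group YN hY t).
    rewrite horner_poly /expm (functional_sum phiL); apply: eq_bigr => k _ /=.
    by rewrite mulrC mulrA [RHS]mulrAC.
  (* The coefficient of t is [phi Y] as soon as [N] is at least 2; for smaller [N], [Y] is 0. *)
  have := congr1 (fun q : {poly K} => q`_1) p0.
  rewrite coef_poly coef0 expr1 divr1; case: ifP => // /negbT; rewrite -leqNgt => N1 _.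
  suff -> : Y = 0 by apply: functional0 phiL.
  by case: N N1 YN {p p0} => [|[|//]] _; rewrite ?expr1 // expr0 => e; rewrite -[Y]mulr1 e mulr0.
have [S [T cp]] := conj_pair_ex X.
have [hS _] := eigen_conj_pair cp hX.
have [P [d [Pu eS _]]] := conj_pair_diag cp.
have [_ [_ [_ [N [_ _ _ hN _]]]]] := cp.
have -> : X = S + (X - S) by rewrite addrC subrK.
rewrite (functionalD phiL) (nil _ _ hN) ?addr0; last first.
  by rewrite addrC -[S in - S]scale1r -scaleNr; apply: eigen_field_linear.
pose L (x : 'rV[K]_n.+1) := phi (invmx P *m diag_mx x *m P).
rewrite eS -/(L d); set f' := lsubst (invmx P) f.
have [c0 h0] := hS; have [c1 h1] := f1.
have e1 : 1%:M = invmx P *m diag_mx (const_mx 1) *m P :> 'M[K]_n.+1.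
  by rewrite diag_const_mx mulmx1 mulVmx.
apply: (@nat_weights K n.+1 (msupp f') L d c0 c1).
- move=> c x y; rewrite /L -phiL; congr phi.
  by rewrite linearP /= mulmxDr mulmxDl -scalemxAr -scalemxAl.
- by move/(lsubst_eigen f c0 Pu eS)/lvf_diag_eigen: h0.
- by move/(lsubst_eigen f c1 Pu e1)/lvf_diag_eigen: h1.
move=> nu [c hc]; set M := invmx P *m diag_mx (\row_i (nu i)%:R) *m P.
have hM : eigen_field f M.
  by exists c; apply/(lsubst_eigen f c Pu (erefl M))/lvf_diag_eigen.
pose E i := invmx P *m delta_mx i i *m P.
have eL (a : 'I_n.+1 -> K) : phi (invmx P *m diag_mx (\row_i a i) *m P) = \sum_i a i * phi (E i).
  rewrite -(functional_sum phiL) diag_mx_sum_delta mulmx_sumr mulmx_suml; congr phi.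
  by apply: eq_bigr => i _; rewrite mxE -scalemxAr -scalemxAl.
pose p : {poly K} := \sum_i phi (E i) *: 'X^(nu i).
have p0 : p = 0.
  apply: poly_eval_neq0 => t t0; transitivity (phi (torus P nu t)); last exact: phiG (torus_in_group Pu hM t0).
  rewrite /torus eL horner_sum; apply: eq_bigr => i _.
  by rewrite hornerZ hornerXn mulrC.
(* The derivative of [phi] along the torus at t = 1 is the value of [phi] on its generator. *)
have := congr1 (fun q : {poly K} => q^`().[1]) p0.
rewrite deriv0 horner0 => <-; rewrite /L eL /p raddf_sum horner_sum.
apply: eq_bigr => i _ /=; rewrite derivZ hornerZ derivXn hornerMn hornerXn expr1n.
by rewrite mulrC.
Qed.

Lemma lie_stable (W : {vspace 'cV[K]_n.+1}) X v : stable G W -> eigen_field f X ->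
  v \in W -> X *m v \in W.
Proof.
move=> sW hX vW; suff -> : X *m v = projv W (X *m v) by apply: memv_proj.
apply/colP => i; apply/eqP; rewrite -subr_eq0; apply/eqP.
pose phi (Y : 'M[K]_n.+1) := (Y *m v) i 0 - (projv W (Y *m v)) i 0.
apply: (lie_linear (phi := phi)) hX => [c Y Z|g Gg]; rewrite /phi.
  by rewrite mulmxDl -scalemxAl linearP !mxE /=; ring.
by rewrite projv_id ?subrr //; apply: sW.
Qed.

Lemma lie_commute p X : (forall g, G g -> g *m p = p *m g) -> eigen_field f X ->
  X *m p = p *m X.
Proof.
move=> hp hX; apply/matrixP => i j; apply/eqP; rewrite -subr_eq0; apply/eqP.
apply: (lie_linear (phi := fun Y : 'M[K]_n.+1 => (Y *m p) i j - (p *m Y) i j)) hX.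
  by move=> c Y Z; rewrite mulmxDl mulmxDr -scalemxAl -scalemxAr !mxE; ring.
by move=> g Gg /=; rewrite hp // subrr.
Qed.
End InGroup.

(** * Powers of a unipotent matrix and unipotent subgroups *)

Section Binomial.
Variables (K : numFieldType) (n : nat).

Definition binp k : {poly K} := k`!%:R^-1 *: \prod_(j < k) ('X - j%:R%:P).

Lemma binpE k m : (binp k).[m%:R] = ('C(m, k))%:R.
Proof.
have f0 : k`!%:R != 0 :> K by rewrite pnatr_eq0 -lt0n fact_gt0.
apply: (mulfI f0); rewrite /binp hornerZ mulVKf // -natrM mulnC bin_ffact.
elim: k {f0} => [|k IH]; first by rewrite big_ord0 hornerC ffactn0.
rewrite big_ord_recr /= hornerM IH hornerD hornerX hornerN hornerC ffactnSr natrM.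
have [km|mk] := leqP k m; first by rewrite natrB.
by rewrite ffact_small // !mul0r.
Qed.

Lemma natural_points (p : {poly K}) :
  (forall t, (exists m : nat, t = m%:R) -> p.[t] = 0) -> p = 0.
Proof. by move=> h; apply: poly_eval0 => k; apply: h; exists k. Qed.

(** A group containing 1 + b is only known to contain its powers. They are the values at the natural
    numbers of a polynomial curve, binomial coefficients being polynomials in the exponent. *)
Lemma unipotent_powers_irreducible (b : 'M[K]_n.+1) k : b ^+ k = 0 ->
  zariski_irreducible (@mat_coord K n.+1) [set u | exists m, u = (1 + b) ^+ m]%classic.
Proof.
move=> bk; pose E : 'M[{poly K}]_n.+1 := \sum_(i < k) binp i *: map_mx polyC (b ^+ i).
suff -> : [set u | exists m, u = (1 + b) ^+ m]%classic =
    (at_point E @` [set t | exists m : nat, t = m%:R])%classic.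
  exact: matrix_curve_irreducible natural_points.
have EE m : at_point E m%:R = (1 + b) ^+ m.
  have -> : at_point E m%:R = \sum_(i < k) b ^+ i *+ 'C(m, i).
    apply/matrixP => i j; rewrite !mxE !summxE rmorph_sum; apply: eq_bigr => l _.
    by rewrite /= horner_evalE !mxE hornerM hornerC binpE mulr_natl mulmxnE.
  rewrite exprDn_comm; last exact/commr_sym/commr1.
  rewrite (big_ord_widen (m.+1 + k) (fun i => b ^+ i *+ 'C(m, i))) ?leq_addl //.
  rewrite [RHS](big_ord_widen (m.+1 + k) (fun i => 1 ^+ (m - i) * b ^+ i *+ 'C(m, i))) ?leq_addr //.
  rewrite big_mkcond [RHS]big_mkcond; apply: eq_bigr => i _ /=.
  rewrite expr1n mul1r; case: (ltnP i k) => ik; case: (ltnP i m.+1) => im //.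
    by rewrite bin_small.
  by rewrite -(subnK ik) exprD bk mulr0 mul0rn.
apply/seteqP; split=> [_ [m ->]|_ [_ [m ->] <-]]; last by exists m; rewrite EE.
by exists m%:R; [exists m | rewrite EE].
Qed.
End Binomial.

Lemma expm_const (K : numFieldType) n (X : 'M[K]_n.+1) N : X ^+ N = 0 ->
  (forall t, expm N X t = 1) -> X = 0.
Proof.
move=> XN h; apply/matrixP => i j; rewrite [RHS]mxE.
pose p : {poly K} := \poly_(k < N) ((X ^+ k) i j / k`!%:R).
have p0 : p = (p`_0)%:P.
  apply/eqP; rewrite -subr_eq0; apply/eqP/poly_eval0 => k.
  have pE t : p.[t] = (1%:M : 'M[K]_n.+1) i j.
    rewrite -[1%:M](h t) horner_poly summxE; apply: eq_bigr => l _.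
    by rewrite mxE; ring.
  by rewrite hornerD hornerN hornerC -horner_coef0 !pE subrr.
have := congr1 (fun q : {poly K} => q`_1) p0.
rewrite coefC coef_poly expr1 divr1; case: ifP => // /negbT; rewrite -leqNgt => N1 _.
suff -> : X = 0 by rewrite mxE.
by case: N N1 XN {h p p0} => [|[|//]] _; rewrite ?expr1 // expr0 => e; rewrite -[X]mulr1 e mulr0.
Qed.

Section Filtration.
Variables (K : numClosedFieldType) (n : nat) (I : 'M[K]_n.+1 -> Prop).
Implicit Types (b u z : 'M[K]_n.+1).

(* b lowers by one the filtration of the column space by the vectors killed by all
   products of i elements of I. *)
Definition lowers b := forall i (z : 'M[K]_n.+1), kills I i.+1 z -> kills I i (b *m z).

Lemma lowers0 : lowers 0.
Proof. by move=> i z _; rewrite mul0mx; apply: kills0r. Qed.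

Lemma lowersD b b' : lowers b -> lowers b' -> lowers (b + b').
Proof. by move=> h h' i z kz; rewrite mulmxDl; apply: killsD; [apply: h | apply: h']. Qed.

Lemma lowersZ c b : lowers b -> lowers (c *: b).
Proof. by move=> h i z kz; rewrite -scalemxAl; apply: killsZ; apply: h. Qed.

Lemma lowersM b b' : lowers b -> lowers b' -> lowers (b *m b').
Proof. by move=> h h' i z kz; rewrite -mulmxA; apply: h; apply: killsW; apply: h'. Qed.

Lemma lowersX b k : lowers b -> lowers (b ^+ k.+1).
Proof. by move=> h; elim: k => // k IH; rewrite exprS; apply: lowersM. Qed.

(** The point is that the inverse preserves the filtration. Step i + k is the whole space, and the
    identity u^-1 z = z - (u - 1) u^-1 z brings u^-1 z down from there to step i. *)
Lemma lowers_inv u : nilpotent_words I -> u \in unitmx -> lowers (u - 1) -> lowers (invmx u - 1).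
Proof.
move=> [k hk] uu h; have e z : invmx u *m z = z - (u - 1) *m (invmx u *m z).
  by rewrite mulmxBl mul1mx mulKVmx // opprB addrC subrK.
have kN i z : kills I i z -> kills I i (- z).
  by move=> kz; rewrite -scaleN1r; apply: killsZ.
have hz i z : kills I i z -> kills I i (invmx u *m z).
  move=> kz; have : kills I (i + k) (invmx u *m z).
    by move=> w /words_split[a [c [_ /hk-> ->]]]; rewrite mulmx0 mul0mx.
  elim: k {hk} => [|l IH]; first by rewrite addn0.
  rewrite addnS => kl; apply: IH; rewrite e; apply: killsD; last by apply: kN; apply: h.
  by elim: l {kl} => [|l IH]; rewrite ?addn0 // addnS; apply: killsW.
move=> i z kz; have -> : (invmx u - 1) *m z = - (u - 1) *m (invmx u *m z).
  by rewrite mulmxBl mul1mx {1}e addrC addKr mulNmx.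
by rewrite mulNmx; apply: kN; apply: h; apply: hz.
Qed.

Lemma lowers_conj u b : u \in unitmx ->
  (forall x, I x -> I (invmx u *m x *m u)) -> (forall x, I x -> I (u *m x *m invmx u)) ->
  lowers b -> lowers (u *m b *m invmx u).
Proof.
move=> uu h1 h2 hb.
have kc v i z : v \in unitmx -> (forall x, I x -> I (invmx v *m x *m v)) ->
    kills I i z -> kills I i (v *m z).
  move=> vu hv kz w hw.
  have : words I i (invmx v *m w *m v).
    elim: i w hw {z kz} => [|i IH] w /=; first by move->; rewrite mulmx1 mulVmx.
    move=> [x [w' [Ix hw' ->]]]; exists (invmx v *m x *m v), (invmx v *m w' *m v).
    by split; [apply: hv | apply: IH | rewrite !mulmxA mulmxK].
  move/kz => e; rewrite -[w *m _](mulKVmx vu) [invmx v *m _]mulmxA [invmx v *m _ *m _]mulmxA.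
  by rewrite -!mulmxA in e *; rewrite e mulmx0.
move=> i z kz; rewrite -!mulmxA; apply: (kc) => //; apply: hb; apply: (kc) => //.
  by rewrite unitmx_inv.
by move=> x Ix; rewrite invmxK; apply: h2.
Qed.

(** The condition is affine in the entries of [u], with one equation for each word, test matrix and
    entry. *)
Lemma lowers_closed : zariski_closed (@mat_coord K n.+1) [set u | lowers (u - 1)]%classic.
Proof.
pose P (w z : 'M[K]_n.+1) r c : {mpoly K[n.+1 * n.+1]} :=
  \sum_a \sum_b (w r a * z b c) *: 'X_(mxvec_index a b) - ((w *m z) r c)%:MP.
have PE w z r c u : (P w z r c).@[mat_coord u] = (w *m ((u - 1) *m z)) r c.
  rewrite /P mevalB mevalC mulmxBl mulmxBr mul1mx [RHS]mxE [fun_of_matrix (- _) _ _]mxE; congr (_ - _).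
  rewrite mxE (raddf_sum (meval (mat_coord u))); apply: eq_bigr => a _ /=.
  rewrite mxE (raddf_sum (meval (mat_coord u))) mulr_sumr; apply: eq_bigr => b _ /=.
  by rewrite mevalZ mevalXU /mat_coord mxvecE; ring.
exists [set p | exists i w z r c, [/\ words I i w, kills I i.+1 z & p = P w z r c]]%classic.
apply/seteqP; split=> [u hu p [i [w [z [r [c [hw kz ->]]]]]]|u hu i z kz w hw].
  by rewrite PE (hu i z kz w hw) mxE.
apply/matrixP => r c; rewrite -PE [RHS]mxE; apply: hu.
by exists i, w, z, r, c.
Qed.
End Filtration.

Section Endomorphisms.
Variables (K : fieldType) (n : nat).
Implicit Types (h : 'End('cV[K]_n)) (v : 'cV[K]_n).

Definition mx_of h : 'M[K]_n := \matrix_(i, j) h (delta_mx j 0) i 0.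

Lemma mx_ofE h v : mx_of h *m v = h v.
Proof.
rewrite [in RHS](matrix_sum_delta v) linear_sum; apply/colP => i.
rewrite mxE summxE; apply: eq_bigr => j _; rewrite big_ord1 linearZ !mxE mulrC.
by congr (v j _ * _); apply/val_inj; case: (0 : 'I_1) => -[].
Qed.

Lemma mx_ext (X Y : 'M[K]_n) : (forall v : 'cV[K]_n, X *m v = Y *m v) -> X = Y.
Proof.
move=> h; apply/matrixP => i j; have /colP/(_ i) := h (delta_mx j 0).
by rewrite -!colE !mxE.
Qed.
End Endomorphisms.

Lemma eigenvector_in (K : closedFieldType) n (u : 'M[K]_n.+1) (W : {vspace 'cV[K]_n.+1}) w :
  (forall v, v \in W -> u *m v \in W) -> w \in W -> w != 0 ->
  exists c, exists2 v, v \in W & v != 0 /\ u *m v = c *: v.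
Proof.
move=> uW wW w0; have [r er] := closed_field_poly_normal (char_poly u).
have : horner_mx u (\prod_(z <- r) ('X - z%:P)) *m w = 0.
  by rewrite -[\prod_(z <- r) _]scale1r -(eqP (char_poly_monic u)) -er Cayley_Hamilton mul0mx.
elim: r w wW w0 {er} => [|z r IH] w wW w0.
  by rewrite big_nil rmorph1 mul1mx => e; rewrite e eqxx in w0.
rewrite big_cons mulrC rmorphM /= -mulmxE -mulmxA.
have -> : horner_mx u ('X - z%:P) *m w = u *m w - z *: w.
  by rewrite rmorphB /= horner_mx_X horner_mx_C mulmxBl mul_scalar_mx.
have [e _|nz] := eqVneq (u *m w - z *: w) 0.
  by exists z, w => //; split=> //; apply/eqP; rewrite -subr_eq0 e.
by apply: IH => //; rewrite memvB ?memvZ ?uW.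
Qed.

Section Determinantal.
Variables (K : fieldType) (n : nat).

Definition generic_mx : 'M[{mpoly K[n * n]}]_n := \matrix_(i, j) 'X_(mxvec_index i j).

Lemma generic_mxE (g : 'M[K]_n) : map_mx (meval (mat_coord g)) generic_mx = g.
Proof. by apply/matrixP => i j; rewrite !mxE mevalXU /mat_coord mxvecE. Qed.

(** The equation tr(e g e g^-1) = k multiplied by det g; the adjugate makes it polynomial in the
    entries of [g]. *)
Definition conj_trace (e : 'M[K]_n) k : {mpoly K[n * n]} :=
  \tr (map_mx (@mpolyC _ K) e *m generic_mx *m map_mx (@mpolyC _ K) e *m \adj generic_mx)
    - k%:R * \det generic_mx.

Lemma conj_traceE e k g : g \in unitmx ->
  (conj_trace e k).@[mat_coord g] = \det g * (\tr (e *m (g *m e *m invmx g)) - k%:R).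
Proof.
move=> gu; have d0 : \det g != 0 by rewrite -unitfE -unitmxE.
have cC (m : 'M[K]_n) : map_mx (meval (mat_coord g)) (map_mx (@mpolyC _ K) m) = m.
  by apply/matrixP => i j; rewrite !mxE mevalC.
rewrite /conj_trace mevalB mevalM mevalMn meval1 -trace_map_mx -det_map_mx.
rewrite !map_mxM map_mx_adj /= !cC generic_mxE mulrBr [\det g * k%:R]mulrC; congr (_ - _).
have -> : \adj g = \det g *: invmx g by rewrite /invmx gu scalerA mulfV // scale1r.
by rewrite -scalemxAr linearZ /= !mulmxA.
Qed.
End Determinantal.

Definition ker_mx (K : fieldType) n (X : 'M[K]_n) : {vspace 'cV[K]_n} :=
  lker (linfun (mulmx X : 'cV[K]_n -> 'cV[K]_n)).

Lemma ker_mxP (K : fieldType) n (X : 'M[K]_n) (v : 'cV[K]_n) :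
  (v \in ker_mx X) = (X *m v == 0).
Proof. by rewrite memv_ker lfunE. Qed.

(** * The associated group and its Lie algebra *)

Section LieAlgebra.
Variables (K : numClosedFieldType) (n : nat).
Variables (D : set 'cV[K]_n.+1) (f : {mpoly K[n.+1]}) (G : set 'M[K]_n.+1).
Variables (A : 'I_n.+1 -> 'M[K]_n.+1) (H : 'M[{mpoly K[n.+1]}]_n.+1).
Hypothesis rf : reduced_equation D f.
Hypothesis A_eigen : forall j, eigen_field f (A j).
Hypothesis A_span : forall X c, lvf X f = c *: f -> exists a : 'I_n.+1 -> K, X = \sum_j a j *: A j.
Hypothesis HM : H *m field_mx A = f%:M.
Hypothesis hG : associated_group D G.
Implicit Types (X Y Z S T u : 'M[K]_n.+1).

Definition lieg : {vspace 'M[K]_n.+1} := <<mktuple A>>%VS.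

Lemma liegP X : X \in lieg <-> eigen_field f X.
Proof.
split=> [|[c /A_span[a ->]]]; last first.
  apply: memv_suml => j _; apply/memvZ/memv_span.
  by apply/tnthP; exists j; rewrite tnth_mktuple.
move/coord_span => ->; elim/big_ind: _ => [|Y Z hY hZ|j _].
- by exists 0; rewrite lvf0l scale0r.
- by rewrite -[Y]scale1r; apply: eigen_field_linear.
rewrite -[_ *: _]addr0; apply: eigen_field_linear.
  by rewrite -tnth_nth tnth_mktuple.
by exists 0; rewrite lvf0l scale0r.
Qed.

Lemma lieg_bracket X Y : X \in lieg -> Y \in lieg -> X * Y - Y * X \in lieg.
Proof. by move=> /liegP hX /liegP hY; apply/liegP; apply: eigen_fieldB. Qed.

Lemma lieg_conj_pair X S T : X \in lieg -> conj_pair X S T -> S \in lieg /\ T \in lieg.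
Proof. by move=> /liegP hX /eigen_conj_pair/(_ hX)[hS hT]; split; apply/liegP. Qed.

Lemma lieg_centralizer u : centralizes lieg u -> u \in lieg.
Proof.
move=> cu; apply/liegP/(centralizer_eigen rf A_eigen HM) => j.
by apply/esym/cu/liegP.
Qed.

Lemma one_eigen : eigen_field f 1%:M.
Proof. by apply/liegP/lieg_centralizer => X _; rewrite mul1r mulr1. Qed.

Lemma group_unit g : G g -> g \in unitmx.
Proof. by case: hG => -[h _ _ _] _ _ _ /h. Qed.

Lemma group_inv g : G g -> G (invmx g).
Proof. by case: hG => -[_ _ _ h] _ _ _ /h. Qed.

Lemma group_conj g X : G g -> X \in lieg -> g *m X *m invmx g \in lieg.
Proof.
move=> Gg /liegP hX; apply/liegP; have gu := group_unit Gg.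
case: hG => _ _ pr _.
have [c c0 e] := subst_eigen rf gu (fun x => pr g x Gg) (fun x => pr _ x (group_inv Gg)).
exact: eigen_field_conj e gu hX.
Qed.

(* The radical I of the trace form consists of nilpotents, so 1 + lowers I meets G in a
   connected normal unipotent subgroup, which contains exp(tX) for X in I. *)
Lemma lieg_trace_form X : reductive G ->
  X \in lieg -> (forall Y, Y \in lieg -> \tr (X * Y) = 0) -> X = 0.
Proof.
move=> hR.
pose I X := X \in lieg /\ forall Y, Y \in lieg -> \tr (X * Y) = 0.
move=> Xg hX; have {Xg hX} : I X by [].
have Inil Y : I Y -> exists k, Y ^+ k = 0.
  move=> [Yg hY]; have [S [T cp]] := conj_pair_ex Y.
  have [_ Tg] := lieg_conj_pair Yg cp.
  have [||k] := conj_pair_trace cp (mulr1 1); first by rewrite mul1r mulr1.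
    by rewrite mul1r hY.
  by rewrite mul1r => hk; exists k.
have Ilie : lie_subspace I.
  split=> [|Y Z [Yg hY] [Zg hZ]|c Y [Yg hY]|Y Z [Yg hY] [Zg hZ]].
  - by split=> [|Y _]; rewrite ?mem0v // mul0r linear0.
  - by split=> [|W Wg]; rewrite ?memvD // mulrDl linearD /= hY // hZ // addr0.
  - by split=> [|W Wg]; rewrite ?memvZ // -scalerAl linearZ /= hY // mulr0.
  split=> [|W Wg]; first exact: lieg_bracket.
  by rewrite mxtrace_bracket hY //; apply: lieg_bracket.
have Iconj g Y : G g -> I Y -> I (g *m Y *m invmx g).
  move=> Gg [Yg hY]; split=> [|W Wg]; first exact: group_conj.
  rewrite -mulmxE -!mulmxA mxtrace_mulC -!mulmxA hY //.
  rewrite mulmxA -{2}[g]invmxK; exact/group_conj/Wg/group_inv.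
have Inw := engel Ilie Inil; have [k hk] := Inw.
have low_nil b : lowers I b -> b ^+ k = 0.
  by move=> lb; apply: (@kills_exp _ _ I).
pose U : set 'M[K]_n.+1 := (G `&` [set u | lowers I (u - 1)])%classic.
have [[_ G1 GM GV] _ _ _] := hG.
have U1 : U 1 by split=> //=; rewrite subrr; apply: lowers0.
have UM u v : U u -> U v -> U (u *m v).
  move=> [Gu lu] [Gv lv]; split; first exact: GM.
  rewrite /= (_ : u *m v - 1 = (u - 1) *m (v - 1) + ((u - 1) + (v - 1))).
    by apply: lowersD; [apply: lowersM | apply: lowersD].
  by rewrite mulmxE mulrBr mulrBl mulr1 mul1r addrA subrK addrA subrK.
suff eU : U = [set 1%:M]%classic.
  move=> IX; have [N XN] := Inil _ IX; apply: (expm_const XN) => t.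
  have : U (expm N X t).
    split; first by apply: (expm_in_group rf hG XN); apply/liegP; case: IX.
    have lX : lowers I X by move=> i z; apply: killsS.
    rewrite /= /expm; case: (N) XN => [|m] e.
      by rewrite big_ord0 -e expr0 subrr; apply: lowers0.
    rewrite big_ord_recl expr0 fact0 divr1 scale1r addrC addKr.
    elim/big_ind: _ => [|b b' hb hb'|i _]; [exact: lowers0 | exact: lowersD |].
    by apply: lowersZ; apply: lowersX.
  by rewrite eU.
apply: hR.
- split=> // [g [Gg _]|g [Gg lg]]; first exact: group_unit.
  by split; [apply: GV | apply: lowers_inv => //; apply: group_unit].
- by move=> g [].
- by exists [set u | lowers I (u - 1)]%classic; first exact: lowers_closed.
- apply: (star_connected U1) => u Uu; have [Gu lu] := Uu.
  exists [set v | exists m, v = (1 + (u - 1)) ^+ m]%classic; rewrite addrC subrK; split.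
  + have := unipotent_powers_irreducible (low_nil _ lu); by rewrite addrC subrK.
  + by move=> _ [m ->]; elim: m => // m IH; rewrite exprS; apply: UM.
  + by exists 1%N; rewrite expr1.
  by exists 0%N.
- move=> g u Gg [Gu lu]; split; first exact: GM (GM _ _ Gg Gu) (GV _ Gg).
  have gu := group_unit Gg.
  have e : g *m u *m invmx g - 1 = g *m (u - 1) *m invmx g.
    by rewrite mulmxBr mulmxBl mulmx1 mulmxV.
  rewrite /= e.
  apply: lowers_conj => // x Ix; last exact: Iconj.
  by have := Iconj _ _ (GV _ Gg) Ix; rewrite invmxK.
by move=> u [_ lu]; exists k; apply: low_nil.
Qed.
Notation g := lieg.
Implicit Types (e : 'M[K]_n.+1) (W U : {vspace 'cV[K]_n.+1}).

Lemma centralizer_comm u v : centralizes g u -> centralizes g v -> u * v = v * u.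
Proof. by move=> cu cv; apply/cu/lieg_centralizer. Qed.

(* For h in G the trace of e (h e h^-1) is the rank of an idempotent, hence constant on
   the connected group G. *)
Lemma idempotent_comm e h : e * e = e -> centralizes g e -> G h -> h *m e = e *m h.
Proof.
move=> ee ce Gh; pose cj a := a *m e *m invmx a.
have [[_ G1 _ _] Gcon _ _] := hG.
have hE a : G a -> [/\ cj a * cj a = cj a, e * cj a = cj a * e & \tr (cj a) = \tr e].
  move=> Ga; have au := group_unit Ga; split.
  - rewrite /cj -mulmxE !mulmxA mulmxKV // -[a *m e *m e]mulmxA.
    by rewrite [e *m e]ee.
  - apply: (centralizer_comm ce) => X Xg.
    have := group_conj (group_inv Ga) Xg; rewrite invmxK => /ce c.
    transitivity (a *m (e *m (invmx a *m X *m a)) *m invmx a).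
      by rewrite /cj -mulmxE !mulmxA mulmxK.
    by rewrite [e *m _]c /cj -mulmxE !mulmxA mulmxV // mul1mx.
  by rewrite /cj -mulmxA mxtrace_mulC mulmxKV.
have idp a : G a -> (e * cj a) * (e * cj a) = e * cj a.
  move=> Ga; have [h1 h2 h3] := hE a Ga.
  by rewrite mulrA -[e * cj a * e]mulrA -h2 mulrA ee -mulrA h1.
pose r := \rank e.
(* The product runs over all ranks other than that of [e]. [Z1] and [Z2] thus separate the points of
   [G] where the trace is the rank of [e] from the other ones. *)
pose q : {mpoly K[n.+1 * n.+1]} := \prod_(k < n.+2 | k != r :> nat) conj_trace e k.
pose Z1 : set 'M[K]_n.+1 := [set a | forall p, [set conj_trace e r]%classic p -> p.@[mat_coord a] = 0]%classic.
pose Z2 : set 'M[K]_n.+1 := [set a | forall p, [set q]%classic p -> p.@[mat_coord a] = 0]%classic.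
have z1 a : G a -> Z1 a -> \tr (e * cj a) = \tr e.
  move=> Ga /(_ _ erefl)/eqP; have au := group_unit Ga.
  rewrite conj_traceE // mulf_eq0.
  have : \det a != 0 by rewrite -unitfE -unitmxE.
  move=> /negbTE->; rewrite subr_eq0 (mxtrace_idem ee) => /eqP//.
have z2 a : G a -> Z2 a -> \tr (e * cj a) != \tr e.
  move=> Ga /(_ _ erefl)/eqP; have au := group_unit Ga.
  rewrite rmorph_prod prodf_seq_eq0 => /hasP[k _ /andP[kr]].
  rewrite /= conj_traceE // mulf_eq0.
  have : \det a != 0 by rewrite -unitfE -unitmxE.
  move=> /negbTE-> /=; rewrite subr_eq0 (mxtrace_idem ee) => /eqP e1.
  by rewrite -mulmxE e1 eqr_nat.
have z12 : (G `<=` Z1 `|` Z2)%classic.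
  move=> a Ga; have au := group_unit Ga; have tr := mxtrace_idem (idp a Ga).
  have [ra|ra] := eqVneq (\rank (e * cj a)%R) r; [left|right] => _ ->.
    by rewrite conj_traceE // -/(cj a) mulmxE tr ra subrr mulr0.
  rewrite rmorph_prod; have lt : (\rank (e * cj a)%R < n.+2)%N by rewrite ltnS rank_leq_row.
  by rewrite (bigD1 (Ordinal lt)) //= conj_traceE // -/(cj a) mulmxE tr subrr mulr0 mul0r.
have cj1 : e * cj 1%:M = e by rewrite /cj invmx1 mulmx1 mul1mx.
have sub : (G `<=` Z1)%classic.
  have [_ hc] := Gcon; have [||||//|s2] := hc Z1 Z2.
  - by exists [set conj_trace e r]%classic.
  - by exists [set q]%classic.
  - exact: z12.
  - apply/seteqP; split=> // a [Ga [a1 a2]].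
    by have := z2 _ Ga a2; rewrite (z1 _ Ga a1) eqxx.
  by have := z2 _ G1 (s2 _ G1); rewrite cj1 eqxx.
have [h1 h2 h3] := hE h Gh; have ht := z1 _ Gh (sub _ Gh); have hi := idp h Gh.
have hu := group_unit Gh.
(* [e] and [cj h] commute, so [e - e * cj h] is an idempotent; its trace is 0, so it vanishes. By
   symmetry [cj h] equals the product as well. *)
have e1 : e - e * cj h = 0.
  apply: idem_trace0; last by rewrite linearB /= ht subrr.
  have eec : e * (e * cj h) = e * cj h by rewrite mulrA ee.
  have ece : e * cj h * e = e * cj h by rewrite -mulrA -h2 mulrA ee.
  by rewrite mulrBr !mulrBl ee hi ece eec subrr subr0.
have e2 : cj h - e * cj h = 0.
  apply: idem_trace0; last by rewrite linearB /= ht h3 subrr.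
  have ecc : e * cj h * cj h = e * cj h by rewrite -mulrA h1.
  have cec : cj h * (e * cj h) = e * cj h by rewrite mulrA -h2 ecc.
  by rewrite mulrBr !mulrBl h1 hi ecc cec subrr subr0.
have : cj h = e by apply/eqP; rewrite -subr_eq0 -[cj h](subrK (e * cj h)) e2 add0r -opprB e1 oppr0.
by move=> ec; rewrite -{2}ec /cj mulmxKV.
Qed.

Hypothesis gN : forall X, X \in g -> (forall Y, Y \in g -> \tr (X * Y) = 0) -> X = 0.

Definition lie_stable_space W := forall X v, X \in g -> v \in W -> X *m v \in W.

Lemma lie_stable_proj W : lie_stable_space W -> exists p, [/\ p * p = p, centralizes g p,
  forall v, p *m v \in W & forall v, v \in W -> p *m v = v].
Proof.
move=> sW; pose pi := mx_of (projv W).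
have piW v : pi *m v \in W by rewrite mx_ofE memv_proj.
have piI v : v \in W -> pi *m v = v by move=> vW; rewrite mx_ofE projv_id.
have pipi : pi * pi = pi by apply: mx_ext => v; rewrite -mulmxE -mulmxA piI.
have pis X : X \in g -> pi * X * pi = X * pi.
  by move=> Xg; apply: mx_ext => v; rewrite -!mulmxE -!mulmxA piI // sW.
have [p [pp pip ppi pX]] := weyl lieg_bracket
  lieg_conj_pair gN lieg_centralizer pipi pis.
exists p; split=> // v; first by rewrite -pip -mulmxE -mulmxA.
by move=> /piI vW; rewrite -vW mulmxA [p *m pi]ppi.
Qed.

(** From right to left, the invariant projection onto [W] replaces an exponential: it centralizes
    the Lie algebra, so it commutes with [G] by [idempotent_comm]. *)
Lemma stableE W : stable G W <-> lie_stable_space W.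
Proof.
split=> [sW X v /liegP hX|sW]; first exact: (lie_stable rf hG one_eigen sW hX).
have [p [pp cp pW pI]] := lie_stable_proj sW.
move=> a v Ga /pI <-; rewrite mulmxA idempotent_comm // -mulmxA; exact: pW.
Qed.
Lemma irreducible_ex W : stable G W -> W != 0%VS ->
  exists2 U, irreducible_submodule G U & (U <= W)%VS.
Proof.
elim: {W}(\dim W) {-2}W (leqnn (\dim W)) => [|m IH] W dW sW W0.
  by move: dW; rewrite leqn0 dimv_eq0 (negbTE W0).
have [iW|nW] := pselect (irreducible_submodule G W); first by exists W.
have [U [UW sU U0 UneW]] : exists U, [/\ (U <= W)%VS, stable G U, U != 0%VS & U != W].
  apply: contrapT => h; apply: nW; split=> // U UW sU.
  have [->|U0] := eqVneq U 0%VS; first by left.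
  by have [->|UneW] := eqVneq U W; [right | case: h; exists U].
have [|V iV VU] := IH U _ sU U0; last by exists V => //; apply: subv_trans UW.
rewrite -ltnS; apply: leq_trans dW; rewrite ltnNge; apply: contra UneW => h.
by rewrite eqEdim UW.
Qed.

Lemma decomposition_of W : stable G W -> exists l (V : 'I_l -> {vspace 'cV[K]_n.+1}),
  [/\ forall i, irreducible_submodule G (V i),
      directv (\sum_(i < l) V i)%VS & (\sum_(i < l) V i)%VS = W].
Proof.
elim: {W}(\dim W) {-2}W (leqnn (\dim W)) => [|m IH] W dW sW.
  exists 0%N, (fun=> W); split=> [[]//||]; first by rewrite directvE /= !big_ord0 dimv0.
  by apply/esym/eqP; rewrite big_ord0 -dimv_eq0 -leqn0.
have [->|W0] := eqVneq W 0%VS.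
  exists 0%N, (fun=> W); split=> [[]//||]; last by rewrite big_ord0.
  by rewrite directvE /= !big_ord0 dimv0.
have [U iU UW] := irreducible_ex sW W0; have [sU U0 _] := iU.
have [p [pp cp pU pI]] := lie_stable_proj (proj1 (stableE U) sU).
pose W' := (W :&: ker_mx p)%VS.
have sW' : stable G W'.
  move=> h v Gh; rewrite !memv_cap !ker_mxP => /andP[vW /eqP pv].
  rewrite (sW _ _ Gh) //= mulmxA -(idempotent_comm pp cp Gh).
  by rewrite -mulmxA pv mulmx0.
have UW' : (U :&: W')%VS = 0%VS.
  apply/eqP; rewrite -subv0; apply/subvP => v; rewrite !memv_cap ker_mxP.
  by move=> /and3P[vU _]; rewrite pI // memv0.
have eW : (U + W')%VS = W.
  apply/eqP; rewrite eqEsubv subv_add UW capvSl /=; apply/subvP => v vW.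
  rewrite -[v](subrK (p *m v)) addrC memv_add // memv_cap ker_mxP.
  rewrite memvB //=; last by apply: (subvP UW).
  by rewrite mulmxBr mulmxA [p *m p]pp subrr.
have dUW : (\dim U + \dim W' = \dim W)%N by rewrite -dimv_disjoint_sum // eW.
have [|l [V [iV dV sV]]] := IH W' _ sW'.
  rewrite -ltnS; apply: leq_trans dW; rewrite -dUW -[X in (X < _)%N]add0n ltn_add2r.
  by rewrite lt0n dimv_eq0.
exists l.+1, (fun i => if unlift ord0 i is Some j then V j else U).
have rec (T : Type) (idx : T) op (F : {vspace 'cV[K]_n.+1} -> T) :
    \big[op/idx]_(i < l.+1) F (if unlift ord0 i is Some j then V j else U) =
    op (F U) (\big[op/idx]_(i < l) F (V i)).
  rewrite big_ord_recl unlift_none; congr op; apply: eq_bigr => i _.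
  by rewrite liftK.
split=> [i||]; first by case: unliftP => [j|] _.
  rewrite directvE /= (rec _ _ _ id) (rec _ _ _ (fun V => \dim V)) sV dimv_disjoint_sum //.
  by move: dV; rewrite directvE /= sV => /eqP->.
by rewrite (rec _ _ _ id) sV.
Qed.

Lemma decomposition_ex : exists l (V : 'I_l -> {vspace 'cV[K]_n.+1}),
  irreducible_decomposition G V.
Proof.
have [|l [V [h1 h2 h3]]] := @decomposition_of fullv; first by move=> *; rewrite memvf.
by exists l, V.
Qed.

(** The centralizer lies in [g], so it is commutative and its elements preserve each summand, where
    Schur's lemma makes them scalars. This is what excludes multiplicities among the summands. *)
Lemma centralizer_basis l (V : 'I_l -> {vspace 'cV[K]_n.+1}) :
  irreducible_decomposition G V -> exists p : 'I_l -> 'M[K]_n.+1,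
  [/\ forall i, centralizes g (p i),
      forall u, centralizes g u -> exists c : 'I_l -> K, u = \sum_i c i *: p i &
      forall c : 'I_l -> K, \sum_i c i *: p i = 0 -> forall i, c i = 0].
Proof.
move=> [iV dV sV].
pose p i := mx_of (sumv_pi_for (esym sV) i); exists p.
have pV i v : p i *m v \in V i by rewrite mx_ofE memv_sum_pi.
have ps (v : 'cV[K]_n.+1) : \sum_i p i *m v = v.
  transitivity (\sum_i sumv_pi_for (esym sV) i v); last exact: sumv_pi_sum (memvf _).
  by apply: eq_bigr => i _; rewrite mx_ofE.
have pu (w : 'I_l -> 'cV[K]_n.+1) i : (forall j, w j \in V j) -> p i *m (\sum_j w j) = w i.
  move=> wV; have /directv_sum_unique/(_ (fun j => p j *m (\sum_j w j)) w) := dV.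
  move=> /(_ (fun j _ => pV j _) (fun j _ => wV j)); rewrite ps eqxx => /esym.
  by move=> /forallP/(_ i)/eqP.
have VX i X v : X \in g -> v \in V i -> X *m v \in V i.
  by move=> Xg; have [sVi _ _] := iV i; apply: (proj1 (stableE _) sVi).
have cp i : centralizes g (p i).
  move=> X Xg; apply: mx_ext => v; rewrite -!mulmxE -!mulmxA -{1}(ps v) mulmx_sumr.
  by rewrite pu // => j; apply: VX.
have pI i w : w \in V i -> p i *m w = w.
  move=> wV; have := pu (fun j => if j == i then w else 0) i.
  rewrite -big_mkcond big_pred1_eq eqxx; apply => j.
  by case: eqP => [->|]; rewrite ?mem0v.
split=> // [u cu|c c0 i].
  suff /choice[c hc] i : exists c, forall w, w \in V i -> u *m w = c *: w.
    exists c; apply: mx_ext => v; rewrite -{1}(ps v) mulmx_sumr mulmx_suml.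
    by apply: eq_bigr => i _; rewrite (hc i) // -scalemxAl.
  have [sVi V0 Vmin] := iV i.
  have cup := centralizer_comm cu (cp i).
  have uV w : w \in V i -> u *m w \in V i.
    by move=> /pI <-; rewrite mulmxA [u *m p i]cup -mulmxA; apply: pV.
  have [|c [w wV [w0 uw]]] := eigenvector_in uV (memv_pick (V i)).
    by rewrite vpick0.
  exists c => v vV; pose U := (V i :&: ker_mx (u - c%:M))%VS.
  have [|U0|UV] := Vmin U (capvSl _ _).
  - apply/stableE => X x Xg; rewrite !memv_cap !ker_mxP => /andP[xV xk].
    rewrite VX //= mulmxA; have -> : (u - c%:M) *m X = X *m (u - c%:M).
      by rewrite mulmxBl mulmxBr scalar_mxC [u *m X]cu.
    by rewrite -mulmxA (eqP xk) mulmx0.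
  - have : w \in U by rewrite memv_cap wV ker_mxP mulmxBl uw mul_scalar_mx subrr /=.
    by rewrite U0 memv0 (negbTE w0).
  have : v \in U by rewrite UV.
  rewrite memv_cap ker_mxP mulmxBl mul_scalar_mx subr_eq0 => /andP[_ /eqP//].
have [_ V0 _] := iV i; have w0 : vpick (V i) != 0 by rewrite vpick0.
have : (\sum_j c j *: p j) *m vpick (V i) = c i *: vpick (V i).
  rewrite mulmx_suml (bigD1 i) //= -scalemxAl pI ?memv_pick // big1 ?addr0 // => j ji.
  rewrite -scalemxAl -[vpick _](pI i) ?memv_pick //.
  have := pu (fun k => if k == i then p i *m vpick (V i) else 0) j.
  rewrite -big_mkcond big_pred1_eq (negbTE ji) => ->; first by rewrite scaler0.
  by move=> k; case: eqP => [->|]; rewrite ?mem0v.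
rewrite c0 mul0mx => /esym/eqP; rewrite scaler_eq0 (negbTE w0) orbF => /eqP//.
Qed.
End LieAlgebra.

(** * Closed logarithmic forms *)

(* Gauss: a prime of L[X] of positive degree stays coprime to its non-multiples over the
   fraction field of L. *)
Lemma prime_bezout (L : idomainType) (p w : {poly L}) : prime_elt p -> (1 < size p)%N ->
  ~ divides p w -> exists c (al be : {poly L}), c != 0 /\ c%:P = al * w + be * p.
Proof.
move=> [p0 _ pp] sp npw.
have ndC (c : L) h : c != 0 -> divides p (c *: h) -> divides p h.
  move=> c0; rewrite -mul_polyC => /pp[|//] [d ed].
  have : size (c%:P : {poly L}) = (size d + size p).-1.
    rewrite ed size_mul //; apply: contra_neq c0 => d0.
    by apply/eqP; rewrite -polyC_eq0 ed d0 mul0r.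
  rewrite size_polyC c0 => e1.
  have d0 : d != 0 by apply: contra_neq c0 => d0; apply/eqP; rewrite -polyC_eq0 ed d0 mul0r.
  by have := size_poly_gt0 d; rewrite d0; lia.
have : coprimep p w.
  have /Pdiv.Idomain.dvdpP[[c h] /= c0 eh] := dvdp_gcdl p w.
  have /Pdiv.Idomain.dvdpP[[c' h'] /= c'0 eh'] := dvdp_gcdr p w.
  have h0 : h != 0.
    by apply: contra_neq p0 => h0; move/eqP: eh; rewrite h0 mul0r -mul_polyC mulf_eq0 polyC_eq0 (negbTE c0) => /eqP.
  have g0 : gcdp p w != 0 by rewrite gcdp_eq0 (negbTE p0).
  have [|[d ed]|[d ed]] := pp h (gcdp p w).
  - by rewrite -eh -mul_polyC; apply: divides_mull; apply: divides_refl.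
  - have : size (c *: p) = (size h + size (gcdp p w)).-1 by rewrite eh size_mul.
    have d0 : d != 0 by apply: contra_neq h0 => d0; rewrite ed d0 mul0r.
    rewrite size_scale // ed size_mul // /coprimep => e1; apply/eqP.
    have := size_poly_gt0 d; have := size_poly_gt0 (gcdp p w); rewrite d0 g0.
    by lia.
  by case: npw; apply: (ndC c') => //; rewrite eh' ed; exists (h' * d); rewrite mulrA.
move=> /Pdiv.Idomain.Bezout_coprimepP[[a b] /= /eqpP[[c c'] /= /andP[c0 c'0] e]].
exists c', (c *: b), (c *: a); split=> //.
by rewrite -!scalerAl -scalerDr addrC e alg_polyC.
Qed.

Section Residue.
Variables (K : numClosedFieldType) (n : nat) (D : set 'cV[K]_n.+1).
Variables (f p q : {mpoly K[n.+1]}) (P : 'I_n.+1 -> {mpoly K[n.+1]}).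
Hypothesis rf : reduced_equation D f.
Hypothesis fE : f = q * p.
Hypothesis pp : prime_elt p.
Hypothesis closed : forall a b,
  f * ((P b)^`M(a) - (P a)^`M(b)) = P b * f^`M(a) - P a * f^`M(b).
Implicit Types (a b : 'I_n.+1) (h : {mpoly K[n.+1]}).

Let npq : ~ divides p q := reduced_squarefree rf pp fE.

(** If [h] vanished on the zeros of [p], then [h * q] would vanish on [D] and be divisible by f = q
    p, so [p] would divide [h]. *)
Lemma prime_nonzero_point h : ~ divides p h ->
  exists x : 'cV[K]_n.+1, p.@[vec_coord x] = 0 /\ h.@[vec_coord x] != 0.
Proof.
move=> nh; apply: contrapT => no; have [p0 _ hp] := pp.
have [k ek] : divides f (h * q).
  apply: (reduced_div rf) => x /(reducedE rf); rewrite fE !mevalM => /eqP.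
  rewrite mulf_eq0 => /orP[/eqP->|/eqP px]; first by rewrite mulr0.
  have [->|hx] := eqVneq h.@[vec_coord x] 0; first by rewrite mul0r.
  by case: no; exists x.
have q0 : q != 0 by apply: contra_not_neq npq => ->; apply: divides0.
case: nh; exists k; apply: (mulIf q0).
by rewrite ek fE mulrA mulrAC.
Qed.

Lemma vanishing_derivatives (S : {mpoly K[n.+1]} -> Prop) x :
  (forall h, S h -> h.@[vec_coord x] = 0) -> (forall h b, S h -> S h^`M(b)) ->
  forall h, S h -> h = 0.
Proof.
move=> Sx SD h; elim: {h}(msize h) {-2}h (leqnn (msize h)) => [|m IH] h hm Sh.
  by apply/eqP; rewrite -msize_poly_eq0 -leqn0.
have [->//|h0] := eqVneq h 0.
have e := mderiv_all0 (fun i => IH _ (leq_trans (mderiv_small i h0) hm) (SD h i Sh)).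
by have := Sx _ Sh; rewrite e mevalC => ->; rewrite mpolyC0.
Qed.

(* A derivation tangent to D which kills f. *)
Definition tangent a b h := f^`M(a) * h^`M(b) - f^`M(b) * h^`M(a).

Lemma tangentD a b h k : tangent a b (h + k) = tangent a b h + tangent a b k.
Proof. by rewrite /tangent !mderivD; ring. Qed.

Lemma tangentM a b h k : tangent a b (h * k) = tangent a b h * k + h * tangent a b k.
Proof. by rewrite /tangent !mderivM; ring. Qed.

Lemma tangent_prime a b : divides p (tangent a b p).
Proof.
exists (q^`M(a) * p^`M(b) - q^`M(b) * p^`M(a)).
by rewrite /tangent fE !mderivM; ring.
Qed.

(** The polynomial is the numerator of the derivative of P a / (df/dx_a) along the tangent field.
    Its divisibility comes from differentiating [closed] with respect to x_a. *)
Lemma tangent_ratio a b :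
  divides p (f^`M(a) * tangent a b (P a) - P a * tangent a b f^`M(a)).
Proof.
have [C eC] : exists C, C = (P b)^`M(a) - (P a)^`M(b) by eexists.
have e0 := closed a b; rewrite -eC in e0.
have := congr1 (mderiv a) e0; rewrite mderivM mderivB !mderivM => e1.
exists (q * (f^`M(a) * C^`M(a) - C * f^`M(a)^`M(a)) ).
have -> : q * (f^`M(a) * C^`M(a) - C * f^`M(a)^`M(a)) * p =
    f^`M(a) * (f * C^`M(a)) - f * C * f^`M(a)^`M(a) by rewrite fE; ring.
have -> : f * C^`M(a) = (P b)^`M(a) * f^`M(a) + P b * f^`M(a)^`M(a)
    - ((P a)^`M(a) * f^`M(b) + P a * f^`M(b)^`M(a)) - f^`M(a) * C.
  by rewrite -e1 addrC addKr.
by rewrite e0 /tangent eC [f^`M(b)^`M(a)]mderiv_comm; ring.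
Qed.

(** Membership in the ideal (w, p) after inverting v, which will be nonzero at the chosen point. *)
Definition near_ideal v w h := exists k al be, v ^+ k * h = al * w + be * p.

Lemma near_ideal_tangent a b w h :
  divides p (f^`M(a) * tangent a b w - w * tangent a b f^`M(a)) ->
  near_ideal f^`M(a) w h -> near_ideal f^`M(a) w (tangent a b h).
Proof.
set v := f^`M(a) => -[s es] [k [al [be e]]].
have [t et] := tangent_prime a b.
have := congr1 (tangent a b) e; rewrite tangentM tangentD !tangentM et => e1.
have eT : v * tangent a b w = s * p + w * tangent a b v by rewrite -es subrK.
have [r er] : exists r, v * tangent a b (v ^+ k) = v ^+ k * r.
  elim: k {e e1} => [|k [r er]].
    exists 0; rewrite expr0 /tangent (_ : 1 = 1%:MP) ?mderivC ?mpolyC1 //; ring.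
  exists (tangent a b v + r); rewrite exprS tangentM mulrDr [v * (v * _)]mulrCA er.
  by ring.
exists k.+1, (v * tangent a b al + al * tangent a b v - r * al),
  (al * s + v * tangent a b be + v * be * t - r * be).
have e2 : v ^+ k.+1 * tangent a b h = v * (v ^+ k * tangent a b h) by rewrite exprS mulrA.
have e3 : v * (v ^+ k * tangent a b h) =
    v * (tangent a b al * w + al * tangent a b w + (tangent a b be * p + be * (t * p)))
    - r * (al * w + be * p).
  by rewrite -e1 -e [v * (_ + _)]mulrDr [v * (tangent _ _ _ * h)]mulrA er; ring.
rewrite e2 e3.
have -> : v * (tangent a b al * w + al * tangent a b w + (tangent a b be * p + be * (t * p)))
  = v * tangent a b al * w + al * (v * tangent a b w) + v * (tangent a b be * p + be * (t * p)).
  by ring.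
by rewrite eT; ring.
Qed.

(* If the residue u / v, with u = P a and v = df/dx_a, takes the value lam at a point x of
   V(p), then w = u - lam v vanishes to infinite order at x along V(p).  Were w not a
   multiple of p, some nonzero polynomial free of x_a would lie in (p, w) and vanish with
   all its derivatives at x. *)
Lemma residue_const : exists lam : K, forall b, divides p (P b - lam *: f^`M(b)).
Proof.
have [p0 np hp] := pp.
have [a na] := prime_mderiv pp.
have nv : ~ divides p f^`M(a).
  rewrite fE mderivM => h; have [] : divides p q \/ divides p p^`M(a) => //.
  apply: hp; have -> : q * p^`M(a) = q^`M(a) * p + q * p^`M(a) - q^`M(a) * p by ring.
  by apply: dividesB => //; apply: divides_mull; apply: divides_refl.
have [x [px vx]] := prime_nonzero_point nv.
pose lam := (P a).@[vec_coord x] / f^`M(a).@[vec_coord x]; exists lam.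
pose w := P a - lam *: f^`M(a).
have wx : w.@[vec_coord x] = 0 by rewrite mevalB mevalZ divfK // subrr.
have tw b : divides p (f^`M(a) * tangent a b w - w * tangent a b f^`M(a)).
  have -> : f^`M(a) * tangent a b w - w * tangent a b f^`M(a) =
      f^`M(a) * tangent a b (P a) - P a * tangent a b f^`M(a).
    rewrite /w -mul_mpolyC /tangent !mderivB !mderivM !mderivC; ring.
  exact: tangent_ratio.
have pw : divides p w.
  apply: contrapT => npw.
  have iso_div h k : divides (to_uni a h) (to_uni a k) -> divides h k.
    move=> [d ed]; exists (of_uni a d); rewrite -(to_uniK a h) -(to_uniK a k) ed.
    by rewrite rmorphM.
  have ppu : prime_elt (to_uni a p).
    split.
    - by apply: contra_neq p0 => e; rewrite -(to_uniK a p) e rmorph0.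
    - apply/negP => /unitrP[k [k1 k2]]; case/negP: np.
      apply/unitrP; exists (of_uni a k); split.
        by rewrite -{1}(to_uniK a p) -(rmorphM (of_uni a)) k1 rmorph1.
      by rewrite -{1}(to_uniK a p) -(rmorphM (of_uni a)) k2 rmorph1.
    move=> h k; rewrite -(of_uniK a h) -(of_uniK a k) -rmorphM /= => /iso_div/hp.
    by case=> -[d ->]; [left|right]; rewrite rmorphM /=; apply: divides_mull; apply: divides_refl.
  have su : (1 < size (to_uni a p))%N.
    rewrite ltnNge; apply/negP => /size1_polyC e; apply: na.
    by rewrite -(to_uniK a p) e of_uniC insert_var_deriv; apply: divides0.
  have nu : ~ divides (to_uni a p) (to_uni a w) by move/iso_div.
  have [c [al [be [c0 ec]]]] : exists (c : {mpoly K[n]}) (al be : {poly {mpoly K[n]}}),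
      c != 0 /\ c%:P = al * to_uni a w + be * to_uni a p by exact: prime_bezout ppu su nu.
  (* On polynomials free of ['X_a] the field [tangent a b] is df/dx_a times d/dx_b, so [S] is stable
     under all derivatives. *)
  pose S h := h^`M(a) = 0 /\ near_ideal f^`M(a) w h.
  have S0 : S 0.
    by split; [rewrite raddf0 | exists 0%N, 0, 0; rewrite !mul0r mulr0 addr0].
  have Sc : S (insert_var a c).
    split; first exact: insert_var_deriv.
    exists 0%N, (of_uni a al), (of_uni a be); rewrite expr0 mul1r -of_uniC ec.
    by rewrite rmorphD; congr (_ + _); rewrite rmorphM; congr (_ * _); exact: to_uniK.
  have/eqP : insert_var a c = 0.
    apply: (vanishing_derivatives (S := S) (x := x)) Sc => [h [_ [k [al' [be' e]]]]|h b [ha nh]].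
      have /eqP := congr1 (meval (vec_coord x)) e.
      rewrite mevalD !mevalM wx px !mulr0 addr0 mulf_eq0 rmorphXn expf_eq0 /=.
      by rewrite (negbTE vx) andbF => /eqP.
    split; first by rewrite mderiv_comm ha raddf0.
    have := near_ideal_tangent (tw b) nh; rewrite /tangent ha mulr0 subr0.
    by move=> [k [al' [be' e]]]; exists k.+1, al', be'; rewrite exprSr -mulrA.
  by rewrite -(rmorph0 (insert_var a)) (inj_eq (@insert_var_inj _ _ a)) (negbTE c0).
(* Modulo p, the relation [closed] carries the residue from the coefficient a over to the
   coefficient b. *)
move=> b; have : divides p (f^`M(a) * (P b - lam *: f^`M(b))).
  have [d ed] := pw; exists (q * ((P b)^`M(a) - (P a)^`M(b)) + d * f^`M(b)).
  have e1 : P a = lam *: f^`M(a) + d * p by rewrite -ed addrC subrK.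
  have -> : f^`M(a) * (P b - lam *: f^`M(b)) =
     (P b * f^`M(a) - P a * f^`M(b)) + d * p * f^`M(b).
    by rewrite e1 -!mul_mpolyC; ring.
  by rewrite -(closed a b) {1}fE; ring.
by case/hp.
Qed.
End Residue.

Section Contraction.
Variables (K : numClosedFieldType) (n : nat).
Implicit Types (X : 'M[K]_n) (F : 'I_n -> {mpoly K[n]}).

(** The pairing of the 1-form with coefficients [F] and the linear field of [X]. *)
Definition contract X F := \sum_b lform (row b X) * F b.

Lemma contractDl X Y F : contract (X + Y) F = contract X F + contract Y F.
Proof.
by rewrite /contract -big_split; apply: eq_bigr => b _ /=; rewrite !raddfD mulrDl.
Qed.

Lemma contractZl c X F : contract (c *: X) F = c *: contract X F.
Proof.
rewrite /contract scaler_sumr; apply: eq_bigr => b _.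
by rewrite !linearZ scalerAl.
Qed.

Lemma contract_suml k (c : 'I_k -> K) (X : 'I_k -> 'M[K]_n) F :
  contract (\sum_j c j *: X j) F = \sum_j c j *: contract (X j) F.
Proof.
elim/big_rec2: _ => [|j Y Z _ <-]; last by rewrite contractDl contractZl.
by rewrite /contract big1 // => b _; rewrite row0 raddf0 mul0r.
Qed.

Lemma contractD X F F' : contract X (fun b => F b + F' b) = contract X F + contract X F'.
Proof. by rewrite /contract -big_split; apply: eq_bigr => b _; rewrite mulrDr. Qed.

Lemma contractM X h F : contract X (fun b => h * F b) = h * contract X F.
Proof. by rewrite /contract mulr_sumr; apply: eq_bigr => b _; rewrite mulrCA. Qed.

Lemma contract_comb X h c k F1 F2 F3 F4 :
  contract X (fun a => h * (F1 a - F2 a) - (k * F3 a - F4 a * c)) =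
  h * (contract X F1 - contract X F2) - (k * contract X F3 - contract X F4 * c).
Proof.
rewrite /contract -!sumrB !mulr_sumr mulr_suml -!sumrB; apply: eq_bigr => l _.
by ring.
Qed.

Lemma contract_sum X k (F : 'I_k -> 'I_n -> {mpoly K[n]}) :
  contract X (fun b => \sum_j F j b) = \sum_j contract X (F j).
Proof.
by rewrite /contract exchange_big; apply: eq_bigr => b _; rewrite mulr_sumr.
Qed.

Lemma lform_mul (u : 'rV[K]_n) X : lform (u *m X) = \sum_b (u 0 b)%:MP * lform (row b X).
Proof.
rewrite mulmx_sum_row linear_sum; apply: eq_bigr => b _.
by rewrite [LHS]linearZ mul_mpolyC.
Qed.

Lemma lvf_contract X Y F :
  lvf X (contract Y F) = contract (Y *m X) F + contract Y (fun b => lvf X (F b)).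
Proof.
rewrite /contract linear_sum -big_split; apply: eq_bigr => b _.
by rewrite [LHS]lvfM lvf_lform row_mul.
Qed.

Lemma contract_mul X Y F :
  contract (Y *m X) F = contract X (fun a => \sum_b (Y b a)%:MP * F b).
Proof.
rewrite /contract; under eq_bigr => b _ do rewrite row_mul lform_mul mulr_suml.
rewrite exchange_big; apply: eq_bigr => a _; rewrite mulr_sumr; apply: eq_bigr => b _.
by rewrite mxE mulrCA mulrA [X in X * _]mulrC -mulrA mulrCA mulrA mulrAC.
Qed.

Lemma mderiv_contract X F a :
  (contract X F)^`M(a) = \sum_b (X b a)%:MP * F b + contract X (fun b => (F b)^`M(a)).
Proof.
rewrite /contract (raddf_sum (mderiv a)) -big_split; apply: eq_bigr => b _ /=.
by rewrite mderivM lform_mderiv mxE.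
Qed.
End Contraction.

Section LogForms.
Variables (K : numClosedFieldType) (n : nat).
Variables (D : set 'cV[K]_n.+1) (f : {mpoly K[n.+1]}).
Variables (A : 'I_n.+1 -> 'M[K]_n.+1) (H : 'M[{mpoly K[n.+1]}]_n.+1).
Hypothesis rf : reduced_equation D f.
Hypothesis A_eigen : forall j, eigen_field f (A j).
Hypothesis A_span : forall X c, lvf X f = c *: f -> exists a : 'I_n.+1 -> K, X = \sum_j a j *: A j.
Hypothesis HM : H *m field_mx A = f%:M.
Implicit Types (X Y : 'M[K]_n.+1) (F : 'I_n.+1 -> {mpoly K[n.+1]}).
Notation g := (lieg A).
Let liegE X : X \in g <-> eigen_field f X := liegP A_eigen A_span X.

(** The Saito matrix is invertible over the field of fractions, so a form is determined by its
    values on the fields [A j]. *)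
Lemma contract_eq0 F : (forall j, contract (A j) F = 0) -> forall b, F b = 0.
Proof.
move=> h b; have f0 := reduced_neq0 rf.
pose Fc : 'cV[{mpoly K[n.+1]}]_n.+1 := \col_l F l.
have e0 : field_mx A *m Fc = 0.
  apply/colP => j; rewrite !mxE -[RHS](h j); apply: eq_bigr => l _.
  by rewrite !mxE.
have := congr1 (fun M : 'M_n.+1 => (M *m Fc) b 0) HM.
rewrite -mulmxA e0 mulmx0 mul_scalar_mx !mxE => /esym/eqP.
by rewrite mulf_eq0 (negbTE f0) => /eqP.
Qed.

Variable phi : 'M[K]_n.+1 -> K.
Hypothesis phiL : forall c X Y, phi (c *: X + Y) = c * phi X + phi Y.
Hypothesis phiB : forall X Y, X \in g -> Y \in g -> phi (X * Y - Y * X) = 0.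

(* The coefficients of f w, where w is the 1-form taking the constant value phi X on the
   field X of the Lie algebra; w is closed because phi kills brackets. *)
Definition form_coef b : {mpoly K[n.+1]} := \sum_i phi (A i) *: H b i.

Lemma contract_form X : X \in g -> contract X form_coef = phi X *: f.
Proof.
move=> /liegE[c /A_span[a ->]]; rewrite contract_suml.
rewrite (functional_sum phiL) scaler_suml; apply: eq_bigr => j _; rewrite -scalerA; congr (_ *: _).
have VH := square_inverse (reduced_neq0 rf) HM.
rewrite /contract; under eq_bigr => b _ do rewrite /form_coef mulr_sumr.
rewrite exchange_big (bigD1 j) //= [X in _ + X]big1 ?addr0 => [|i ij].
  have /matrixP/(_ j j) := VH; rewrite !mxE eqxx mulr1n => <-.
  by rewrite scaler_sumr; apply: eq_bigr => b _; rewrite -scalerAr !mxE.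
have /matrixP/(_ j i) := VH; rewrite !mxE eq_sym (negbTE ij) mulr0n => e.
transitivity (phi (A i) *: \sum_b field_mx A j b * H b i); last by rewrite e scaler0.
by rewrite scaler_sumr; apply: eq_bigr => b _; rewrite -scalerAr !mxE.
Qed.

(** The left-hand side is a coefficient of the Lie derivative of f w along [A i]. As [phi] kills
    brackets, w is invariant, and only the factor c of f remains. *)
Lemma form_lie_invariant i c : lvf (A i) f = c *: f -> forall b,
  lvf (A i) (form_coef b) + \sum_a (A i a b)%:MP * form_coef a = c *: form_coef b.
Proof.
move=> hc b; apply/eqP; rewrite -subr_eq0; apply/eqP; move: b.
apply: (@contract_eq0 (fun b => lvf (A i) (form_coef b) + \sum_a (A i a b)%:MP * form_coef a
  - c *: form_coef b)) => j.
have Ag l : A l \in g by apply/liegE.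
rewrite !contractD -contract_mul.
have -> : contract (A j) (fun b => - (c *: form_coef b)) = - (c *: (phi (A j) *: f)).
  rewrite -(contract_form (Ag j)) -mul_mpolyC -mulNr -contractM.
  by apply: eq_bigr => b _; rewrite mulNr mul_mpolyC.
have := lvf_contract (A i) (A j) form_coef.
rewrite (contract_form (Ag j)) lvfZ hc => e3.
have -> : contract (A j) (fun b => lvf (A i) (form_coef b)) =
    phi (A j) *: (c *: f) - contract (A j *m A i) form_coef by rewrite e3 addrC addKr.
have -> : contract (A i *m A j) form_coef =
    contract (A i *m A j - A j *m A i) form_coef + contract (A j *m A i) form_coef.
  by rewrite -contractDl subrK.
have cB := contract_form (lieg_bracket A_eigen A_span (Ag i) (Ag j)).
rewrite (phiB (Ag i) (Ag j)) scale0r -!mulmxE in cB.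
by rewrite cB add0r subrK scalerA mulrC scalerA subrr.
Qed.

(** This is dw = 0 for w = [form_coef] / f, cleared of denominators. Contracted with each [A i], it
    follows from Cartan's formula and [form_lie_invariant]. *)
Lemma form_closed a b :
  f * ((form_coef b)^`M(a) - (form_coef a)^`M(b)) =
  form_coef b * f^`M(a) - form_coef a * f^`M(b).
Proof.
apply/eqP; rewrite -subr_eq0; apply/eqP; move: a.
apply: (@contract_eq0 (fun a => f * ((form_coef b)^`M(a) - (form_coef a)^`M(b)) -
  (form_coef b * f^`M(a) - form_coef a * f^`M(b)))) => i.
have Ag : A i \in g by apply/liegE.
have [c hc] := A_eigen i; have := form_lie_invariant hc b.
have := congr1 (mderiv b) (contract_form Ag); rewrite mderiv_contract mderivZ => e1 e2.
transitivity (f * (lvf (A i) (form_coef b) - contract (A i) (fun a => (form_coef a)^`M(b)))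
  - (form_coef b * lvf (A i) f - contract (A i) form_coef * f^`M(b))).
  exact: contract_comb.
have -> : contract (A i) (fun a => (form_coef a)^`M(b)) =
    phi (A i) *: f^`M(b) - \sum_a (A i a b)%:MP * form_coef a by rewrite -e1 addrC addKr.
have -> : lvf (A i) (form_coef b) = c *: form_coef b - \sum_a (A i a b)%:MP * form_coef a.
  by rewrite -e2 addrK.
rewrite (contract_form Ag) hc -!mul_mpolyC; ring.
Qed.
End LogForms.

(** * Prime factors of the equation and their characters *)

Section Factors.
Variables (K : numClosedFieldType) (n : nat).
Variables (D : set 'cV[K]_n.+1) (f : {mpoly K[n.+1]}).
Hypothesis rf : reduced_equation D f.

Definition factorization k (u : {mpoly K[n.+1]}) (p : 'I_k -> {mpoly K[n.+1]}) :=
  [/\ u \is a GRing.unit, forall j, prime_elt (p j) & f = u * \prod_j p j].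

Lemma factorization_ex : exists k u (p : 'I_k -> {mpoly K[n.+1]}), factorization u p.
Proof.
have [u [s [uu ps ef]]] := mpoly_factorial (reduced_neq0 rf).
exists (size s), u, (fun j => tnth (in_tuple s) j); split=> // [j|].
  by apply: ps; apply: mem_tnth.
by rewrite {1}ef (big_tnth _ _ s).
Qed.

Variables (k : nat) (u : {mpoly K[n.+1]}) (p : 'I_k -> {mpoly K[n.+1]}).
Hypothesis fac : factorization u p.

Definition cofactor_of j := u * \prod_(i < k | i != j) p i.

Lemma cofactorE j : f = cofactor_of j * p j.
Proof. by have [_ _ ->] := fac; rewrite (bigD1 j) //= /cofactor_of mulrAC mulrA. Qed.

Lemma cofactor_prime j : ~ divides (p j) (cofactor_of j).
Proof. by have [_ ps _] := fac; apply: (reduced_squarefree rf (ps j)); apply: cofactorE. Qed.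

Lemma divides_cofactor i j : i != j -> divides (p i) (cofactor_of j).
Proof.
by move=> ij; rewrite /cofactor_of (bigD1 i) //= mulrCA; apply: divides_mulr; apply: divides_refl.
Qed.

Lemma factors_divide h : (forall j, divides (p j) h) -> divides f h.
Proof.
move=> ph; apply: (reduced_div rf) => x /(reducedE rf); have [uu _ ->] := fac.
have [c c0 ->] := mpoly_unitP uu.
rewrite mevalM mevalC rmorph_prod => /eqP; rewrite mulf_eq0 (negbTE c0) prodf_seq_eq0 /=.
by move=> /hasP[j _ /= /eqP pj]; have [d ->] := ph j; rewrite mevalM pj mulr0.
Qed.

Lemma factors_mderiv j b :
  divides (p j) (f^`M(b) - cofactor_of j * (p j)^`M(b)).
Proof. by exists (cofactor_of j)^`M(b); rewrite {1}(cofactorE j) mderivM; ring. Qed.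

Variables (A : 'I_n.+1 -> 'M[K]_n.+1) (H : 'M[{mpoly K[n.+1]}]_n.+1).
Hypothesis A_eigen : forall j, eigen_field f (A j).
Hypothesis A_span : forall X c, lvf X f = c *: f -> exists a : 'I_n.+1 -> K, X = \sum_j a j *: A j.
Hypothesis HM : H *m field_mx A = f%:M.
Implicit Types (X Y : 'M[K]_n.+1).
Notation g := (lieg A).
Let liegE X : X \in g <-> eigen_field f X := liegP A_eigen A_span X.

(** The values on the [A i] are extended through coordinates, so that each [chi j] is linear on all
    matrices. *)
Lemma characters_ex : exists chi : 'I_k -> 'M[K]_n.+1 -> K,
  (forall j c X Y, chi j (c *: X + Y) = c * chi j X + chi j Y) /\
  (forall j X, X \in g -> lvf X (p j) = chi j X *: p j).
Proof.
have [_ ps _] := fac.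
have /choice[a ha] (ji : 'I_k * 'I_n.+1) : exists a, lvf (A ji.2) (p ji.1) = a *: p ji.1.
  have [c hc] := A_eigen ji.2; apply: (prime_factor_lvf (q := cofactor_of ji.1) (c := c)) => //.
    exact: cofactor_prime.
  by rewrite -cofactorE.
exists (fun j X => \sum_i coord (mktuple A) i X * a (j, i)); split=> [j c X Y|j X Xg].
  rewrite mulr_sumr -big_split; apply: eq_bigr => i _ /=.
  by rewrite linearP mulrDl mulrA.
rewrite {1}(coord_span Xg) scaler_suml.
have lsum (c : 'I_n.+1 -> K) (F : 'I_n.+1 -> 'M[K]_n.+1) h :
    lvf (\sum_i c i *: F i) h = \sum_i c i *: lvf (F i) h.
  elim/big_rec2: _ => [|i Y Z _ <-]; last by rewrite lvfDl lvfZl.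
  by rewrite lvf0l.
rewrite lsum; apply: eq_bigr => i _.
by rewrite -tnth_nth tnth_mktuple (ha (j, i)) scalerA.
Qed.

Variable chi : 'I_k -> 'M[K]_n.+1 -> K.
Hypothesis chiL : forall j c X Y, chi j (c *: X + Y) = c * chi j X + chi j Y.
Hypothesis chiP : forall j X, X \in g -> lvf X (p j) = chi j X *: p j.

Lemma chi_bracket j X Y : X \in g -> Y \in g -> chi j (X * Y - Y * X) = 0.
Proof.
move=> Xg Yg; have [_ ps _] := fac; have [p0 _ _] := ps j.
have Bg := lieg_bracket A_eigen A_span Xg Yg.
have := lvf_comm Y X (p j); rewrite mulmxE.
rewrite [in RHS](chiP j Bg) (chiP j Xg) (chiP j Yg) !lvfZ (chiP j Xg) (chiP j Yg).
by rewrite !scalerA mulrC subrr => /esym/eqP; rewrite scaler_eq0 (negbTE p0) orbF => /eqP.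
Qed.

Lemma functional_characters (phi : 'M[K]_n.+1 -> K) :
  (forall c X Y, phi (c *: X + Y) = c * phi X + phi Y) ->
  (forall X Y, X \in g -> Y \in g -> phi (X * Y - Y * X) = 0) ->
  exists lam : 'I_k -> K, forall X, X \in g -> phi X = \sum_j lam j * chi j X.
Proof.
move=> phiL phiB; have [_ ps _] := fac; have f0 := reduced_neq0 rf.
pose P := form_coef A H phi.
have cl := form_closed rf A_eigen A_span HM phiL phiB.
have /choice[lam hl] j : exists lam : K, forall b, divides (p j) (P b - lam *: f^`M(b)).
  exact: (residue_const rf (cofactorE j) (ps j) cl).
exists lam => X Xg.
(* [R] holds the coefficients of f times the form w minus the sum of the lam_j dp_j / p_j. That form
   has no residues left, hence no poles: f divides [R]. *)
pose R b := P b + \sum_j (- lam j)%:MP * (cofactor_of j * (p j)^`M(b)).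
have /choice[Q hQ] b : exists Q, R b = f * Q.
  have [|Q eQ] := @factors_divide (R b); last by exists Q; rewrite eQ mulrC.
  move=> i; have -> : R b = (P b - lam i *: f^`M(b))
      + (lam i)%:MP * (f^`M(b) - cofactor_of i * (p i)^`M(b))
      + \sum_(j < k | j != i) (- lam j)%:MP * (cofactor_of j * (p j)^`M(b)).
    by rewrite /R (bigD1 i) //= rmorphN /= -mul_mpolyC; ring.
  apply: dividesD.
    by apply: dividesD => //; apply: divides_mull; apply: factors_mderiv.
  apply: divides_sum => j ji; apply: divides_mull.
  rewrite mulrC; apply: divides_mull; apply: divides_cofactor.
  by rewrite eq_sym.
have e : contract X R = phi X *: f + \sum_j (- lam j * chi j X) *: f.
  rewrite contractD (contract_form rf A_eigen A_span HM phiL Xg) contract_sum; congr (_ + _).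
  apply: eq_bigr => j _.
  rewrite contractM contractM -[contract X _]/(lvf X (p j)) chiP //.
  rewrite -[RHS]mul_mpolyC (cofactorE j) -mul_mpolyC rmorphM /=; ring.
have e2 : contract X R = f * contract X Q.
  by rewrite -contractM; apply: eq_bigr => b _; rewrite hQ.
have e3 : (phi X + \sum_j - lam j * chi j X)%:MP = contract X Q.
  apply: (mulfI f0); rewrite -e2 e -scaler_suml -scalerDl mulrC mul_mpolyC //.
(* The contraction of a polynomial form with a linear field vanishes at the origin, so the constant
   is 0. *)
have : phi X + \sum_j - lam j * chi j X = 0.
  have := congr1 (meval (vec_coord (0 : 'cV[K]_n.+1))) e3; rewrite mevalC => ->.
  rewrite (raddf_sum (meval (vec_coord (0 : 'cV[K]_n.+1)))).
  by rewrite big1 // => b _ /=; rewrite mevalM lform_eval0 mul0r.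
move/eqP; rewrite addr_eq0 => /eqP->; rewrite -sumrN; apply: eq_bigr => j _.
by rewrite mulNr opprK.
Qed.

(** A relation makes the sum of the c_j dp_j / p_j vanish. Multiplied by f and reduced modulo p_i,
    only the term of index i survives, and for nonzero c_i some coefficient of it is not divisible
    by p_i. *)
Lemma characters_free (c : 'I_k -> K) :
  (forall X, X \in g -> \sum_j c j * chi j X = 0) -> forall j, c j = 0.
Proof.
move=> h i; have [_ ps _] := fac; have [p0 np hp] := ps i.
pose F b := \sum_j (c j)%:MP * (cofactor_of j * (p j)^`M(b)).
have F0 : forall b, F b = 0.
  apply: (contract_eq0 rf HM) => l; have Ag : A l \in g by apply/liegE.
  transitivity ((\sum_j c j * chi j (A l))%:MP * f); last by rewrite (h _ Ag) mpolyC0 mul0r.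
  rewrite contract_sum rmorph_sum mulr_suml.
  apply: eq_bigr => j _; rewrite contractM contractM -[contract _ _]/(lvf (A l) (p j)) chiP //.
  rewrite (cofactorE j) -mul_mpolyC rmorphM /=; ring.
have [b nb] := prime_mderiv (ps i).
have [//|ci] := eqVneq (c i) 0; exfalso.
have : divides (p i) (cofactor_of i * (p i)^`M(b)).
  have e : cofactor_of i * (p i)^`M(b) =
      ((c i)^-1)%:MP * (F b - \sum_(j < k | j != i) (c j)%:MP * (cofactor_of j * (p j)^`M(b))).
    rewrite /F (bigD1 i) //= addrK.
    by rewrite [RHS]mulrA -mpolyCM mulVf // mpolyC1 mul1r.
  rewrite e F0; apply: divides_mull; apply: dividesB; first exact: divides0.
  apply: divides_sum => j ji; apply: divides_mull.
  rewrite mulrC; apply: divides_mull; apply: divides_cofactor; by rewrite eq_sym.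
by case/hp => // /cofactor_prime.
Qed.

Hypothesis gN : forall X, X \in g -> (forall Y, Y \in g -> \tr (X * Y) = 0) -> X = 0.

Lemma count_factors l (e : 'I_l -> 'M[K]_n.+1) :
  (forall i, centralizes g (e i)) ->
  (forall z, centralizes g z -> exists c : 'I_l -> K, z = \sum_i c i *: e i) ->
  (forall c : 'I_l -> K, \sum_i c i *: e i = 0 -> forall i, c i = 0) -> l = k.
Proof.
move=> ce espan efree.
have gB X Y := @lieg_bracket _ _ _ _ A_eigen A_span X Y.
have gC z := @lieg_centralizer _ _ _ _ _ _ rf A_eigen A_span HM z.
pose M : 'M[K]_(l, k) := \matrix_(i, j) chi j (e i).
have cD c y z : centralizes g y -> centralizes g z -> centralizes g (c *: y + z).
  by move=> cy cz X Xg; rewrite mulrDl mulrDr cz // -scalerAl -scalerAr cy.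
have c_sum (c : 'I_l -> K) : centralizes g (\sum_i c i *: e i).
  elim/big_rec: _ => [|i z _ cz]; first by move=> X _; rewrite mul0r mulr0.
  exact: cD.
have free : row_free M.
  apply: inj_row_free => v vM; apply/rowP => i; rewrite [RHS]mxE.
  apply: (efree (fun i => v 0 i)); set z := \sum_i _; have cz : centralizes g z := c_sum _.
  apply: (central_trace_eq0 gN gC cz) => y cy.
  have [|X Y Xg Yg|lam hlam] := @functional_characters (fun X => \tr (X * y)).
  - by move=> c X Y; rewrite mulrDl -scalerAl linearP.
  - by rewrite mxtrace_bracket (cy _ Yg) subrr mulr0 linear0.
  rewrite (hlam _ (gC _ cz)) big1 // => j _; rewrite (functional_sum (chiL j)).
  have /rowP/(_ j) := vM; rewrite !mxE => vj.
  rewrite [X in _ * X](_ : _ = 0) ?mulr0 // -[RHS]vj.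
  by apply: eq_bigr => i' _; rewrite mxE.
have full : row_free M^T.
  apply: inj_row_free => v vM; apply/rowP => i; rewrite [RHS]mxE.
  apply: (characters_free (c := fun i => v 0 i)).
  have [d [b [bg bspan bfree]]] := vspace_basis (gC _ (fun X _ => etrans (mul1r X) (esym (mulr1 X)))) (oner_neq0 _).
  apply: (functional_eq0 gB gN gC bg bspan bfree) => [c X Y|X Y Xg Yg|z cz].
  - rewrite mulr_sumr -big_split; apply: eq_bigr => j _ /=.
    by rewrite chiL; ring.
  - by rewrite big1 // => j _; rewrite chi_bracket // mulr0.
  have [c ->] := espan z cz.
  under eq_bigr => j _ do rewrite (functional_sum (chiL j)) mulr_sumr.
  rewrite exchange_big big1 // => i' _.
  have /rowP/(_ i') := vM; rewrite !mxE => vi.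
  rewrite -[RHS](mulr0 (c i')) -[in RHS]vi mulr_sumr; apply: eq_bigr => j _.
  by rewrite !mxE; ring.
by move: free full; rewrite /row_free mxrank_tr => /eqP-> /eqP.
Qed.
End Factors.

Local Open Scope classical_set_scope.

(** * Irreducible components *)

Section Components.
Variables (K : numClosedFieldType) (n : nat).
Variables (D : set 'cV[K]_n.+1) (f : {mpoly K[n.+1]}).
Hypothesis rf : reduced_equation D f.
Variables (k : nat) (u : {mpoly K[n.+1]}) (p : 'I_k -> {mpoly K[n.+1]}).
Hypothesis fac : factorization f u p.
Notation coord := (@vec_coord K n.+1).

Definition zeros (h : {mpoly K[n.+1]}) : set 'cV[K]_n.+1 := [set x | h.@[coord x] = 0].

Lemma zeros_closed h : zariski_closed coord (zeros h).
Proof.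
exists [set h]; apply/seteqP; split=> [x hx _ ->//|x hx].
exact: hx.
Qed.

Lemma zeros_prime j h : zeros (p j) `<=` zeros h -> divides (p j) h.
Proof.
have [_ ps _] := fac; move=> sub; apply: contrapT.
by move/(prime_nonzero_point rf (cofactorE fac j) (ps j)) => [x [/sub -> /eqP]].
Qed.

Lemma zeros_irreducible j : zariski_irreducible coord (zeros (p j)).
Proof.
have [_ ps _] := fac; have [_ _ hp] := ps j.
split; first exact: prime_zero (ps j).
move=> _ _ [S1 ->] [S2 ->] sub; apply: contrapT => /not_orP[h1 h2].
have out S : ~ zeros (p j) `<=` [set x | forall q, S q -> q.@[coord x] = 0] ->
    exists2 q, S q & ~ divides (p j) q.
  move=> h; apply: contrapT => h'; apply: h => x px q Sq.
  have [[d ->]|nd] := pselect (divides (p j) q); last by case: h'; exists q.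
  by rewrite mevalM px mulr0.
have [q1 S1q nq1] := out _ h1; have [q2 S2q nq2] := out _ h2.
have : divides (p j) (q1 * q2).
  by apply: zeros_prime => x /sub[/(_ _ S1q)|/(_ _ S2q)] e; rewrite /zeros /= mevalM e ?mul0r ?mulr0.
by case/hp.
Qed.

Lemma zerosD j : zeros (p j) `<=` D.
Proof.
by move=> x px; apply/(reducedE rf); rewrite (cofactorE fac j) mevalM px mulr0.
Qed.

Lemma irreducible_in_factor Y : zariski_irreducible coord Y -> Y `<=` D ->
  exists j, Y `<=` zeros (p j).
Proof.
move=> [Y0 iY] YD; have [uu _ ef] := fac; have [c c0 uc] := mpoly_unitP uu.
have : Y `<=` zeros (\prod_j p j).
  move=> x /YD/(reducedE rf); rewrite ef uc mevalM mevalC => /eqP.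
  by rewrite mulf_eq0 (negbTE c0) => /eqP.
elim: (index_enum _) => [|j s IH] sub.
  have [x Yx] := Y0; have := sub x Yx; rewrite /zeros /= big_nil meval1 => /eqP.
  by rewrite oner_eq0.
have [||x Yx|s1|s2] := iY (zeros (p j)) (zeros (\prod_(i <- s) p i)).
- exact: zeros_closed.
- exact: zeros_closed.
- have := sub x Yx; rewrite /zeros /= big_cons mevalM => /eqP.
  by rewrite mulf_eq0 => /orP[] /eqP; [left | right].
- by exists j.
exact: IH.
Qed.

Lemma zeros_inj i j : zeros (p i) `<=` zeros (p j) -> i = j.
Proof.
move=> /zeros_prime [d ed]; apply/eqP/contraT => ij; exfalso.
apply: (cofactor_prime rf fac (j := i)); rewrite /cofactor_of (bigD1 j) 1?eq_sym //=.
by rewrite mulrCA ed mulrAC; apply: divides_mull; apply: divides_refl.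
Qed.

Lemma components_zeros Y :
  irreducible_components coord D Y <-> exists j, Y = zeros (p j).
Proof.
split=> [[YD iY mY]|[j ->]].
  have [j Yj] := irreducible_in_factor iY YD; exists j; apply/esym.
  by apply: mY => //; [exact: zerosD | exact: zeros_irreducible].
split; [exact: zerosD | exact: zeros_irreducible |] => Y' Y'D iY' sub.
have [i Y'i] := irreducible_in_factor iY' Y'D.
have ij : j = i by apply: zeros_inj; apply: subset_trans Y'i.
by apply/seteqP; split=> //; rewrite ij.
Qed.

Lemma card_components : (irreducible_components coord D #= `I_k)%card.
Proof.
(* [I_k] is a set of natural numbers here, so the family needs a default value, [set0], outside
   it. *)
pose F (m : nat) := if insub m is Some j then zeros (p j) else set0.
have -> : irreducible_components coord D = F @` `I_k.
  apply/seteqP; split=> [Y /components_zeros[j ->]|_ [m mk <-]].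
    exists (nat_of_ord j); first exact: ltn_ord.
    by rewrite /F; case: insubP => [i _ /val_inj->//|]; rewrite ltn_ord.
  by apply/components_zeros; exists (Ordinal mk); rewrite /F insubT.
apply: inj_card_eq => m m'; rewrite !inE /= => mk mk'.
rewrite /F !insubT => e; have := @zeros_inj (Ordinal mk) (Ordinal mk').
by rewrite [X in X `<=` _](e : zeros (p (Ordinal mk)) = zeros (p (Ordinal mk'))) => /(_ (@subset_refl _ _)) [].
Qed.
End Components.

Local Close Scope classical_set_scope.

(** * Quivers *)

(** The matrices 1 + (t - 1) p form a one-parameter group, which preserves [D] because it commutes
    with the [A j]. Dimension 0 is included because [rep_dim] is not visibly a successor. *)
Lemma idempotent_torus_in_group (K : numClosedFieldType) n (D : set 'cV[K]_n) G (p : 'M[K]_n) t :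
  linear_free_divisor D -> associated_group D G ->
  p *m p = p -> (forall h, G h -> h *m p = p *m h) -> t != 0 -> G (1%:M + (t - 1) *: p).
Proof.
case: n D G p => [|n] D G p lfd hG pp cp t0.
  rewrite [_ + _](_ : _ = 1%:M) ?[_ + _]flatmx0 ?[RHS]flatmx0 //.
  by case: hG => -[].
have [f [A [H [rf A_eigen A_span _ HM]]]] := lfd_basis lfd.
have f1 := one_eigen rf A_eigen A_span HM.
have cA j : A j *m p = p *m A j := lie_commute rf hG f1 cp (A_eigen j).
pose E : 'M[{poly K}]_n.+1 := 1%:M + ('X - 1) *: map_mx polyC p.
have EE s : at_point E s = 1%:M + (s - 1) *: p.
  apply/matrixP => i j; rewrite !mxE rmorphD rmorphM /= !horner_evalE hornerD hornerN.
  by rewrite hornerX !hornerC hornerMn hornerC.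
have EM r s : (1%:M + (r - 1) *: p) *m (1%:M + (s - 1) *: p) = 1%:M + (r * s - 1) *: p.
  rewrite mulmxDr !mulmxDl !mulmx1 mul1mx -scalemxAl -scalemxAr pp scalerA -!addrA -!scalerDl.
  by congr (_ + _ *: _); ring.
have EV s : s != 0 -> (1%:M + (s^-1 - 1) *: p) *m (1%:M + (s - 1) *: p) = 1%:M.
  by move=> s0; rewrite EM mulVf // subrr scale0r addr0.
rewrite -EE; apply: (curve_in_group hG (B := [set t | t != 0]%classic)) => //=.
- exact: poly_eval_neq0.
- by exists 1; rewrite ?oner_neq0 // EE subrr scale0r addr0.
- by move=> r s r0 s0; exists (r * s); rewrite ?mulf_neq0 // !EE EM.
- by move=> s s0; exists s^-1; rewrite ?invr_neq0 // !EE EV.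
move=> s x s0; rewrite EE; apply: (discriminant_stable rf A_eigen HM).
  by have /mulmx1_unit[] := EV s s0.
by move=> j; rewrite mulmxDr mulmxDl mulmx1 mul1mx -scalemxAr -scalemxAl cA.
Qed.

Section Quiver.
Variables (K : numClosedFieldType) (Q : quiver) (d : vertex Q -> nat).
Implicit Types (a al : arrow Q).
Notation N := (rep_dim d).

Lemma rep_of_vec_of (X : forall a, 'M[K]_(d (tgt a), d (src a))) a : rep_of (vec_of X) a = X a.
Proof. by apply/matrixP => i j; rewrite !mxE enum_rankK. Qed.

Lemma rep_of_inj (x y : 'cV[K]_N) : (forall a, rep_of x a = rep_of y a) -> x = y.
Proof.
move=> h; apply/colP => k; rewrite -(enum_valK k).
case: (enum_val k) => a [i j]; have /matrixP/(_ i j) := h a.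
by rewrite !mxE.
Qed.

Definition arrow_proj al : 'M[K]_N := diag_mx (\row_k (tag (enum_val k) == al)%:R).

Lemma rep_of_proj al x a : rep_of (arrow_proj al *m x) a = (a == al)%:R *: rep_of x a.
Proof. by apply/matrixP => i j; rewrite [LHS]mxE mul_diag_mx !mxE enum_rankK. Qed.

Lemma rep_of_act (g : forall i, 'M[K]_(d i)) x a :
  rep_of (rep_act g x) a = g (tgt a) *m rep_of x a *m invmx (g (src a)).
Proof. exact: rep_of_vec_of. Qed.

Lemma arrow_proj_idem al : arrow_proj al *m arrow_proj al = arrow_proj al.
Proof.
rewrite mulmx_diag; congr diag_mx; apply/rowP => k; rewrite !mxE.
by case: eqP; rewrite ?mulr1 ?mulr0.
Qed.

Lemma arrow_proj_comm al P : @GL_image K Q d P -> P *m arrow_proj al = arrow_proj al *m P.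
Proof.
move=> [g _ hP]; apply: mx_ext => x; rewrite -!mulmxA !hP; apply: rep_of_inj => a.
rewrite rep_of_proj !rep_of_act rep_of_proj.
by rewrite -scalemxAr -scalemxAl.
Qed.

Lemma arrow_torus al : defines_linear_free_divisor K d ->
  exists2 h : forall i, 'M[K]_(d i), in_GL h &
  forall x a, h (tgt a) *m rep_of x a = (1 + (a == al)%:R) *: rep_of x a *m h (src a).
Proof.
move=> [D [_ lfd hG _]].
have n2 : 2%:R != 0 :> K by rewrite pnatr_eq0.
have [h hu hh] := idempotent_torus_in_group lfd hG (arrow_proj_idem al) (@arrow_proj_comm al) n2.
exists h => // x a; have := congr1 (fun y => rep_of y a *m h (src a)) (hh x).
rewrite rep_of_act mulmxKV // => <-; congr (_ *m _).
apply/matrixP => i j; rewrite mulmxDl mul1mx -scalemxAl.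
have /matrixP/(_ i j) := rep_of_proj al x a; rewrite !mxE => ->.
by ring.
Qed.

Hypothesis ds : sincere d.

Lemma arrow_weights al : defines_linear_free_divisor K d ->
  exists mu : vertex Q -> K, mu (tgt al) != 0 /\
  forall a, mu (tgt a) = (1 + (a == al)%:R) * mu (src a).
Proof.
move=> /(arrow_torus al)[h hu hh].
pose z i : 'I_(d i) := Ordinal (ds i).
(* A matrix unit on every arrow, at the first basis vectors, which exist because [d] is sincere. By
   [col] the first column of [h] at a target has no entry off the diagonal, so a zero on the
   diagonal would make [h] singular. *)
pose x := vec_of (fun a => delta_mx (z (tgt a)) (z (src a)) : 'M[K]_(_, _)).
have col a i : h (tgt a) i (z (tgt a)) = (i == z (tgt a))%:R * ((1 + (a == al)%:R) * h (src a) (z (src a)) (z (src a))).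
  have := hh x a; rewrite /x rep_of_vec_of => /matrixP/(_ i (z (src a))).
  rewrite mxE (bigD1 (z (tgt a))) //= big1 => [|j jz]; last by rewrite mxE (negbTE jz) mulr0.
  rewrite mxE !eqxx mulr1 addr0 => ->; rewrite mxE (bigD1 (z (src a))) //= big1 => [|j jz].
    by rewrite !mxE eqxx andbT addr0; ring.
  by rewrite !mxE (negbTE jz) andbF mulr0 mul0r.
exists (fun i => h i (z i) (z i)); split=> [|a]; last by rewrite col eqxx mul1r.
apply/eqP => mu0; have : h (tgt al) *m delta_mx (z (tgt al)) (z (tgt al)) = 0 :> 'M_(_, d (tgt al)).
  apply/matrixP => i j; rewrite mxE (bigD1 (z (tgt al))) //= big1 => [|l lz].
    rewrite !mxE eqxx addr0 col; move: mu0; rewrite col eqxx mul1r => ->.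
    by rewrite mulr0 mul0r.
  by rewrite mxE (negbTE lz) mulr0.
move/(congr1 (mulmx (invmx (h (tgt al))))); rewrite mulKmx // mulmx0.
move/matrixP/(_ (z (tgt al)) (z (tgt al))); rewrite !mxE !eqxx => /eqP.
by rewrite oner_eq0.
Qed.

Lemma quiver_acyclic c : defines_linear_free_divisor K d -> ~~ @quiver_cycle Q c.
Proof.
move=> dl; apply/negP; case: c => [|[al b] s] // /and4P[_ cyc /= /andP[als _] _].
have [mu [mu0 hmu]] := arrow_weights al dl.
have flat v : v.1 != al -> mu (step_src v) = mu (step_tgt v).
  case: v => a [] /= /negbTE na; rewrite /step_src /step_tgt /= hmu na addr0 mul1r //.
(* [al] does not occur again in the cycle, so [mu] stays constant along the rest of it, back to the
   start. *)
have walk (v w : arrow Q * bool) r : path (fun u v => step_tgt u == step_src v) v (rcons r w) ->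
    al \notin [seq u.1 | u <- r] -> mu (step_tgt v) = mu (step_src w).
  elim: r v => [|y r IH] v /=; first by rewrite andbT => /eqP->.
  case/andP => /eqP-> py; rewrite inE negb_or eq_sym => /andP[ya nr].
  by rewrite flat // IH.
have := walk _ _ _ cyc als; have := hmu al; rewrite eqxx.
move=> e1 e2; case/eqP: mu0.
have e3 : mu (tgt al) = mu (src al) by case: b e2 {cyc} => /=; rewrite /step_tgt /step_src /= => ->.
have : mu (src al) = 0.
  have := e1; rewrite e3 mulrDl !mul1r -[LHS]addr0 => /addrI/esym//.
by rewrite e3.
Qed.
End Quiver.

Local Open Scope classical_set_scope.

Theorem reductive_count (K : numClosedFieldType) (n : nat) (D : set 'cV[K]_n) (G : set 'M[K]_n) :
  linear_free_divisor D -> associated_group D G -> reductive G ->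
  (exists (l : nat) (W : 'I_l -> {vspace 'cV[K]_n}), irreducible_decomposition G W) /\
  (forall (l : nat) (W : 'I_l -> {vspace 'cV[K]_n}), irreducible_decomposition G W ->
     (irreducible_components (@vec_coord K n) D #= `I_l)%card).
Proof.
case: n D G => [|n] D G lfd hG hR.
  (* In dimension 0 all polynomials are constant, so there is no hypersurface. *)
  have [f [[sf _ _] _]] := lfd; move: sf; rewrite ltnNge => /negP[].
  have -> : f = (f@_0)%:MP.
    apply/mpolyP => m; have -> : m = 0%MM by apply/mnmP => -[].
    by rewrite mcoeffC eqxx mulr1.
  by rewrite msizeC leq_b1.
have [f [A [H [rf A_eigen A_span _ HM]]]] := lfd_basis lfd.
have gN X := @lieg_trace_form _ _ _ _ _ _ rf A_eigen A_span hG X hR.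
split=> [|l W hW]; first exact: decomposition_ex rf A_eigen A_span HM hG gN.
have [e [ce espan efree]] := centralizer_basis rf A_eigen A_span HM hG gN hW.
have [k [u [p fac]]] := factorization_ex rf.
have [chi [chiL chiP]] := characters_ex rf fac A_eigen.
rewrite (count_factors rf fac A_eigen A_span HM chiL chiP gN ce espan efree).
exact: (card_components rf fac).
Qed.

Theorem theorem1p1 (R : realType) :
  (forall (n : nat) (D : set 'cV[R[i]]_n) (G : set 'M[R[i]]_n),
     linear_free_divisor D -> associated_group D G -> reductive G ->
     (exists (l : nat) (W : 'I_l -> {vspace 'cV[R[i]]_n}),
        irreducible_decomposition G W) /\
     (forall (l : nat) (W : 'I_l -> {vspace 'cV[R[i]]_n}),
        irreducible_decomposition G W ->
        (irreducible_components (@vec_coord R[i] n) D #= `I_l)%card))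
  /\
  (forall (Q : quiver) (d : vertex Q -> nat),
     connected_quiver Q -> sincere d ->
     defines_linear_free_divisor R[i] d -> is_tree Q).
Proof.
split=> [n D G|Q d cQ ds dl]; first exact: (@reductive_count R[i]).
by split=> // c; apply: (@quiver_acyclic R[i] _ _ ds).
Qed.
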